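(* Let $\mathbf{q}=(q_k)_{k\ge 1}$ be a non-zero sequence of non-negative real numbers which is admissible, with associated partition functions $W^{(\ell)}$ and constant $c_{\mathbf q}$ as defined in the context. Assume that $$\forall k\ge 1,\qquad q_k-2\,c_{\mathbf q}^{-2k}\,W^{(k)}\ \ge 0 .$$ Then there exists a slowly varying function $L_{\mathbf q}$ such that $1=O(L_{\mathbf q}(\ell))$, $L_{\mathbf q}(\ell)=O(\log \ell)$ as $\ell\to\infty$, and $$W^{(\ell)}\ \sim\ c_{\mathbf q}^{\ell+1}\,\frac{L_{\mathbf q}(\ell)}{2\ell^{2}}\qquad\text{as }\ell\to\infty .$$
   Context: A planar map is a finite connected planar graph embedded in the sphere, considered up to orientation-preserving homeomorphism, equipped with a distinguished oriented root edge; the face to the right of the root edge is the root face $f_r$. The degree $\deg(f)$ of a face is the number of edges surrounding it counted with multiplicity; the perimeter is $\deg(f_r)$. A map is bipartite if all face degrees are even. Let $\mathcal M^{(\ell)}$ be the set of finite rooted bipartite planar maps with perimeter $2\ell$. For a sequence $\mathbf q=(q_k)_{k\ge1}$ of non-negative reals, the weight of a map $\mathfrak m$ is $w_{\mathbf q}(\mathfrak m)=\prod_{f\neq f_r} q_{\deg(f)/2}$ (product over non-root faces), and $W^{(\ell)}=\sum_{\mathfrak m\in\mathcal M^{(\ell)}} w_{\mathbf q}(\mathfrak m)$. The sequence $\mathbf q$ is admissible if $W^{(\ell)}<\infty$ for all $\ell\ge1$; in that case it is known that the limit $c_{\mathbf q}=\lim_{\ell\to\infty}W^{(\ell+1)}/W^{(\ell)}$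 exists (and is finite and positive). A function $L:\mathbb R_+\to\mathbb R$ is slowly varying if $L(\lambda x)/L(x)\to1$ as $x\to\infty$ for every $\lambda>0$. *)

(* Defs.v *)
From HB Require Import structures.
From mathcomp Require Import all_boot all_order all_algebra all_fingroup.
From mathcomp Require Import all_classical all_reals all_analysis.

Set Implicit Arguments.
Unset Strict Implicit.
Unset Printing Implicit Defensive.

Import Order.TTheory GRing.Theory Num.Theory numFieldNormedType.Exports.
Local Open Scope classical_set_scope.
Local Open Scope ring_scope.

(* Combinatorial maps (rotation systems).  A map with m.+1 edges has the
   2*(m.+1) darts 'I_(m.*2.+2).  [s] is the vertex rotation, [a] the edge
   involution (fixed-point free), faces are the cycles of [s * a].
   The root dart is [ord0]; the root face is the face containing it. *)
Definition dart (m : nat) := 'I_(m.*2.+2).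

Definition face_perm (m : nat) (s a : {perm dart m}) : {perm dart m} := (s * a)%g.

Definition root_face (m : nat) (s a : {perm dart m}) : {set dart m} :=
  porbit (face_perm s a) ord0.

Definition is_bip_planar_map (m l : nat) (s a : {perm dart m}) : bool :=
  [&& [forall x, a x != x],
      [forall x, a (a x) == x],
      [forall x, forall y, connect (fun u v => (v == s u) || (v == a u)) x y],
      (* planarity (Euler): V - E + F = 2 *)
      (#|porbits s| + #|porbits (face_perm s a)| == m.+1 + 2)%N,
      [forall f in porbits (face_perm s a), ~~ odd #|f| ]
    & #|root_face s a| == l.*2 ]%N.

Definition map_weight (R : realType) (q : nat -> R) (m : nat) (s a : {perm dart m}) : R :=
  \prod_(f in porbits (face_perm s a) | f != root_face s a) q (#|f| %/ 2)%N.

(* Weighted count of rooted maps with m.+1 edges and perimeter 2l.  Every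
   rooted map with m.+1 edges has exactly (2m+1)! labelings of its darts by
   'I_(m.*2.+2) sending the root dart to ord0 (rooted maps have no
   non-trivial automorphisms), hence the normalisation. *)
Definition Wn (R : realType) (q : nat -> R) (l m : nat) : R :=
  (\sum_(s : {perm dart m}) \sum_(a : {perm dart m} | is_bip_planar_map l s a)
      map_weight q s a) / ((m.*2.+1)`!)%:R.

Definition W (R : realType) (q : nat -> R) (l : nat) : \bar R :=
  (\sum_(0 <= m <oo) (Wn q l m)%:E)%E.

Definition admissible (R : realType) (q : nat -> R) : Prop :=
  forall l, (0 < l)%N -> (W q l < +oo)%E.

(* real value of W^(l) (meaningful when q is admissible) *)
Definition Wr (R : realType) (q : nat -> R) (l : nat) : R := fine (W q l).

Definition slowly_varying (R : realType) (L : R -> R) : Prop :=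
  forall lam : R, 0 < lam -> (fun x => L (lam * x) / L x) @ +oo --> (1 : R).

(* Main.v *)
Require Import Defs.
From HB Require Import structures.
From mathcomp Require Import all_boot all_order all_algebra all_fingroup.
From mathcomp Require Import zify ring lra.

Set Implicit Arguments.
Unset Strict Implicit.
Unset Printing Implicit Defensive.

(** Root-edge deletion gives Tutte's equation for [W] (with [W_0 = 1]).  With
    [A_p = 2 W_(p-1) c^(-p)] and [B_k = q_(k+1) c^k] it reads
    [2 A = A * A + 2 (B acting by backward shifts)] in degrees at least 2, and the
    ratio limit gives [sum A + sum B <= 1].  A Wiener-Hopf factorisation then
    produces a probability [b] with [A_p = al_p - sum_k b_k al_(p+k)], where [al]
    are the coefficients of [1 - sqrt (1 - z)].

    The assumption is [B_k >= A_(k+2)]; it makes the tail [T] of [b] superharmonic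
    for the symmetrisable kernel [kap (k+j+1) ~ 1/(k+j)], whose invariant function
    is [h_k = 'C(2k,k) / 4^k].  In dyadic scale this kernel is a recurrent
    one-dimensional walk, so logarithmic cutoffs have vanishing energy.  Testing
    them against [T] (Barta) shows that [T / h] is slowly varying and bounded below;
    a Caccioppoli inequality bounds it above by a logarithm.  Finally
    [A_(p+1) = sum_i T_(i+1) (al_(p+i+1) - al_(p+i+2))] transfers regular variation
    to [A], and [L x = x^2 A_(floor x + 1)]. *)

(** * Planar maps as pairs of permutations *)

(** Tutte's equation says that the square of the two-sided series [K(z) = 1 - A(z) - B(1/z)] has no
    terms of degree at least 2. The factorisation is [K(z) = (1 - a(z)) (1 - b(1/z))] with [a], [b]
    nonnegative of mass at most 1; removing the factors [1 - b(1/z)] on that range leaves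
    [(1 - a(z))^2 = 1 - x z]. The mass bound gives [x <= 1], the ratio limit [x >= 1]. So the
    weights survive only in [b], while [al], [h] and the kernel are explicit.

    As [q] is subject to inequalities only, [T] is known just to be decreasing and superharmonic.
    Energy estimates need no more: on windows of macroscopic length, [T / h] cannot differ
    everywhere without costing energy, and monotonicity turns this into a pointwise statement. The
    kernel is exactly critical, [h_k^2] being of order [1/k]: the divergence of its sum forces [b]
    to have mass 1, and the number of dyadic blocks below [l] is the source of the logarithm. *)

Definition cls (T : finType) (e : rel T) (x : T) : {set T} := [set y | e x y].
(** Vertices, faces and components are all counted as classes of an equivalence relation, so that
    one statement on disjoint unions and one on relabelling serve all three. *)
Definition nclass (T : finType) (e : rel T) : nat := #|cls e @: [set: T]|.

Lemma eq_nclass (T : finType) (e e' : rel T) : e =2 e' -> nclass e = nclass e'.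
Proof.
move=> E; rewrite /nclass; congr #|pred_of_set _|.
by apply: eq_imset => x; apply/setP => y; rewrite !inE E.
Qed.

Lemma cls_eq (T : finType) (e : rel T) (x y : T) :
  equivalence_rel e -> (cls e x == cls e y) = e x y.
Proof.
move=> eE; have exx z : e z z by exact: (eE z z z).1.
apply/eqP/idP => [E|exy].
  by have : y \in cls e y; [rewrite inE exx|rewrite -E inE].
by apply/setP => z; rewrite !inE ((eE x y z).2 exy).
Qed.

(** The new classes are the old ones with [cls e y] deleted, after it has been adjoined to the class
    of [x]. *)
Lemma nclass_sew (T : finType) (e e' : rel T) (x y : T) :
  equivalence_rel e -> equivalence_rel e' ->
  (forall u v, e' u v = [|| e u v, e u x && e y v | e u y && e x v]) ->
  nclass e' + ~~ e x y = nclass e.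
Proof.
move=> eE eE' E'.
have exx z : e z z by exact: (eE z z z).1.
have eC u v : e u v = e v u by apply/idP/idP => h; [rewrite -((eE u v u).2 h)|rewrite -((eE v u v).2 h)].
have eT u v w : e u v -> e v w -> e u w by move=> /(eE u v w).2 ->.
case exy: (e x y) => /=.
  rewrite addn0; apply: eq_nclass => u v; rewrite E'.
  apply/idP/idP => [|->//]; case/or3P => [//|/andP[h1 h2]|/andP[h1 h2]].
    exact: eT (eT _ _ _ h1 exy) h2.
  by apply: eT (eT _ _ _ h1 _) h2; rewrite eC.
rewrite /nclass addn1.
have [Cx Cy] : cls e x \in cls e @: [set: T] /\ cls e y \in cls e @: [set: T].
  by split; apply: imset_f; rewrite inE.
rewrite (cardsD1 (cls e y) (cls e @: _)) Cy add1n; congr _.+1.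
pose g (X : {set T}) := if x \in X then X :|: cls e y else X.
have gE z : ~~ e y z -> g (cls e z) = cls e' z.
  move=> yz; rewrite /g inE; apply/setP => w; case: ifP => zx; rewrite !inE E'.
    by rewrite zx (eC z y) (negPf yz) /= ?orbF.
  by rewrite zx (eC z y) (negPf yz) /= ?orbF.
have -> : cls e' @: [set: T] = g @: (cls e @: [set: T] :\ cls e y).
  apply/setP => X; apply/imsetP/imsetP => [[z _ ->]|[Y]].
    have [yz|yz] := boolP (e y z); last first.
      exists (cls e z); last by rewrite gE.
      by rewrite !inE cls_eq // (eC z y) yz; apply: imset_f; rewrite inE.
    exists (cls e x); first by rewrite in_setD1 cls_eq // exy Cx.
    rewrite gE; last by rewrite eC exy.
    by apply/eqP; rewrite cls_eq // E' (eC z y) yz exx !orbT.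
  rewrite in_setD1 => /andP[Yy /imsetP[z _ Y_z]] ->; exists z => //; rewrite Y_z gE //.
  by apply: contra Yy => yz; rewrite Y_z cls_eq // eC.
rewrite card_in_imset // => X Y; rewrite !inE => /andP[Xy /imsetP[z _ Xz]].
move=> /andP[Yy /imsetP[w _ Yw]]; subst X Y.
have yz : ~~ e y z by apply: contra Xy; rewrite cls_eq // eC.
have yw : ~~ e y w by apply: contra Yy; rewrite cls_eq // eC.
rewrite !gE // => /eqP; rewrite cls_eq // E' (eC z y) (negPf yz) (negPf yw) andbF.
by rewrite /= ?orbF => zw; apply/eqP; rewrite cls_eq.
Qed.

Lemma nclass_closed (T : finType) (e : rel T) (B : {set T}) :
  equivalence_rel e -> (forall x y, e x y -> (x \in B) = (y \in B)) ->
  nclass e = #|cls e @: B| + #|cls e @: ~: B|.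
Proof.
move=> eE cB; rewrite /nclass -(setUCr B) imsetU cardsU.
rewrite (_ : _ :&: _ = set0) ?cards0 ?subn0 //.
apply/setP => X; rewrite !inE; apply/negP => /andP[/imsetP[x xB ->] /imsetP[y]].
by rewrite inE => yB /eqP; rewrite cls_eq // => /cB; rewrite xB (negPf yB).
Qed.

Lemma card_cls_trivial (T : finType) (e : rel T) (B : {set T}) :
  (forall x y, x \in B -> e x y = (x == y)) -> #|cls e @: B| = #|B|.
Proof.
move=> tB; rewrite card_in_imset // => x y xB yB /setP/(_ y).
by rewrite !inE !tB // eqxx => /eqP.
Qed.

(** Each of [e1], [e2] also counts singletons on the side where it is trivial; these, [#|T|] in all,
    are the correction term. *)
Lemma nclass_disjoint (T : finType) (e e1 e2 : rel T) (B : {set T}) :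
  equivalence_rel e1 -> equivalence_rel e2 -> equivalence_rel e ->
  (forall x y, x \notin B -> e1 x y = (x == y)) ->
  (forall x y, x \in B -> e2 x y = (x == y)) ->
  (forall x y, e x y = if x \in B then e1 x y else e2 x y) ->
  nclass e + #|T| = nclass e1 + nclass e2.
Proof.
move=> E1 E2 E t1 t2 eE.
have sym (r : rel T) : equivalence_rel r -> symmetric r.
  move=> R u v; have rr z : r z z by exact: (R z z z).1.
  by apply/idP/idP => h; [rewrite -((R u v u).2 h)|rewrite -((R v u v).2 h)].
have c1 x y : e1 x y -> (x \in B) = (y \in B).
  move=> xy; case: (boolP (x \in B)) => xB; last by move: xy; rewrite t1 // => /eqP <-; rewrite (negPf xB).
  by apply/esym; apply: contraTT xy => yB; rewrite sym // t1 //; apply: contraNneq yB => ->.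
have c2 x y : e2 x y -> (x \in B) = (y \in B).
  move=> xy; case: (boolP (x \in B)) => xB; first by move: xy; rewrite t2 // => /eqP <-.
  apply/esym/negbTE; apply: contraL xy => yB; rewrite sym // t2 //.
  by apply: contraNneq xB => <-.
have c x y : e x y -> (x \in B) = (y \in B).
  by rewrite eE; case: ifP => xB h; [rewrite -xB (c1 _ _ h)|rewrite -xB (c2 _ _ h)].
rewrite (nclass_closed E c) (nclass_closed E1 c1) (nclass_closed E2 c2).
rewrite (@card_cls_trivial _ e1 (~: B)); last by move=> x y; rewrite inE => /t1.
rewrite (@card_cls_trivial _ e2 B) // -(cardsC B).
have -> : [set cls e x | x in B] = [set cls e1 x | x in B].
  by apply: eq_in_imset => x xB; apply/setP => y; rewrite !inE eE xB.
have -> : [set cls e x | x in ~: B] = [set cls e2 x | x in ~: B].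
  by apply: eq_in_imset => x; rewrite inE => xB; apply/setP => y; rewrite !inE eE (negPf xB).
by rewrite (addnC #|B|) addnACA; congr (_ + _); rewrite addnC.
Qed.

Local Open Scope group_scope.

Definition step (T : finType) (s a : {perm T}) : rel T :=
  fun u v => (v == s u) || (v == a u).
Definition ncc (T : finType) (s a : {perm T}) : nat := nclass (connect (step s a)).
Definition ncyc (T : finType) (s : {perm T}) : nat := #|porbits s|.
Definition supp (T : finType) (a : {perm T}) : {set T} := [set x | a x != x].
(* [supp a] counts the darts matched by the edge involution [a], so this is
   V - E + F = 2 * (number of components) multiplied by 2; a fixed point of [a]
   (a leg) contributes no edge. *)
Definition euler (T : finType) (s a : {perm T}) : bool :=
  (ncyc s + ncyc (s * a)).*2 == #|supp a| + (ncc s a).*2.*2.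

Lemma porbit_equiv (T : finType) (s : {perm T}) :
  equivalence_rel (fun x y => y \in porbit s x).
Proof.
move=> x y z; split; first exact: porbit_id.
by rewrite -eq_porbit_mem => /eqP ->.
Qed.

Lemma ncycE (T : finType) (s : {perm T}) :
  ncyc s = nclass (fun x y => y \in porbit s x).
Proof.
rewrite /ncyc /porbits /nclass; congr #|pred_of_set _|.
apply/setP => X; apply/imsetP/imsetP => -[x _ ->]; exists x; rewrite ?inE //.
  by apply/setP => y; rewrite inE.
by apply/setP => y; rewrite inE.
Qed.

Lemma porbit_closed (T : finType) (s : {perm T}) (B : {set T}) x :
  (forall y, y \in B -> s y \in B) -> x \in B -> porbit s x \subset B.
Proof.
move=> cB xB; apply/subsetP => y /porbitP[i ->]; elim: i => [|i IH]; first by rewrite expg0 perm1.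
by rewrite expgSr permM cB.
Qed.

Lemma mem_porbitS (T : finType) (s : {perm T}) x y :
  (s y \in porbit s x) = (y \in porbit s x).
Proof. by rewrite !(porbit_sym _ _ x) -(porbit_perm s 1 y) expg1. Qed.

Lemma eq_in_porbit (T : finType) (s s' : {perm T}) x :
  (forall y, y \in porbit s x -> s' y = s y) -> porbit s' x = porbit s x.
Proof.
move=> E; suff H n : (s' ^+ n) x = (s ^+ n) x.
  by apply/setP => y; apply/porbitP/porbitP => -[i ->]; exists i; rewrite H.
elim: n => [|n IH]; first by rewrite !expg0.
by rewrite !expgSr !permM IH E // mem_porbit.
Qed.

Lemma porbit_sew (T : finType) (s : {perm T}) x y : y \notin porbit s x ->
  porbit (s * tperm x y) x = porbit s x :|: porbit s y.
Proof.
move=> yx; set u := s * _.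
have uE z : s z != x -> s z != y -> u z = s z.
  by move=> zx zy; rewrite permM tpermD // eq_sym.
have sub1 z w : z \in [:: x; y] -> w \in porbit s z -> w \in porbit u z.
  move=> zxy /porbitP[i ->]; elim: i => [|i IH].
    by rewrite expg0 perm1 porbit_id.
  rewrite expgSr permM; set v := (s ^+ i) z in IH *.
  have vz : s v \in porbit s z by rewrite mem_porbitS mem_porbit.
  move: zxy vz IH; rewrite !inE => /orP[] /eqP -> vz IH.
    have [->|nx] := eqVneq (s v) x; first exact: porbit_id.
    have [E|ny] := eqVneq (s v) y; first by rewrite -E vz in yx.
    by rewrite -uE // mem_porbitS.
  have [->|ny] := eqVneq (s v) y; first exact: porbit_id.
  have [E|nx] := eqVneq (s v) x; first by rewrite porbit_sym -E vz in yx.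
  by rewrite -uE // mem_porbitS.
have xuy : x \in porbit u y.
  have : s^-1 y \in porbit u y.
    apply: sub1; first by rewrite !inE eqxx orbT.
    by rewrite -mem_porbitS permKV porbit_id.
  by rewrite -mem_porbitS permM permKV tpermR.
apply/eqP; rewrite eqEsubset; apply/andP; split.
  apply: porbit_closed; last by rewrite inE porbit_id.
  move=> z; rewrite permM => zO.
  have szO : s z \in porbit s x :|: porbit s y by rewrite inE !mem_porbitS -in_setU.
  by case: tpermP => // _; rewrite inE porbit_id ?orbT.
apply/subsetP => z; rewrite inE => /orP[zx|zy]; first by apply: sub1; rewrite // inE eqxx.
have := sub1 y z; rewrite !inE eqxx orbT => /(_ isT zy).
by move: xuy; rewrite -eq_porbit_mem => /eqP <-.
Qed.

Lemma ncyc_mul_tperm (T : finType) (s : {perm T}) x y :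
  (ncyc (s * tperm x y) + (x \notin porbit s y).*2 = ncyc s + (x != y))%N.
Proof.
rewrite /ncyc -[porbits (s * _)]porbitsV invMg tpermV -(porbitV s) -(porbitsV s).
exact: porbits_mul_tperm.
Qed.

Lemma connect_s (T : finType) (s a : {perm T}) x y :
  y \in porbit s x -> connect (step s a) x y.
Proof.
move=> /porbitP[i ->]; elim: i => [|i IH]; first by rewrite expg0 perm1.
by rewrite expgSr permM (connect_trans IH) // connect1 // /step eqxx.
Qed.

Lemma connect_a (T : finType) (s a : {perm T}) x y :
  y \in porbit a x -> connect (step s a) x y.
Proof.
move=> /porbitP[i ->]; elim: i => [|i IH]; first by rewrite expg0 perm1.
by rewrite expgSr permM (connect_trans IH) // connect1 // /step eqxx orbT.
Qed.

Lemma connect_step_sym (T : finType) (s a : {perm T}) : connect_sym (step s a).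
Proof.
apply: symmetric_from_pre => x y /connectP[p]; elim: p x => [|z p IH] x /=.
  by move=> _ ->.
case/andP=> xz pth ye; apply: connect_trans (IH _ pth ye) _.
case/orP: xz => /eqP ->.
  by apply: connect_s; rewrite porbit_sym mem_porbitS porbit_id.
by apply: connect_a; rewrite porbit_sym mem_porbitS porbit_id.
Qed.

Lemma connect_equiv (T : finType) (s a : {perm T}) :
  equivalence_rel (connect (step s a)).
Proof.
move=> x y z; split=> // xy; apply/idP/idP; last exact: connect_trans.
by apply: connect_trans; rewrite connect_step_sym.
Qed.

Lemma connect_mul (T : finType) (s a : {perm T}) :
  connect (step (s * a) a) =2 connect (step s a).
Proof.
have H (u b : {perm T}) x y : connect (step (u * b) b) x y -> connect (step u b) x y.
  move: x y; apply: connect_sub => x y /orP[] /eqP ->.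
    rewrite permM (connect_trans (connect1 (_ : step u b x (u x)))) ?/step ?eqxx //.
    by rewrite connect1 // /step eqxx orbT.
  by rewrite connect1 // /step eqxx orbT.
move=> x y; apply/idP/idP; first exact: H.
move: x y; apply: connect_sub => x y /orP[] /eqP ->.
  apply: connect_trans (connect1 (_ : step (s * a) a x ((s * a) x))) _.
    by rewrite /step eqxx.
  by apply: connect_a; rewrite porbit_sym permM mem_porbitS porbit_id.
by rewrite connect1 // /step eqxx orbT.
Qed.

Lemma ncc_mul (T : finType) (s a : {perm T}) : ncc (s * a) a = ncc s a.
Proof. by apply: eq_nclass => x y; rewrite connect_mul. Qed.

Lemma ncc1 (T : finType) (s : {perm T}) : ncc s 1 = ncyc s.
Proof.
rewrite ncycE; apply: eq_nclass => x y; apply/idP/idP; last exact: connect_s.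
move=> /connectP[p]; elim: p x => [|z p IH] x /=; first by move=> _ ->; rewrite porbit_id.
case/andP=> xz pth ye; move: (IH _ pth ye).
by case/orP: xz => /eqP ->; rewrite ?perm1 // ![y \in _]porbit_sym mem_porbitS.
Qed.

(** * Gluing two legs into an edge, and Euler's inequality *)

Section Sew.
Variables (T : finType) (s a : {perm T}) (x y : T).
Hypotheses (aI : involutive a) (ax : a x = x) (ay : a y = y) (xy : x != y).
Let t := tperm x y.

Lemma sew_commute : t * a = a * t.
Proof.
have : t ^ a = t by rewrite tpermJ ax ay.
by rewrite conjgE => /(congr1 (mulg a)); rewrite !mulgA mulgV mul1g.
Qed.

Lemma sewI : involutive (a * t).
Proof.
move=> z; rewrite !permM.
have := congr1 (fun p : {perm T} => p (t (a z))) sew_commute.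
by rewrite !permM => <-; rewrite tpermK aI.
Qed.

Lemma sew_supp : supp (a * t) = [set x; y] :|: supp a.
Proof.
apply/setP => z; rewrite !inE permM.
have [->|zx] := eqVneq z x; first by rewrite ax tpermL eq_sym xy.
have [->|zy] := eqVneq z y; first by rewrite ay tpermR xy.
rewrite tpermD //=.
  by apply: contra zx => /eqP h; rewrite -(aI z) -h ax.
by apply: contra zy => /eqP h; rewrite -(aI z) -h ay.
Qed.

Lemma sew_card_supp : #|supp (a * t)| = #|supp a|.+2.
Proof.
rewrite sew_supp cardsU (_ : _ :&: _ = set0) ?cards0 ?subn0 ?cards2 ?xy //.
by apply/setP => z; rewrite !inE; apply/negP => /andP[/orP[] /eqP ->]; rewrite ?ax ?ay eqxx.
Qed.

Lemma sew_connect u v :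
  connect (step s (a * t)) u v = [|| connect (step s a) u v,
    connect (step s a) u x && connect (step s a) y v |
    connect (step s a) u y && connect (step s a) x v].
Proof.
have H1 : subrel (connect (step s a)) (connect (step s (a * t))).
  apply: connect_sub => {u v} u v /orP[] /eqP ->; first by rewrite connect1 // /step eqxx.
  have [->|ux] := eqVneq u x; first by rewrite ax.
  have [->|uy] := eqVneq u y; first by rewrite ay.
  rewrite connect1 // /step permM tpermD ?eqxx ?orbT //.
    by apply: contra ux => /eqP h; rewrite -(aI u) -h ax.
  by apply: contra uy => /eqP h; rewrite -(aI u) -h ay.
have H2 : connect (step s (a * t)) x y by rewrite connect1 // /step permM ax tpermL eqxx orbT.
apply/idP/idP; last first.
  case/or3P => [/H1 //|/andP[/H1 h1 /H1 h2]|/andP[/H1 h1 /H1 h2]].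
    exact: connect_trans (connect_trans h1 H2) h2.
  by apply: connect_trans (connect_trans h1 _) h2; rewrite connect_step_sym.
move=> /connectP[p]; elim: p u => [|z p IH] u /=; first by move=> _ ->; rewrite connect0.
case/andP=> uz pth ve; have {}IH := IH _ pth ve.
have [cuz|[[ux zy]|[uy zx]]] : connect (step s a) u z \/ ((u = x /\ z = y) \/ (u = y /\ z = x)).
- case/orP: uz => /eqP ->; first by left; rewrite connect1 // /step eqxx.
  have [->|ux] := eqVneq u x; first by right; left; rewrite permM ax tpermL.
  have [->|uy] := eqVneq u y; first by right; right; rewrite permM ay tpermR.
  left; rewrite connect1 // /step permM tpermD ?eqxx ?orbT //.
    by apply: contra ux => /eqP h; rewrite -(aI u) -h ax.
  by apply: contra uy => /eqP h; rewrite -(aI u) -h ay.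
- case/or3P: IH => [h|/andP[h1 h2]|/andP[h1 h2]].
  + by rewrite (connect_trans cuz h).
  + by rewrite (connect_trans cuz h1) h2 orbT.
  + by rewrite (connect_trans cuz h1) h2 !orbT.
- subst u z; case/or3P: IH => [h|/andP[h1 h2]|/andP[h1 h2]].
  + by rewrite connect0 h orbT.
  + by rewrite connect0 h2 !orbT.
  + by rewrite h2.
- subst u z; case/or3P: IH => [h|/andP[h1 h2]|/andP[h1 h2]].
  + by rewrite connect0 h !orbT.
  + by rewrite h2.
  + by rewrite connect0 h2 !orbT.
Qed.

Lemma sew_ncc : (ncc s (a * t) + ~~ connect (step s a) x y)%N = ncc s a.
Proof.
by apply: (@nclass_sew _ _ _ x y); [exact: connect_equiv..|exact: sew_connect].
Qed.

End Sew.

(** The genus is nonnegative. Induction on the edges: without edges, each component has one vertex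
    and one face. Restoring the edge [{x, a x}] multiplies [s * b] by a transposition, which gains a
    cycle by splitting or loses one by joining, and only a join can connect two components. *)
Lemma euler_le (T : finType) (s a : {perm T}) : involutive a ->
  ((ncyc s + ncyc (s * a)).*2 <= #|supp a| + (ncc s a).*2.*2)%N.
Proof.
have [n] := ubnP #|supp a|; elim: n s a => // n IH s a; rewrite ltnS => le aI.
have [a0|[x xa]] := set_0Vmem (supp a).
  have -> : a = 1.
    by apply/permP => x; rewrite perm1; apply/eqP; apply: contraFT (in_set0 x); rewrite -a0 inE.
  by rewrite mulg1 ncc1 addnn leq_addl.
set y := a x; have xy : x != y by move: xa; rewrite inE eq_sym.
pose t := tperm x y; pose b := a * t.
have ay : a y = x by exact: aI.
have bx : b x = x by rewrite permM tpermR.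
have by' : b y = y by rewrite permM ay tpermL.
have ab : a = b * t by rewrite -mulgA tperm2 mulg1.
have bI : involutive b.
  have tJ : t ^ a = t by rewrite tpermJ ay tpermC.
  have ta : t * a = a * t by rewrite -{2}tJ conjgE !mulgA mulgV mul1g.
  move=> z; rewrite /b !permM.
  have := congr1 (fun p : {perm T} => p (t (a z))) ta.
  by rewrite !permM => <-; rewrite tpermK aI.
have cs := sew_card_supp bI bx by' xy; have nc := sew_ncc s bI bx by'.
rewrite -/t -ab in cs nc.
rewrite cs in le *; have lb : (#|supp b| < n)%N by lia.
have := IH s b lb bI; have -> : s * a = s * b * t by rewrite ab mulgA.
clearbody b; rewrite -nc /=.
have := ncyc_mul_tperm (s * b) x y; rewrite -/t xy.
have [yx|yx] := boolP (x \in porbit (s * b) y) => /=.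
  have -> : connect (step s b) x y.
    rewrite -connect_mul; apply: connect_s; by rewrite porbit_sym.
  lia.
case: connect => /=; lia.
Qed.

(** The product [s * t * (a * t) = s * a] is unchanged, so only the cycles of [s], the edges and the
    components vary. Gluing two cycles of one component creates a handle, and by [euler_le] no
    earlier defect can compensate for it. *)
Lemma euler_sew (T : finType) (s a : {perm T}) x y :
  involutive a -> a x = x -> a y = y -> x != y ->
  let t := tperm x y in
  euler (s * t) (a * t) =
    euler s a && ((x \in porbit s y) || ~~ connect (step s a) x y).
Proof.
move=> aI ax ay xy t; rewrite /euler.
have tc : t * a = a * t := sew_commute ax ay.
have -> : s * t * (a * t) = s * a by rewrite -mulgA (mulgA t) tc -mulgA tperm2 mulg1.
have nc : (ncc (s * t) (a * t) + ~~ connect (step s a) x y)%N = ncc s a.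
  rewrite -(ncc_mul s a) -(sew_ncc (s * a) aI ax ay) connect_mul; congr (_ + _)%N.
  by rewrite -(ncc_mul (s * t)) -mulgA (mulgA t) tc -mulgA tperm2 mulg1.
have cs := sew_card_supp aI ax ay xy; rewrite -/t in cs.
have cy := ncyc_mul_tperm s x y; rewrite -/t xy in cy.
have le := euler_le s aI.
rewrite cs /= -nc in le *; move: le cy.
have [yx|yx] := boolP (x \in porbit s y) => /=.
  have -> : connect (step s a) x y by apply: connect_s; rewrite porbit_sym.
  move=> _ cy; rewrite andbT; lia.
by case: connect => /= le cy; rewrite ?andbF ?andbT; lia.
Qed.

Lemma sew_connect2 (T : finType) (s a : {perm T}) x y u v :
  involutive a -> a x = x -> a y = y ->
  connect (step (s * tperm x y) (a * tperm x y)) u v = [|| connect (step s a) u v,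
    connect (step s a) u x && connect (step s a) y v |
    connect (step s a) u y && connect (step s a) x v].
Proof.
move=> aI ax ay; rewrite -!(connect_mul s a) -(sew_connect (s * a) aI ax ay).
by rewrite -(connect_mul (s * _)) -mulgA (mulgA (tperm x y)) (sew_commute ax ay) -mulgA tperm2 mulg1.
Qed.

Lemma porbit_fix (T : finType) (s : {perm T}) z : s z = z -> porbit s z = [set z].
Proof.
move=> sz; apply/eqP; rewrite eqEsubset sub1set porbit_id andbT.
by apply: porbit_closed; rewrite ?inE // => y; rewrite !inE => /eqP ->; rewrite sz.
Qed.

Lemma connect_fix (T : finType) (s a : {perm T}) z v :
  s z = z -> a z = z -> connect (step s a) z v = (v == z).
Proof.
move=> sz az; apply/idP/eqP => [/connectP[p]|->]; last exact: connect0.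
elim: p => [|w p IH] //=; rewrite {1}/step sz az orbb => /andP[/eqP -> pth] E.
exact: IH.
Qed.

(** * Inserting an isolated dart as a leg *)

Section Skip.
Variables (T : finType) (s a : {perm T}) (z y : T).
Hypotheses (sz : s z = z) (az : a z = z) (yz : y != z).
Let t := tperm z y.

Lemma skip_connect u v :
  connect (step (s * t) a) u v = [|| connect (step s a) u v,
    connect (step s a) u z && connect (step s a) y v |
    connect (step s a) u y && connect (step s a) z v].
Proof.
have szE w : s w = z -> w = z by move=> h; apply: (@perm_inj _ s); rewrite h sz.
have zy' : connect (step (s * t) a) z y by rewrite connect1 // /step permM sz tpermL eqxx.
have yz' : connect (step (s * t) a) y z by rewrite connect_step_sym.
have H1 : subrel (connect (step s a)) (connect (step (s * t) a)).
  apply: connect_sub => {u v} u v /orP[] /eqP ->; last by rewrite connect1 // /step eqxx orbT.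
  have [E|uz] := eqVneq (s u) z; first by rewrite (szE _ E) sz.
  have [E|uy] := eqVneq (s u) y; last first.
    by rewrite connect1 // /step permM tpermD ?eqxx // eq_sym.
  by rewrite E (connect_trans _ zy') // connect1 // /step permM E tpermR eqxx.
apply/idP/idP; last first.
  case/or3P => [/H1 //|/andP[/H1 h1 /H1 h2]|/andP[/H1 h1 /H1 h2]].
    exact: connect_trans (connect_trans h1 zy') h2.
  exact: connect_trans (connect_trans h1 yz') h2.
move=> /connectP[p]; elim: p u => [|w p IH] u /=; first by move=> _ ->; rewrite connect0.
case/andP=> uw pth ve; have {}IH := IH _ pth ve.
have [cuw|[[ux wy]|[uy wx]]] : connect (step s a) u w \/
    ((u = z /\ w = y) \/ (connect (step s a) u y /\ w = z)).
- case/orP: uw => /eqP ->; last by left; rewrite connect1 // /step eqxx orbT.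
  have [E|uz] := eqVneq (s u) z.
    by right; left; rewrite (szE _ E) permM sz tpermL.
  have [E|uy] := eqVneq (s u) y; last first.
    by left; rewrite permM tpermD 1?eq_sym // connect1 // /step eqxx.
  by right; right; rewrite permM E tpermR connect1 // /step E eqxx.
- case/or3P: IH => [h|/andP[h1 h2]|/andP[h1 h2]].
  + by rewrite (connect_trans cuw h).
  + by rewrite (connect_trans cuw h1) h2 orbT.
  + by rewrite (connect_trans cuw h1) h2 !orbT.
- subst u w; case/or3P: IH => [h|/andP[h1 h2]|/andP[h1 h2]].
  + by rewrite connect0 h orbT.
  + by rewrite connect0 h2 !orbT.
  + by rewrite h2.
- subst w; case/or3P: IH => [h|/andP[h1 h2]|/andP[h1 h2]].
  + by rewrite uy h !orbT.
  + by rewrite (connect_trans uy h2).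
  + by rewrite uy h2 !orbT.
Qed.

Lemma skip_ncc : (ncc (s * t) a).+1 = ncc s a.
Proof.
have <- : (ncc (s * t) a + ~~ connect (step s a) z y)%N = ncc s a.
  by apply: (@nclass_sew _ _ _ z y); [exact: connect_equiv..|exact: skip_connect].
by rewrite connect_fix // yz addn1.
Qed.

Lemma skip_ncyc (u : {perm T}) v : u z = z -> v != z ->
  (ncyc (u * tperm z v)).+1 = ncyc u.
Proof.
move=> uz vz; have := ncyc_mul_tperm u z v.
by rewrite porbit_sym porbit_fix // inE vz eq_sym vz; lia.
Qed.

(** The isolated dart was a component with one cycle of each kind. Inserting it removes one
    component and one cycle of each kind, which balances in Euler's formula. *)
Lemma euler_skip : euler (s * t) a = euler s a.
Proof.
have E : s * t * a = s * a * tperm z (a y).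
  have : t ^ a = tperm z (a y) by rewrite tpermJ az.
  by rewrite conjgE => <-; rewrite !mulgA mulgK.
have ayz : a y != z by apply: contra yz => /eqP h; apply/eqP/(@perm_inj _ a); rewrite h.
rewrite /euler E -(skip_ncyc sz yz) -(@skip_ncyc (s * a) (a y)) ?permM ?sz //.
rewrite -/t -skip_ncc; lia.
Qed.

Lemma skip_porbit : porbit (s * t) z = z |: porbit s y.
Proof.
by rewrite porbit_sew porbit_fix // in_set1.
Qed.

End Skip.

(** * Disjoint unions of maps *)

Section Disjoint.
Variables (T : finType) (B C : {set T}) (s1 s2 a1 a2 : {perm T}).
Hypotheses (BC : [disjoint B & C]).
Hypotheses (s1B : perm_on B s1) (a1B : perm_on B a1) (s2C : perm_on C s2) (a2C : perm_on C a2).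

Lemma disjoint_inl (u v : {perm T}) x : perm_on B u -> perm_on C v -> x \in B -> (u * v) x = u x.
Proof.
move=> uB vC xB; rewrite permM (out_perm vC) //.
by rewrite (disjointFr BC) // perm_closed.
Qed.

Lemma disjoint_inr (u v : {perm T}) x : perm_on B u -> perm_on C v -> x \notin B -> (u * v) x = v x.
Proof. by move=> uB vC xB; rewrite permM (out_perm uB). Qed.

Lemma disjoint_porbitl (u v : {perm T}) x : perm_on B u -> perm_on C v -> x \in B ->
  porbit (u * v) x = porbit u x.
Proof.
move=> uB vC xB; apply: eq_in_porbit => y yx; apply: disjoint_inl => //.
by apply: (subsetP (porbit_closed _ xB)) yx => z zB; rewrite perm_closed.
Qed.

Lemma disjoint_porbitr (u v : {perm T}) x : perm_on B u -> perm_on C v -> x \notin B ->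
  porbit (u * v) x = porbit v x.
Proof.
move=> uB vC xB; apply: eq_in_porbit => y yx; apply: disjoint_inr => //.
have : y \in ~: B; last by rewrite inE.
apply: (subsetP (porbit_closed _ _)) yx; rewrite ?inE // => z; rewrite !inE => zB.
have [zC|zC] := boolP (z \in C); last by rewrite (out_perm vC).
by apply: contraL zC => /(disjointFr BC); rewrite perm_closed // => ->.
Qed.

Lemma disjoint_connect x y : connect (step (s1 * s2) (a1 * a2)) x y =
  if x \in B then connect (step s1 a1) x y else connect (step s2 a2) x y.
Proof.
have cl (u : {perm T}) z : perm_on C u -> z \notin B -> u z \notin B.
  move=> uC zB; have [zC|zC] := boolP (z \in C); last by rewrite (out_perm uC).
  by apply: contraL zC => /(disjointFr BC); rewrite perm_closed // => ->.
case: ifP => xB.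
  apply/idP/idP => /connectP[p pth ->] {y}; elim: p x xB pth => [|z p IH] x xB /=;
    rewrite ?connect0 // => /andP[xz pth].
    have xz' : step s1 a1 x z by move: xz; rewrite /step !disjoint_inl.
    apply: connect_trans (connect1 xz') (IH _ _ pth).
    by case/orP: xz' => /eqP ->; rewrite perm_closed.
  have xz' : step (s1 * s2) (a1 * a2) x z by rewrite /step !disjoint_inl.
  apply: connect_trans (connect1 xz') (IH _ _ pth).
  by case/orP: xz => /eqP ->; rewrite perm_closed.
apply/idP/idP => /connectP[p pth ->] {y}; elim: p x xB pth => [|z p IH] x /negbT xB /=;
    rewrite ?connect0 // => /andP[xz pth].
  have xz' : step s2 a2 x z by move: xz; rewrite /step !disjoint_inr.
  apply: connect_trans (connect1 xz') (IH _ _ pth).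
  by case/orP: xz' => /eqP ->; apply/negbTE/cl.
have xz' : step (s1 * s2) (a1 * a2) x z by rewrite /step !disjoint_inr.
apply: connect_trans (connect1 xz') (IH _ _ pth).
by case/orP: xz => /eqP ->; apply/negbTE/cl.
Qed.

Lemma disjoint_fix1 (u : {perm T}) x : perm_on B u -> x \notin B -> u x = x.
Proof. by move=> uB xB; rewrite (out_perm uB). Qed.
Lemma disjoint_fix2 (u : {perm T}) x : perm_on C u -> x \in B -> u x = x.
Proof. by move=> uC xB; rewrite (out_perm uC) // (disjointFr BC). Qed.

Lemma disjoint_ncc : (ncc (s1 * s2) (a1 * a2) + #|T| = ncc s1 a1 + ncc s2 a2)%N.
Proof.
apply: (@nclass_disjoint _ _ _ _ B); try exact: connect_equiv.
- by move=> x y xB; rewrite connect_fix 1?eq_sym ?disjoint_fix1.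
- by move=> x y xB; rewrite connect_fix 1?eq_sym ?disjoint_fix2.
- exact: disjoint_connect.
Qed.

Lemma disjoint_ncyc (u v : {perm T}) : perm_on B u -> perm_on C v ->
  (ncyc (u * v) + #|T| = ncyc u + ncyc v)%N.
Proof.
move=> uB vC; rewrite !ncycE; apply: (@nclass_disjoint _ _ _ _ B); try exact: porbit_equiv.
- by move=> x y xB; rewrite porbit_fix ?inE 1?eq_sym ?disjoint_fix1.
- by move=> x y xB; rewrite porbit_fix ?inE 1?eq_sym ?disjoint_fix2.
- by move=> x y /=; case: (boolP (x \in B)) => xB; [rewrite (disjoint_porbitl uB vC)|rewrite (disjoint_porbitr uB vC)].
Qed.

Lemma disjoint_mul : s1 * s2 * (a1 * a2) = (s1 * a1) * (s2 * a2).
Proof.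
rewrite !mulgA; congr (_ * _); rewrite -!mulgA; congr (_ * _).
apply/esym/(@perm_onC _ B C) => //.
Qed.

Lemma disjoint_supp : #|supp (a1 * a2)| = (#|supp a1| + #|supp a2|)%N.
Proof.
have -> : supp (a1 * a2) = supp a1 :|: supp a2.
  apply/setP => x; rewrite !inE; have [xB|xB] := boolP (x \in B).
    by rewrite disjoint_inl // (disjoint_fix2 a2C xB) eqxx orbF.
  by rewrite disjoint_inr // (disjoint_fix1 a1B xB) eqxx.
rewrite cardsU (_ : _ :&: _ = set0) ?cards0 ?subn0 //.
apply/setP => x; rewrite !inE; have [xB|xB] := boolP (x \in B).
  by rewrite (disjoint_fix2 a2C xB) eqxx andbF.
by rewrite (disjoint_fix1 a1B xB) eqxx.
Qed.

Lemma disjoint_involutive : involutive (a1 * a2) <-> involutive a1 /\ involutive a2.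
Proof.
have c : a1 * a2 = a2 * a1 by apply: (@perm_onC _ B C).
split=> [aI|[I1 I2] x]; last first.
  by rewrite {2}c !permM I1 I2.
split=> x.
  have [xB|xB] := boolP (x \in B); last by rewrite !disjoint_fix1.
  by move: (aI x); rewrite !disjoint_inl // perm_closed.
have [xC|xC] := boolP (x \in C); last by rewrite !(out_perm a2C).
have xB : x \notin B by rewrite (disjointFl BC).
have axB : a2 x \notin B by rewrite (disjointFl BC) // perm_closed.
by move: (aI x); rewrite !disjoint_inr.
Qed.

(** Both sides of Euler's relation are additive; since [euler_le] holds for each part, equality for
    the union forces equality for both. *)
Lemma disjoint_euler : involutive a1 -> involutive a2 ->
  euler (s1 * s2) (a1 * a2) = euler s1 a1 && euler s2 a2.
Proof.
move=> I1 I2; rewrite /euler disjoint_mul disjoint_supp.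
have l1 := euler_le s1 I1; have l2 := euler_le s2 I2.
have n1 := disjoint_ncc; have n2 := disjoint_ncyc s1B s2C.
have n3 := disjoint_ncyc (perm_onM s1B a1B) (perm_onM s2C a2C).
move: n1 n2 n3 l1 l2; lia.
Qed.

End Disjoint.

Import GRing.Theory.

Lemma sum_bij (R : nmodType) (I J : finType) (P : pred I) (Q : pred J)
    (F : I -> R) (G : J -> R) (f : I -> J) (g : J -> I) :
  (forall i, P i -> [/\ Q (f i), g (f i) = i & F i = G (f i)]) ->
  (forall j, Q j -> P (g j) /\ f (g j) = j) ->
  (\sum_(i | P i) F i = \sum_(j | Q j) G j)%R.
Proof.
move=> fP gQ; rewrite (reindex_onto f g) /=; last by move=> j /gQ[].
apply: eq_big => i; last by case/fP.
apply/idP/andP => [/fP[-> -> _]|[/gQ[+ _] /eqP E]]; first by rewrite eqxx.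
by rewrite E.
Qed.

(** * Weighted sums over planar maps with a marked root dart *)

Section Weights.
Variables (R : comNzRingType) (w : nat -> R) (T : finType).
Implicit Types (s a : {perm T}) (B C D : {set T}).

Definition owt s C : R := (\prod_(X in [set porbit s x | x in C]) w #|X|)%R.

Lemma eq_owt s s' C : (forall x, x \in C -> porbit s x = porbit s' x) -> owt s C = owt s' C.
Proof. by move=> E; rewrite /owt; congr bigop.body; rewrite (eq_in_imset E). Qed.

Lemma owtU s C D : (forall x, x \in C -> porbit s x \subset C) -> [disjoint C & D] ->
  owt s (C :|: D) = (owt s C * owt s D)%R.
Proof.
move=> cC CD; rewrite /owt imsetU -bigU /=; first by apply: eq_bigl => X; rewrite in_setU.
rewrite disjoint_subset; apply/subsetP => X /imsetP[x xC ->]; rewrite inE.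
apply/imsetP => -[y yD E]; have := subsetP (cC _ xC) y.
by rewrite E porbit_id => /(_ isT) yC; rewrite (disjointFr CD yC) in yD.
Qed.

Lemma owt_porbit s x : owt s (porbit s x) = w #|porbit s x|.
Proof.
rewrite /owt (_ : [set _ | _ in _] = [set porbit s x]) ?big_set1 //.
apply/setP => X; rewrite inE; apply/imsetP/eqP => [[y yx ->]|->].
  by apply/eqP; rewrite eq_porbit_mem.
by exists x; rewrite ?porbit_id.
Qed.

(* Connected planar maps on the darts [B], whose cycles of [s] are the faces and
   whose root face, through [r], has degree [d].  When [lg] holds, [r] is a leg,
   i.e. the only dart of [B] not matched by [a]. *)
Definition gmap B (r : T) (lg : bool) (d : nat) s a : bool :=
  [&& r \in B, perm_on B s, perm_on B a, [forall x, a (a x) == x],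
      [forall x in B, (a x == x) == (lg && (x == r))],
      [forall x in B, connect (step s a) r x], euler s a & #|porbit s r| == d].

Record gmap_spec B (r : T) (lg : bool) (d : nat) s a : Prop := GmapSpec {
  gm_root : r \in B;
  gm_s : perm_on B s;
  gm_a : perm_on B a;
  gm_I : involutive a;
  gm_fix : forall x, x \in B -> (a x == x) = (lg && (x == r));
  gm_con : forall x, x \in B -> connect (step s a) r x;
  gm_euler : euler s a;
  gm_size : #|porbit s r| = d }.

Lemma gmapP B r lg d s a : reflect (gmap_spec B r lg d s a) (gmap B r lg d s a).
Proof.
apply: (iffP idP) => [/and5P[h1 h2 h3 h4 /and4P[h5 h6 h7 h8]]|[h1 h2 h3 h4 h5 h6 h7 h8]].
  split=> //; first by move=> x; apply/eqP/(forallP h4).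
  - by move=> x xB; exact: eqP (forall_inP h5 x xB).
  - by move=> x xB; exact: (forall_inP h6 x xB).
  - exact/eqP.
apply/and5P; split=> //; first by apply/forallP => x; rewrite h4.
apply/and4P; split=> //; last exact/eqP.
- by apply/forall_inP => x xB; rewrite h5.
- exact/forall_inP.
Qed.

Definition gsum B r lg d : R :=
  (\sum_(p : {perm T} * {perm T} | gmap B r lg d p.1 p.2) owt p.1 (B :\: porbit p.1 r))%R.

End Weights.

Lemma perm_onP (T : finType) (B : {set T}) (s : {perm T}) :
  (forall x, x \notin B -> s x = x) <-> perm_on B s.
Proof.
split=> [h|h x xB]; last exact: out_perm h xB.
by apply/subsetP => x; rewrite inE; apply: contraR => /h ->.
Qed.

Lemma expg_porbit_inj (T : finType) (s : {perm T}) x i j :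
  i < #|porbit s x| -> j < #|porbit s x| -> (s ^+ i) x = (s ^+ j) x -> i = j.
Proof.
move=> il jl E; apply/eqP; rewrite -(nth_uniq x _ _ (uniq_traject_porbit s x)) ?size_traject //.
by rewrite !nth_traject // -!permX E.
Qed.

(** * Deleting an edge that separates two faces *)

Section Merge.
Variables (T : finType) (r r' : T).
Hypothesis (rr' : r != r').
Implicit Types s : {perm T}.
Let t := tperm r r'.

Lemma sew_iter s i : r' \notin porbit s r -> i < #|porbit s r| -> ((s * t) ^+ i) r = (s ^+ i) r.
Proof.
move=> r's; elim: i => [|i IH] il; first by rewrite !expg0.
rewrite expgSr permM IH 1?ltnW // permM -(permM (s ^+ i)) -expgSr tpermD //.
  apply/eqP => E; suff: i.+1 = 0%N by [].
  by apply: (expg_porbit_inj il); rewrite ?(leq_trans _ il) // -E expg0 perm1.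
by apply: contraNneq r's => ->; rewrite mem_porbit.
Qed.

Lemma sew_iter_last s : r' \notin porbit s r -> ((s * t) ^+ #|porbit s r|) r = r'.
Proof.
move=> r's; have := card_porbit_neq0 s r; case E: #|porbit s r| => [//|d] _.
rewrite expgSr permM sew_iter ?E // permM -(permM (s ^+ d)) -expgSr -E permX iter_porbit.
exact: tpermL.
Qed.

(** In the merged cycle [r'] comes [#|porbit s r|] steps after [r], and [y] is its successor. Once
    [r'] is skipped, [y] stands at that distance, so the old root degree is all that is needed to
    undo the operation. *)
Lemma merge_fwd s (y := (s * t) r') (s2 := s * t * tperm r' y) : r' \notin porbit s r ->
  [/\ s2 r' = r', y != r', r' |: porbit s2 r = porbit s r :|: porbit s r',
     #|porbit s2 r|.+1 = (#|porbit s r| + #|porbit s r'|)%N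
   & (s2 ^+ #|porbit s r|) r = y].
Proof.
move=> r's.
have s2r : s2 r' = r' by rewrite permM -/y tpermR.
have yr : y != r'.
  rewrite /y permM; case: tpermP => [E|//|_ /eqP //].
  by move: r's; rewrite porbit_sym -{1}E mem_porbitS porbit_id.
have E1 : s2 * tperm r' y = s * t by rewrite /s2 -mulgA tperm2 mulg1.
have P1 : porbit (s * t) r = porbit s r :|: porbit s r' by exact: porbit_sew.
have P2 : porbit (s * t) r' = r' |: porbit s2 y by rewrite -E1 skip_porbit.
have r1 : r \in porbit (s * t) r'.
  by rewrite porbit_sym P1 inE porbit_id orbT.
have P12 : porbit (s * t) r = porbit (s * t) r'.
  by apply/eqP; rewrite eq_porbit_mem.
have ry : r \in porbit s2 y by move: r1; rewrite P2 !inE (negPf rr').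
have P3 : porbit s2 r = porbit s2 y by apply/eqP; rewrite eq_porbit_mem.
split=> //; first by rewrite P3 -P2 -P12 P1.
- have : #|porbit s r :|: porbit s r'| = (#|porbit s r| + #|porbit s r'|)%N.
    rewrite cardsU (_ : _ :&: _ = set0) ?cards0 ?subn0 //.
    apply/setP => z; rewrite !inE; apply/negP => /andP[z1 z2].
    move: r's; rewrite -eq_porbit_mem; move: z1 z2; rewrite -!eq_porbit_mem => /eqP <- /eqP <-.
    by rewrite eqxx.
  rewrite -P1 P12 P2 -P3 cardsU1 => <-.
  by rewrite (porbit_sym _ r') (porbit_fix s2r) in_set1 rr' add1n.
- have H i : i < #|porbit s r| -> (s2 ^+ i) r = (s ^+ i) r.
    elim: i => [|i IH] il; first by rewrite !expg0.
    have st : (s * t) ((s ^+ i) r) = (s ^+ i.+1) r.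
      by rewrite -(sew_iter r's il) expgSr [RHS]permM sew_iter // ltnW.
    rewrite expgSr permM IH 1?ltnW // permM -/(s * t) st tpermD //.
      by apply: contraNneq r's => ->; rewrite mem_porbit.
    apply: contraNneq r's; rewrite /y -st => /perm_inj ->; exact: mem_porbit.
  have := card_porbit_neq0 s r; case E: #|porbit s r| => [//|d] _.
  have L := sew_iter_last r's; rewrite E expgSr permM sew_iter ?E // in L.
  by rewrite expgSr permM H ?E // permM -/(s * t) L tpermL.
Qed.

(** Inserting [r'] just before [y] and splitting at [r], [r'] cuts off the first [d] darts. The
    extreme case [d = #|porbit s2 r|] has [y = r] and gives [r'] a face of degree 1. *)
Lemma merge_bwd s2 d (y := (s2 ^+ d) r) (s := s2 * tperm r' y * t) :
  s2 r' = r' -> 0 < d -> d <= #|porbit s2 r| ->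
  [/\ y != r', r' \notin porbit s r, #|porbit s r| = d & (s * t) r' = y].
Proof.
move=> s2r' d0 dle.
have nr' i : (s2 ^+ i) r != r'.
  apply: contraNneq rr' => E; apply/eqP/(@perm_inj _ (s2 ^+ i)).
  by rewrite E permX_fix.
have yr' : y != r' by exact: nr'.
have E1 : s * t = s2 * tperm r' y by rewrite /s -mulgA tperm2 mulg1.
have yr : y \in porbit s2 r by exact: mem_porbit.
have P2 : porbit (s * t) r' = r' |: porbit s2 r.
  rewrite E1 skip_porbit //; congr (_ |: _); apply/eqP; by rewrite eq_porbit_mem.
have rst : r \in porbit (s * t) r' by rewrite P2 !inE porbit_id orbT.
have r's : r' \notin porbit s r.
  have := ncyc_mul_tperm s r r'; have := ncyc_mul_tperm (s * t) r r'.
  rewrite -/t rst -mulgA tperm2 mulg1 rr' porbit_sym; case: (_ \in _) => //=; lia.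
have H i : i < d -> ((s * t) ^+ i) r = (s2 ^+ i) r.
  elim: i => [|i IH] il; first by rewrite !expg0.
  rewrite expgSr permM IH 1?ltnW // E1 permM -(permM (s2 ^+ i)) -expgSr tpermD //.
    by rewrite eq_sym.
  apply/eqP => E; have : (d - i.+1)%N = 0%N.
    apply: (@expg_porbit_inj _ s2 r); rewrite ?(leq_trans _ dle) //; first lia.
    rewrite expg0 perm1; apply: (@perm_inj _ (s2 ^+ i.+1)).
    by rewrite -permM -expgD subnK ?(ltnW il).
  lia.
have stl : (s * t) r' = y by rewrite E1 permM s2r' tpermL.
have P1 : porbit (s * t) r = porbit s r :|: porbit s r' by exact: porbit_sew.
have st_d : ((s * t) ^+ d) r = r'.
  case: d d0 dle @y @s nr' yr' E1 yr P2 rst r's H stl P1 => // d _ dle y s nr' yr' E1 yr P2 rst r's H stl P1.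
  by rewrite expgSr permM H // E1 permM -(permM (s2 ^+ d)) -expgSr tpermR.
split=> //; have card_st : #|porbit s r| < #|porbit (s * t) r|.
  rewrite P1 cardsU (_ : _ :&: _ = set0) ?cards0 ?subn0.
    by rewrite -[X in X < _]addn0 ltn_add2l lt0n card_porbit_neq0.
  apply/setP => z; rewrite !inE; apply/negP => /andP[z1 z2].
  move: r's; rewrite -eq_porbit_mem; move: z1 z2; rewrite -!eq_porbit_mem => /eqP <- /eqP <-.
  by rewrite eqxx.
have P12 : porbit (s * t) r = r' |: porbit s2 r.
  by rewrite -P2; apply/eqP; rewrite eq_porbit_mem.
apply: (@expg_porbit_inj _ (s * t) r) => //; last by rewrite sew_iter_last.
rewrite P12 cardsU1 (_ : r' \notin _) ?add1n ?ltnS //.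
by rewrite porbit_sym (porbit_fix s2r') in_set1.
Qed.
End Merge.

Section MergeMaps.
Variables (T : finType) (A : {set T}) (r r' : T).
Hypotheses (rA : r \in A) (r'A : r' \in A) (rr' : r != r').
Implicit Types (s a : {perm T}) (B : {set T}).
Let t := tperm r r'.

Lemma perm_on_tperm (B : {set T}) x y : x \in B -> y \in B -> perm_on B (tperm x y).
Proof.
move=> xB yB; apply/perm_onP => z zB; rewrite tpermD //.
  by apply: contraNneq zB => <-.
by apply: contraNneq zB => <-.
Qed.

Lemma cut_involutive a : involutive a -> a r = r' ->
  [/\ involutive (a * t), (a * t) r = r, (a * t) r' = r' & a * t * t = a].
Proof.
move=> aI ar; have ar' : a r' = r by rewrite -ar aI.
split; [|by rewrite permM ar tpermR|by rewrite permM ar' tpermL|by rewrite -mulgA tperm2 mulg1].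
have ta : t * a = a * t.
  have tJ : t ^ a = t by rewrite tpermJ ar ar' tpermC.
  by rewrite -{2}tJ conjgE !mulgA mulgV mul1g.
move=> z; rewrite !permM.
have := congr1 (fun p : {perm T} => p (t (a z))) ta.
by rewrite !permM => <-; rewrite tpermK aI.
Qed.

Lemma cut_fix a x : involutive a -> a r = r' -> x != r -> x != r' ->
  (a * t) x = a x.
Proof.
move=> aI ar xr xr'; rewrite permM tpermD //.
  by apply: contra xr' => /eqP E; rewrite -(aI x) -E ar.
by apply: contra xr => /eqP E; rewrite -(aI x) -E -ar aI.
Qed.

Lemma perm_onD1 (B : {set T}) s x : perm_on B s -> s x = x -> perm_on (B :\ x) s.
Proof.
move=> sB sx; apply/perm_onP => z; rewrite in_setD1 negb_and negbK.
by case/orP => [/eqP ->//|/(out_perm sB)].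
Qed.

(** After the cut, [r] and [r'] lie on one cycle, which is the harmless case of [euler_sew]; [r'] is
    then an isolated dart inserted in that cycle and [euler_skip] removes it, while [r] stays as a
    leg marking the place of the deleted edge. *)
Lemma gmap_merge s2 a2 y (s := s2 * tperm r' y * t) (a := a2 * t) d D :
  y != r' -> s2 r' = r' -> r' \notin porbit s r -> y \in porbit s2 r ->
  #|porbit s r| = d -> #|porbit s2 r| = D ->
  (gmap A r false d s a && (a r == r')) = gmap (A :\ r') r true D s2 a2.
Proof.
move=> yr' s2r' r's y2 sd s2D.
have E1 : s * t = s2 * tperm r' y by rewrite /s -mulgA tperm2 mulg1.
have rst : r \in porbit (s2 * tperm r' y) r'.
  by rewrite -E1 porbit_sym (porbit_sew r's) inE porbit_id orbT.
have crr' : connect (step (s2 * tperm r' y) a2) r r'.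
  by rewrite connect_step_sym; apply: connect_s.
have nr'x x : x != r' -> a2 r' = r' -> connect (step (s2 * tperm r' y) a2) r x = connect (step s2 a2) r x.
  move=> xr' a2r'; rewrite skip_connect //.
  have c z : connect (step s2 a2) r' z = (z == r') by exact: connect_fix.
  by rewrite (connect_step_sym _ _ r r') !c (negPf rr') (negPf xr') andbF /= orbF.
apply/idP/idP => [/andP[/gmapP[_ sA aA aI afix acon ae _] /eqP ar]|/gmapP[_ s2A a2A a2I a2fix a2con a2e _]].
  have [a2I a2r a2r' _] := cut_involutive aI ar.
  have Ea : a * t = a2 by rewrite /a -mulgA tperm2 mulg1.
  rewrite Ea in a2I a2r a2r'.
  apply/gmapP; split=> //.
  - by rewrite in_setD1 rr' rA.
  - apply: perm_onD1 => //; have -> : s2 = s * t * tperm r' y by rewrite E1 -mulgA tperm2 mulg1.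
    have s2A : perm_on A (s * t) by rewrite perm_onM // perm_on_tperm.
    have yA : y \in A.
      have -> : y = (s * t) r' by rewrite E1 permM s2r' tpermL.
      by rewrite perm_closed.
    by rewrite perm_onM // perm_on_tperm.
  - by apply: perm_onD1 => //; rewrite -Ea perm_onM // perm_on_tperm.
  - move=> x; rewrite in_setD1 => /andP[xr' xA].
    have [->|xr] := eqVneq x r; first by rewrite a2r eqxx.
    by rewrite -Ea cut_fix // afix.
  - move=> x; rewrite in_setD1 => /andP[xr' xA]; rewrite -nr'x //.
    have := acon x xA; rewrite sew_connect2 //.
    have cr'x : connect (step (s2 * tperm r' y) a2) r' x -> connect (step (s2 * tperm r' y) a2) r x.
      exact: connect_trans.
    by case/or3P => [//|/andP[_ /cr'x]|/andP[_]].
  - move: ae; rewrite euler_sew // rst andbT euler_skip //.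
have a2r' : a2 r' = r' by rewrite (out_perm a2A) // !inE eqxx.
have a2r : a2 r = r by apply/eqP; rewrite a2fix ?eqxx // !inE rr' rA.
have yA : y \in A.
  have : y \in A :\ r'.
    apply: (subsetP (porbit_closed _ _)) y2; last by rewrite in_setD1 rr'.
    by move=> z zA; rewrite perm_closed.
  by rewrite in_setD1 => /andP[].
have s2A' : perm_on A s2 by apply: subset_trans s2A (subsetDl _ _).
have a2A' : perm_on A a2 by apply: subset_trans a2A (subsetDl _ _).
have ar : a r = r' by rewrite permM a2r tpermL.
rewrite ar eqxx andbT; apply/gmapP; split=> //.
- by rewrite !perm_onM ?perm_on_tperm.
- by rewrite perm_onM ?perm_on_tperm.
- exact: sewI.
- move=> x xA; have [->|xr] := eqVneq x r; first by rewrite ar eq_sym (negPf rr').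
  have [->|xr'] := eqVneq x r'; first by rewrite permM a2r' tpermR (negPf rr').
  have [aI _ _ _] := cut_involutive (sewI a2I a2r a2r') ar.
  have E2 : a * t = a2 by rewrite /a -mulgA tperm2 mulg1.
  have := cut_fix (sewI a2I a2r a2r') ar xr xr'; rewrite E2 => <-.
  by rewrite a2fix ?in_setD1 ?xr' //= (negPf xr).
- move=> x xA; rewrite sew_connect2 //.
  have [->|xr'] := eqVneq x r'; first by rewrite crr'.
  by rewrite nr'x // a2con // in_setD1 xr'.
- by rewrite euler_sew // rst andbT euler_skip.
Qed.

(** The face of [r'] leaves the product and gives the factor [w e]; the other non-root faces are
    untouched. The merged face has lost the dart [r'], hence the degree [d + e - 1]. *)
Lemma gsum_merge (R : comNzRingType) (w : nat -> R) d e : 0 < d -> 0 < e ->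
  (\sum_(p : {perm T} * {perm T} | [&& gmap A r false d p.1 p.2, p.2 r == r',
       r' \notin porbit p.1 r & #|porbit p.1 r'| == e]) owt w p.1 (A :\: porbit p.1 r)
   = w e * gsum w (A :\ r') r true (d + e - 1))%R.
Proof.
move=> d0 e0; rewrite /gsum big_distrr /=.
apply: (@sum_bij _ _ _ _ _ _ _
  (fun p => (p.1 * t * tperm r' ((p.1 * t) r'), p.2 * t))
  (fun p => (p.1 * tperm r' ((p.1 ^+ d) r) * t, p.2 * t))) => -[s a] /=.
  case/and4P => gm /eqP ar r's /eqP se.
  have gs := gmapP _ _ _ _ _ _ gm; have sd := gm_size gs.
  have [h1 h2 h3 h4 h5] := merge_fwd rr' r's.
  set s2 := s * t * _ in h1 h2 h3 h4 h5 *; set y := (s * t) r' in s2 h1 h2 h3 h4 h5 *.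
  have [a2I a2r a2r' aE] := cut_involutive (gm_I gs) ar.
  have sE : s2 * tperm r' y * t = s by rewrite /s2 -!mulgA (mulgA (tperm _ y)) tperm2 mul1g tperm2 mulg1.
  have y2 : y \in porbit s2 r by rewrite -h5 mem_porbit.
  have D : #|porbit s2 r| = (d + e - 1)%N by rewrite -se -sd; lia.
  split.
  - rewrite -(gmap_merge (a * t) h2 h1 _ y2 _ D (d := d)) ?sE //.
    by rewrite aE gm ar eqxx.
  - by rewrite -sd h5 aE sE.
  - rewrite -se -owt_porbit.
    have cl x : x \in porbit s r' -> porbit s x \subset porbit s r'.
      by move=> xr; apply/subsetP => z; move: xr; rewrite -eq_porbit_mem => /eqP ->.
    have -> : A :\: porbit s r = porbit s r' :|: (A :\ r') :\: porbit s2 r.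
      apply/setP => z; have := congr1 (fun X : {set T} => z \in X) h3; rewrite !inE => h3z.
      have zA : z \in porbit s r' -> z \in A.
        move=> zr; apply: (subsetP (porbit_closed _ r'A)) zr => u; by rewrite perm_closed ?(gm_s gs).
      have zn : z \in porbit s r' -> z \notin porbit s r.
        move=> z1; apply: contra r's; rewrite porbit_sym in z1 => z2.
        by move: z1 z2; rewrite -!eq_porbit_mem => /eqP -> ->.
      have r'2 : r' \in porbit s2 r = false.
        by apply/negbTE; rewrite porbit_sym (porbit_fix h1) in_set1.
      case: (boolP (z \in porbit s r')) zA zn h3z => [_ -> // -> //|_ _ _] /=.
      rewrite orbF => <-; rewrite negb_or; case: eqVneq => [->|] //=.
      by rewrite ?r'2 //= ; case: (_ \in _).
    rewrite owtU //; last first.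
      rewrite -setI_eq0; apply/eqP/setP => z; rewrite !inE; apply/negP => /and3P[z1 z2 /andP[z3 _]].
      have := congr1 (fun X : {set T} => z \in X) h3; rewrite !inE z1 orbT (negPf z2) (negPf z3).
      by [].
    congr (_ * _)%R; apply: eq_owt => x; rewrite !inE => /and3P[x1 x2 x3].
    apply/esym/eq_in_porbit => z zx.
    have zs : z \notin porbit s r :|: porbit s r'.
      have -> : z \in porbit s r :|: porbit s r' = (x \in porbit s r :|: porbit s r').
        by rewrite !inE -!eq_porbit_mem; move: zx; rewrite -eq_porbit_mem => /eqP ->.
      by rewrite -h3 !inE negb_or x2.
    have zE : (s * t) z = s z.
      rewrite permM tpermD //.
        by apply: contraNneq zs => E; rewrite inE -(mem_porbitS s r) -E porbit_id.
      by apply: contraNneq zs => E; rewrite inE -(mem_porbitS s r') -E porbit_id orbT.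
    rewrite permM zE tpermD //.
      by apply: contraNneq zs => E; rewrite inE -(mem_porbitS s r') -E porbit_id orbT.
    apply: contraNneq zs => E; have /perm_inj <- : (s * t) r' = (s * t) z by rewrite zE.
    by rewrite inE porbit_id orbT.
move=> gm; have gs := gmapP _ _ _ _ _ _ gm; have sD := gm_size gs.
have s2r' : s r' = r' by rewrite (out_perm (gm_s gs)) // !inE eqxx.
have dD : d <= #|porbit s r| by rewrite sD; lia.
have [h1 h2 h3 h4] := merge_bwd rr' s2r' d0 dD.
set y := (s ^+ d) r in h1 h2 h3 h4 *; set s1 := s * _ * t in h2 h3 h4 *.
have yo : y \in porbit s r by exact: mem_porbit.
have gE := gmap_merge a h1 s2r' h2 yo h3 sD; rewrite gm in gE.
have /andP[g1 /eqP g2] := gE.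
have sE : s1 * t = s * tperm r' y by rewrite /s1 -mulgA tperm2 mulg1.
have s2E : s1 * t * tperm r' ((s1 * t) r') = s by rewrite h4 sE -mulgA tperm2 mulg1.
split; last by rewrite s2E -mulgA tperm2 mulg1.
rewrite g1 g2 eqxx h2 /=; have [_ _ _ + _] := merge_fwd rr' h2.
rewrite s2E h3 sD => E; apply/eqP; lia.
Qed.

End MergeMaps.

Lemma restr_permP (T : finType) (B : {set T}) (u : {perm T}) x :
  (forall z, (u z \in B) = (z \in B)) -> x \in B -> restr_perm B u x = u x.
Proof.
by move=> uB xB; rewrite restr_permE //; apply/astabsP => z; exact: uB.
Qed.

Lemma restr_perm_mul (T : finType) (A B : {set T}) (u : {perm T}) : B \subset A ->
  perm_on A u -> (forall z, (u z \in B) = (z \in B)) ->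
  u = restr_perm B u * restr_perm (A :\: B) u.
Proof.
move=> BA uA uB; apply/permP => x; rewrite permM.
have uC z : (u z \in A :\: B) = (z \in A :\: B) by rewrite !inE uB perm_closed.
have [xB|xB] := boolP (x \in B).
  by rewrite (restr_permP uB xB) (out_perm (restr_perm_on _ _)) // inE uB xB.
rewrite (out_perm (restr_perm_on _ _) xB).
have [xA|xA] := boolP (x \in A); first by rewrite (restr_permP uC) // inE xB.
by rewrite (out_perm (restr_perm_on _ _)) ?(out_perm uA) // inE (negPf xA) andbF.
Qed.

Lemma restr_perm_mull (T : finType) (B C : {set T}) (u v : {perm T}) :
  [disjoint B & C] -> perm_on B u -> perm_on C v -> restr_perm B (u * v) = u.
Proof.
move=> BC uB vC; apply/permP => x.
have cl z : ((u * v) z \in B) = (z \in B).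
  have [zB|zB] := boolP (z \in B); first by rewrite (disjoint_inl BC uB vC zB) perm_closed.
  rewrite (disjoint_inr uB vC zB).
  have [zC|zC] := boolP (z \in C); last by rewrite (out_perm vC) // (negPf zB).
  by rewrite (disjointFl BC) // perm_closed.
have [xB|xB] := boolP (x \in B); last by rewrite (out_perm (restr_perm_on _ _) xB) (out_perm uB).
by rewrite restr_permP // (disjoint_inl BC uB vC xB).
Qed.

Lemma restr_perm_mulr (T : finType) (B C : {set T}) (u v : {perm T}) :
  [disjoint B & C] -> perm_on B u -> perm_on C v -> restr_perm C (u * v) = v.
Proof.
move=> BC uB vC; rewrite (@perm_onC _ B C) //; apply: restr_perm_mull vC uB.
by rewrite disjoint_sym.
Qed.

(** * Cutting a map along an isthmus *)

Section SplitMaps.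
Variables (T : finType) (A : {set T}) (r r' : T).
Hypotheses (rA : r \in A) (r'A : r' \in A) (rr' : r != r').
Implicit Types (s a : {perm T}) (B : {set T}).
Let t := tperm r r'.

Lemma card_porbit_sew s : r' \notin porbit s r ->
  #|porbit (s * t) r| = (#|porbit s r| + #|porbit s r'|)%N.
Proof.
move=> r's; rewrite porbit_sew // cardsU (_ : _ :&: _ = set0) ?cards0 ?subn0 //.
apply/setP => z; rewrite !inE; apply/negP => /andP[z1 z2].
move: r's; rewrite -eq_porbit_mem; move: z1 z2; rewrite -!eq_porbit_mem => /eqP <- /eqP <-.
by rewrite eqxx.
Qed.

(** A combinatorial Jordan curve theorem: an edge with the same face on both sides disconnects.
    Undoing the cut glues two different cycles, which [euler_sew] allows only between different
    components. *)
Lemma gmap_disjoint_cut s a d : gmap A r false d s a -> a r = r' -> r' \in porbit s r ->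
  ~~ connect (step (s * t) (a * t)) r r' /\ euler (s * t) (a * t).
Proof.
move=> /gmapP[_ _ _ aI _ _ ae _] ar rs.
have [a2I a2r a2r' aE] := cut_involutive aI ar.
have : euler (s * t * t) (a * t * t) by rewrite aE -mulgA tperm2 mulg1.
rewrite euler_sew // => /andP[-> /orP[|-> //]].
have := ncyc_mul_tperm s r r'; have := ncyc_mul_tperm (s * t) r r'.
rewrite porbit_sym in rs.
rewrite -/t -mulgA tperm2 mulg1 rr' rs; case: (_ \in _) => //=; lia.
Qed.

Section Fwd.
Variables (s a : {perm T}) (d : nat).
Hypotheses (gm : gmap A r false d s a) (ar : a r = r') (rs : r' \in porbit s r).
Let s1 := s * t.
Let a1 := a * t.
Let B := [set x | connect (step s1 a1) r x].

Lemma split_fwd :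
  [/\ B \subset A, r \in B, r' \notin B,
   gmap B r true #|porbit s1 r| (restr_perm B s1) (restr_perm B a1) &
   gmap (A :\: B) r' true #|porbit s1 r'| (restr_perm (A :\: B) s1) (restr_perm (A :\: B) a1)] /\
  [/\ s1 = restr_perm B s1 * restr_perm (A :\: B) s1,
      a1 = restr_perm B a1 * restr_perm (A :\: B) a1 &
     (#|porbit s1 r| + #|porbit s1 r'|)%N = d].
Proof.
have gs := gmapP _ _ _ _ _ _ gm.
have [a1I a1r a1r' aE] := cut_involutive (gm_I gs) ar.
have [nc e1] := gmap_disjoint_cut gm ar rs.
have sE : s1 * t = s by rewrite /s1 -mulgA tperm2 mulg1.
have tA : perm_on A t by exact: perm_on_tperm.
have s1A : perm_on A s1 by rewrite perm_onM ?(gm_s gs).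
have a1A : perm_on A a1 by rewrite perm_onM ?(gm_a gs).
have rB : r \in B by rewrite inE connect0.
have r'B : r' \notin B by rewrite inE.
have BA : B \subset A.
  apply/subsetP => x; rewrite inE => /connectP[p]; elim: p r rA {rB} => [|z p IH] u uA /=.
    by move=> _ ->.
  case/andP=> uz; apply: IH.
  by case/orP: uz => /eqP ->; rewrite perm_closed.
have cs z : (s1 z \in B) = (z \in B).
  rewrite !inE; apply/idP/idP => h; apply: connect_trans h _.
    by apply: connect_s; rewrite porbit_sym mem_porbitS porbit_id.
  by rewrite connect1 // /step eqxx.
have ca z : (a1 z \in B) = (z \in B).
  rewrite !inE; apply/idP/idP => h; apply: connect_trans h _.
    by apply: connect_a; rewrite porbit_sym mem_porbitS porbit_id.
  by rewrite connect1 // /step eqxx orbT.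
have Es := restr_perm_mul BA s1A cs; have Ea := restr_perm_mul BA a1A ca.
have r'C : r' \in A :\: B by rewrite inE r'B.
have BC : [disjoint B & A :\: B].
  by rewrite -setI_eq0; apply/eqP/setP => z; rewrite !inE; case: (z \in B) => //=; case: connect.
set sB := restr_perm B s1 in Es *; set sC := restr_perm (A :\: B) s1 in Es *.
set aB := restr_perm B a1 in Ea *; set aC := restr_perm (A :\: B) a1 in Ea *.
have sBB : perm_on B sB by exact: restr_perm_on.
have aBB : perm_on B aB by exact: restr_perm_on.
have sCC : perm_on (A :\: B) sC by exact: restr_perm_on.
have aCC : perm_on (A :\: B) aC by exact: restr_perm_on.
have pB x : x \in B -> porbit s1 x = porbit sB x.
  by move=> xB; rewrite Es (disjoint_porbitl BC).
have pC x : x \notin B -> porbit s1 x = porbit sC x.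
  by move=> xB; rewrite Es (disjoint_porbitr BC sBB sCC xB).
have [aBI aCI] : involutive aB /\ involutive aC.
  by apply/(disjoint_involutive BC) => //; rewrite -Ea.
have cE x y := disjoint_connect BC sBB aBB sCC aCC x y.
have /andP[eB eC] : euler sB aB && euler sC aC.
  by rewrite -(disjoint_euler BC) // -Es -Ea.
have r's1 : r' \notin porbit s1 r by apply: contra nc; exact: connect_s.
split; split=> //.
- apply/gmapP; split=> //; last by rewrite pB.
  + move=> x xB; have xA := subsetP BA x xB.
    have -> : aB x = a1 x by rewrite Ea (disjoint_inl BC).
    have [->|xr] := eqVneq x r; first by rewrite a1r eqxx.
    rewrite (cut_fix (gm_I gs) ar xr); last by apply: contraNneq r'B => <-.
    by rewrite (gm_fix gs).
  + by move=> x xB; have := cE r x; rewrite rB -Es -Ea => <-; rewrite inE in xB.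
- apply/gmapP; split=> //; last by rewrite pC.
  + move=> x; rewrite inE => /andP[xB xA].
    have -> : aC x = a1 x by rewrite Ea (disjoint_inr aBB aCC xB).
    have [->|xr'] := eqVneq x r'; first by rewrite a1r' eqxx.
    rewrite (cut_fix (gm_I gs) ar _ xr'); last by apply: contraNneq xB => ->.
    by rewrite (gm_fix gs).
  + move=> x; rewrite inE => /andP[xB xA].
    have := cE r' x; rewrite (negPf r'B) -Es -Ea => <-.
    have := gm_con gs xA; rewrite -sE -aE sew_connect2 //.
    rewrite inE in xB; rewrite (negPf xB) (negPf nc) /= orbF.
    by case/andP.
- by rewrite -card_porbit_sew // sE (gm_size gs).
Qed.
End Fwd.

Lemma split_bwd B s1 a1 s2 a2 d1 d2 (s := s1 * s2 * t) (a := a1 * a2 * t) :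
  B \subset A -> r' \notin B ->
  gmap B r true d1 s1 a1 -> gmap (A :\: B) r' true d2 s2 a2 ->
  [/\ gmap A r false (d1 + d2) s a, a r = r', r' \in porbit s r &
   forall x, connect (step (s1 * s2) (a1 * a2)) r x = (x \in B)].
Proof.
move=> BA r'B /gmapP[rB s1B a1B a1I a1f a1c a1e a1d] /gmapP[r'C s2C a2C a2I a2f a2c a2e a2d].
have BC : [disjoint B & A :\: B].
  by rewrite -setI_eq0; apply/eqP/setP => z; rewrite !inE; case: (z \in B).
have inA (u : {perm T}) : perm_on B u -> perm_on A u by move=> h; exact: subset_trans h BA.
have inA' (u : {perm T}) : perm_on (A :\: B) u -> perm_on A u.
  by move=> h; exact: subset_trans h (subsetDl _ _).
have cE x y := disjoint_connect BC s1B a1B s2C a2C x y.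
have cB x : connect (step (s1 * s2) (a1 * a2)) r x = (x \in B).
  rewrite cE rB; have [xB|xB] := boolP (x \in B); first exact: a1c.
  rewrite connect_step_sym connect_fix ?(out_perm s1B) ?(out_perm a1B) //.
  by apply: contraNF xB => /eqP <-.
have aI : involutive (a1 * a2) by apply/(disjoint_involutive BC).
have ar : (a1 * a2) r = r.
  by rewrite (disjoint_inl BC) //; apply/eqP; rewrite a1f // eqxx.
have ar' : (a1 * a2) r' = r'.
  by rewrite (disjoint_inr a1B a2C r'B) //; apply/eqP; rewrite a2f // eqxx.
have tA : perm_on A t by exact: perm_on_tperm.
have nor : r' \notin porbit (s1 * s2) r.
  by apply: contra r'B => /(connect_s (a1 * a2)); rewrite cB.
have arr' : a r = r' by rewrite permM ar tpermL.
split=> //; last by rewrite porbit_sew // inE porbit_id orbT.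
apply/gmapP; split=> //.
- by apply: perm_onM => //; apply: perm_onM; [exact: inA|exact: inA'].
- by apply: perm_onM => //; apply: perm_onM; [exact: inA|exact: inA'].
- exact: sewI.
- move=> x xA; have [->|xr] := eqVneq x r; first by rewrite arr' eq_sym (negPf rr').
  have [->|xr'] := eqVneq x r'; first by rewrite permM ar' tpermR (negPf rr').
  have E2 : a * t = a1 * a2 by rewrite /a -mulgA tperm2 mulg1.
  have := cut_fix (sewI aI ar ar') arr' xr xr'; rewrite E2 => <-.
  have [xB|xB] := boolP (x \in B); first by rewrite (disjoint_inl BC) // a1f // (negPf xr).
  by rewrite (disjoint_inr a1B a2C xB) a2f ?inE ?xB // (negPf xr').
- move=> x xA; rewrite sew_connect2 // cB; have [//|xB] := boolP (x \in B).
  rewrite connect0 /=; have := cE r' x; rewrite (negPf r'B) => ->.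
  by rewrite a2c ?orbT // inE xB.
- by rewrite euler_sew // cB r'B orbT andbT (disjoint_euler BC) // a1e.
- rewrite card_porbit_sew // (disjoint_porbitl BC) // a1d.
  by rewrite (disjoint_porbitr BC s1B s2C r'B) a2d.
Qed.

Lemma owt_split (R : comNzRingType) (w : nat -> R) B s1 s2 (s := s1 * s2 * t) :
  B \subset A -> r \in B -> r' \notin B -> perm_on B s1 -> perm_on (A :\: B) s2 ->
  owt w s (A :\: porbit s r) =
  (owt w s1 (B :\: porbit s1 r) * owt w s2 ((A :\: B) :\: porbit s2 r'))%R.
Proof.
move=> BA rB r'B s1B s2C.
have BC : [disjoint B & A :\: B].
  by rewrite -setI_eq0; apply/eqP/setP => z; rewrite !inE; case: (z \in B).
have cB x : x \in B -> porbit s1 x \subset B.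
  by apply: porbit_closed => z; rewrite perm_closed.
have cC x : x \in A :\: B -> porbit s2 x \subset A :\: B.
  by apply: porbit_closed => z; rewrite perm_closed.
have p1 x : x \in B -> porbit (s1 * s2) x = porbit s1 x.
  by move=> xB; rewrite (disjoint_porbitl BC).
have p2 x : x \notin B -> porbit (s1 * s2) x = porbit s2 x by exact: (disjoint_porbitr BC).
have nor : r' \notin porbit (s1 * s2) r.
  by rewrite p1 //; apply: contra r'B; apply: (subsetP (cB r rB)).
have sr : porbit s r = porbit s1 r :|: porbit s2 r' by rewrite porbit_sew // p1 // p2.
have -> : A :\: porbit s r = (B :\: porbit s1 r) :|: ((A :\: B) :\: porbit s2 r').
  apply/setP => z; rewrite sr !inE negb_or.
  have h1 := subsetP (cB r rB) z; have r'C : r' \in A :\: B by rewrite inE r'B.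
  have h2 := subsetP (cC r' r'C) z; have h3 := subsetP BA z; move: h2; rewrite inE => h2.
  case: (boolP (z \in porbit s1 r)) h1 => [_ /(_ isT) zB|_ _] /=.
    by rewrite zB andbF.
  case: (boolP (z \in porbit s2 r')) h2 => [_ /(_ isT) /andP[/negPf -> _] //|_ _] /=.
  by case: (boolP (z \in B)) h3 => [_ /(_ isT) ->|_ _].
have sx x : x \in A :\: porbit s r -> porbit s x = porbit (s1 * s2) x.
  rewrite inE => /andP[xs xA]; apply: eq_in_porbit => y yx.
  rewrite /s [LHS]permM tpermD //.
    apply: contraNneq xs => E; have : r \in porbit (s1 * s2) x by rewrite E mem_porbitS.
    by rewrite porbit_sym sr inE -p1 // => ->.
  apply: contraNneq xs => E; have : r' \in porbit (s1 * s2) x by rewrite E mem_porbitS.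
  by rewrite porbit_sym sr inE -p2 // => ->; rewrite orbT.
rewrite owtU.
- congr (_ * _)%R; apply: eq_owt => x; rewrite !inE.
    by move=> /andP[xs xB]; rewrite -p1 // sx // sr !inE negb_or xs (subsetP BA) // andbT;
       apply: contraL xB => /(subsetP (cC r' _)); rewrite !inE r'B => /(_ r'A) /andP[].
  move=> /and3P[xs xB xA]; rewrite -p2 // sx // sr !inE negb_or xs xA !andbT.
  by apply: contra xB; apply: (subsetP (cB r rB)).
- move=> x; rewrite inE => /andP[xr xB].
  have -> : porbit s x = porbit s1 x.
    rewrite sx ?p1 // sr !inE negb_or xr (subsetP BA) // andbT /=.
    by apply: contraL xB => /(subsetP (cC r' _)); rewrite !inE r'B => /(_ r'A) /andP[].
  apply/subsetP => z zx; rewrite inE (subsetP (cB x xB)) // andbT.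
  by apply: contra xr; move: zx; rewrite -!eq_porbit_mem => /eqP -> .
- rewrite -setI_eq0; apply/eqP/setP => z; rewrite !inE.
  by case: (z \in B); rewrite ?andbF.
Qed.

(* Deleting an isthmus: the root face is cut into the root faces of two maps. *)
Lemma gsum_split (R : comNzRingType) (w : nat -> R) d :
  (\sum_(p : {perm T} * {perm T} | [&& gmap A r false d p.1 p.2, p.2 r == r' &
       r' \in porbit p.1 r]) owt w p.1 (A :\: porbit p.1 r)
   = \sum_(B : {set T} | [&& B \subset A, r \in B & r' \notin B]) \sum_(i < d.+1)
       gsum w B r true i * gsum w (A :\: B) r' true (d - i))%R.
Proof.
under [in RHS]eq_bigr => B _ do under eq_bigr => i _ do rewrite /gsum big_distrlr /= pair_big_dep /=.
under [in RHS]eq_bigr => B _ do rewrite pair_big_dep /=.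
rewrite pair_big_dep /=.
(* The data of a cut map: the component [B] of [r], the degree of its root face, and the
   restrictions to [B] and to its complement. *)
pose f (p : {perm T} * {perm T}) :=
  let s1 := p.1 * t in let a1 := p.2 * t in
  let B := [set x | connect (step s1 a1) r x] in
  (B, (inord #|porbit s1 r| : 'I_d.+1,
    ((restr_perm B s1, restr_perm B a1), (restr_perm (A :\: B) s1, restr_perm (A :\: B) a1)))).
pose g (j : {set T} * ('I_d.+1 * (({perm T} * {perm T}) * ({perm T} * {perm T})))) :=
  (j.2.2.1.1 * j.2.2.2.1 * t, j.2.2.1.2 * j.2.2.2.2 * t).
apply: (@sum_bij _ _ _ _ _ _ _ f g) => [[s a] /=|[B [i [[s1 a1] [s2 a2]]]] /=].
  case/and3P => gm /eqP ar rs.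
  have [[h1 h2 h3 h4 h5] [h6 h7 h8]] := split_fwd gm ar rs.
  have gs := gmapP _ _ _ _ _ _ gm.
  have iE : (inord #|porbit (s * t) r| : 'I_d.+1) = #|porbit (s * t) r| :> nat.
    by rewrite inordK // ltnS -h8 leq_addr.
  have dE : (d - #|porbit (s * t) r| = #|porbit (s * t) r'|)%N by rewrite -h8 addKn.
  split.
  - by rewrite h1 h2 h3 iE dE h4 h5.
  - by rewrite /g /= -h6 -h7 -!mulgA tperm2 !mulg1.
  - rewrite -owt_split ?restr_perm_on // -h6.
    by rewrite /= -!mulgA tperm2 mulg1.
case/andP=> /and3P[BA rB r'B] /andP[g1 g2].
have [h1 h2 h3 h4] := split_bwd BA r'B g1 g2.
have [e1 e2] := (gm_size (gmapP _ _ _ _ _ _ g1), gm_size (gmapP _ _ _ _ _ _ g2)).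
have [i1 i2] := (gm_s (gmapP _ _ _ _ _ _ g1), gm_s (gmapP _ _ _ _ _ _ g2)).
have [j1 j2] := (gm_a (gmapP _ _ _ _ _ _ g1), gm_a (gmapP _ _ _ _ _ _ g2)).
split; first by rewrite /g /= h2 eqxx h3; move: h1; rewrite subnKC ?andbT // -ltnS.
have BC : [disjoint B & A :\: B].
  by rewrite -setI_eq0; apply/eqP/setP => z; rewrite !inE; case: (z \in B).
rewrite /f /g /= -!mulgA tperm2 !mulg1.
have -> : [set x | connect (step (s1 * s2) (a1 * a2)) r x] = B by apply/setP => x; rewrite inE h4.
rewrite !(restr_perm_mull BC) // !(restr_perm_mulr BC) //.
rewrite (disjoint_porbitl BC) // e1.
by congr (_, (_, _)); apply/val_inj; rewrite /= inordK.
Qed.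
End SplitMaps.

(** * Recursion by deletion of the root edge and of the leg *)

Section Leg.
Variables (R : comNzRingType) (w : nat -> R) (T : finType).
Implicit Types (s a : {perm T}) (A B : {set T}).

(* Deleting the root edge {r, r'}: either both sides lie on the root face, or the
   other side is a face of degree e+1, which merges with the root face. *)
Lemma gsum_root A r d : r \in A -> 0 < d ->
  (gsum w A r false d = \sum_(r' in A :\ r)
    ((\sum_(B : {set T} | [&& B \subset A, r \in B & r' \notin B]) \sum_(i < d.+1)
       gsum w B r true i * gsum w (A :\: B) r' true (d - i)) +
     \sum_(e < #|T|) w e.+1 * gsum w (A :\ r') r true (d + e)))%R.
Proof.
move=> rA d0; rewrite /gsum (partition_big (fun p : {perm T} * {perm T} => p.2 r) (fun x => x \in A :\ r)) /=; last first.
  move=> [s a] /= /gmapP gs; rewrite in_setD1 perm_closed ?(gm_a gs) // rA andbT.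
  by rewrite (gm_fix gs).
apply: eq_bigr => r'; rewrite in_setD1 => /andP[r'r r'A].
have rr' : r != r' by rewrite eq_sym.
rewrite -gsum_split // (bigID (fun p : {perm T} * {perm T} => r' \in porbit p.1 r)) /=; congr (_ + _)%R.
  by apply: eq_bigl => p; rewrite -andbA.
rewrite (partition_big (fun p : {perm T} * {perm T} => inord (#|porbit p.1 r'|.-1) : 'I_#|T|.-1.+1) xpredT) //=.
have T0 : #|T| = #|T|.-1.+1 by rewrite prednK //; apply/card_gt0P; exists r.
rewrite [in RHS]T0; apply: eq_bigr => e _.
have -> : (d + e = d + e.+1 - 1)%N by lia.
rewrite -gsum_merge //; apply: eq_bigl => -[s a] /=.
rewrite -!andbA; congr [&& _, _, _ & _]; rewrite -val_eqE /= inordK; last first.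
  by rewrite -T0 prednK ?max_card // lt0n card_porbit_neq0.
have := card_porbit_neq0 s r'; case: #|porbit s r'| => //.
Qed.

Lemma gsum0 B r lg : gsum w B r lg 0 = 0%R.
Proof.
rewrite /gsum big1 // => -[s a] /= /gmapP gs.
by have := card_porbit_neq0 s r; rewrite (gm_size gs).
Qed.

Lemma gsum_leg1 B r : r \in B -> gsum w B r true 1 = (B == [set r])%:R%R.
Proof.
move=> rB; rewrite /gsum.
have H s a : gmap B r true 1 s a -> [/\ B = [set r], s = 1 & a = 1].
  move=> /gmapP gs; have ar : a r = r by apply/eqP; rewrite (gm_fix gs) // eqxx.
  have sr : s r = r.
    have /card_le1P h : #|porbit s r| <= 1 by rewrite (gm_size gs).
    have := h r (porbit_id _ _) (s r); rewrite mem_porbitS porbit_id inE => /esym/eqP //.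
  have B1 : B = [set r].
    apply/setP => x; rewrite inE; apply/idP/eqP => [xB|-> //].
    by apply/eqP; rewrite -(connect_fix _ sr ar); exact: (gm_con gs).
  have c : #|B| <= 1 by rewrite B1 cards1.
  by split=> //; [exact: perm_on_id (gm_s gs) c|exact: perm_on_id (gm_a gs) c].
have [BE|nB] := eqVneq B [set r]; last first.
  by rewrite big1 // => -[s a] /= /H[E]; rewrite E eqxx in nB.
have n1 : ncyc (1 : {perm T}) = #|T|.
  rewrite ncycE; rewrite /nclass card_cls_trivial ?cardsT // => x y _.
  by rewrite porbit_fix ?perm1 // inE eq_sym.
have g1 : gmap B r true 1 1 (1 : {perm T}).
  rewrite BE; apply/gmapP; split; rewrite ?perm_on1 ?inE ?eqxx //.
  - by move=> x; rewrite !perm1.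
  - by move=> x; rewrite inE => /eqP ->; rewrite perm1 !eqxx.
  - by move=> x; rewrite inE => /eqP ->; rewrite connect0.
  - rewrite /euler mulg1 ncc1 n1 (_ : supp 1 = set0) ?cards0; first lia.
    by apply/setP => x; rewrite !inE perm1 eqxx.
  - by rewrite porbit_fix ?perm1 // cards1.
rewrite (bigD1 (1, 1)) //= big1 ?addr0 => [|[s a] /= /andP[g]].
  by rewrite porbit_fix ?perm1 // BE setDv /owt imset0 big_set0.
by case/negP; have [_ -> ->] := H s a g.
Qed.

(** Removing the leg passes the root to the next dart of the face, and a leg can be inserted in
    front of any dart of a smaller map; hence the sum over [x]. *)
Lemma gsum_leg B r d : r \in B -> 0 < d ->
  gsum w B r true d.+1 = (\sum_(x in B :\ r) gsum w (B :\ r) x false d)%R.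
Proof.
move=> rB d0; rewrite /gsum.
rewrite (partition_big (fun p : {perm T} * {perm T} => p.1 r) (fun x => x \in B :\ r)) /=; last first.
  move=> [s a] /= /gmapP gs; rewrite in_setD1 perm_closed ?(gm_s gs) // rB andbT.
  by apply/eqP => /porbit_fix E; have := gm_size gs; rewrite E cards1; lia.
apply: eq_bigr => x; rewrite in_setD1 => /andP[xr xB].
have K (s : {perm T}) : s * tperm r x * tperm r x = s by rewrite -mulgA tperm2 mulg1.
have M s a : s r = r -> gmap B r true d.+1 (s * tperm r x) a = gmap (B :\ r) x false d s a.
  move=> sr; have P : porbit (s * tperm r x) r = r |: porbit s x by rewrite skip_porbit.
  have rx : r \notin porbit s x by rewrite porbit_sym porbit_fix // inE.
  apply/idP/idP => /gmapP gs.
    have ar : a r = r by apply/eqP; rewrite (gm_fix gs) ?eqxx.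
    apply/gmapP; split.
    - by rewrite in_setD1 xr.
    - apply: perm_onD1 => //; rewrite -(K s) perm_onM ?(gm_s gs) // perm_on_tperm //.
    - by apply: perm_onD1 => //; exact: gm_a gs.
    - exact: gm_I gs.
    - by move=> y; rewrite in_setD1 => /andP[yr yB]; rewrite (gm_fix gs) // (negPf yr).
    - move=> y; rewrite in_setD1 => /andP[yr yB].
      have := gm_con gs yB; rewrite skip_connect //.
      by rewrite !(connect_fix _ sr ar) eqxx (negPf yr) (negPf xr) /= orbF.
    - by rewrite -(euler_skip sr ar xr) (gm_euler gs).
    - by have := gm_size gs; rewrite P cardsU1 rx => -[].
  have ar : a r = r by rewrite (out_perm (gm_a gs)) // !inE eqxx.
  apply/gmapP; split=> //.
  - apply: perm_onM; [exact: subset_trans (gm_s gs) (subsetDl _ _)|exact: perm_on_tperm].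
  - exact: subset_trans (gm_a gs) (subsetDl _ _).
  - exact: gm_I gs.
  - move=> y yB; have [->|yr] := eqVneq y r; first by rewrite ar eqxx.
    by rewrite (gm_fix gs) ?in_setD1 ?yr.
  - move=> y yB; rewrite skip_connect // connect0 /=.
    have [->|yr] := eqVneq y r; first by rewrite connect0.
    by rewrite (gm_con gs) ?orbT // in_setD1 yr.
  - by rewrite (euler_skip sr ar xr) (gm_euler gs).
  - by rewrite P cardsU1 rx (gm_size gs).
apply: (@sum_bij _ _ _ _ _ _ _
  (fun p => (p.1 * tperm r x, p.2)) (fun p => (p.1 * tperm r x, p.2))) => -[s a] /=.
  case/andP=> gm /eqP sx; have sr : (s * tperm r x) r = r by rewrite permM sx tpermR.
  split; rewrite ?K //; first by rewrite -M ?K.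
  have P : porbit s r = r |: porbit (s * tperm r x) x by rewrite -{1}(K s) skip_porbit.
  have -> : (B :\ r) :\: porbit (s * tperm r x) x = B :\: porbit s r.
    by apply/setP => y; rewrite P !inE negb_or andbCA andbA.
  apply: eq_owt => y; rewrite inE => /andP[yr yB].
  apply/esym/eq_in_porbit => z zy; rewrite permM tpermD //.
    apply: contraNneq yr => E; rewrite porbit_sym.
    by move: zy; rewrite -mem_porbitS -E.
  apply: contraNneq yr => E; rewrite porbit_sym -mem_porbitS sx E.
  by rewrite mem_porbitS.
move=> gm; have gs := gmapP _ _ _ _ _ _ gm.
have sr : s r = r by rewrite (out_perm (gm_s gs)) // !inE eqxx.
by rewrite K M // gm permM sr tpermL eqxx.
Qed.

End Leg.

(** * Independence of the labelling of the darts *)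

Definition bij_on (T T' : finType) (B : {set T}) (B' : {set T'}) (f : T -> T') (g : T' -> T) :=
  (forall x, x \in B -> f x \in B' /\ g (f x) = x) /\
  (forall y, y \in B' -> g y \in B /\ f (g y) = y).

Lemma bij_on_sym (T T' : finType) (B : {set T}) (B' : {set T'}) f g :
  bij_on B B' f g -> bij_on B' B g f.
Proof. by case. Qed.

Lemma ex_bij_on (T T' : finType) (B : {set T}) (B' : {set T'}) r r' :
  r \in B -> r' \in B' -> #|B| = #|B'| ->
  exists f g, bij_on B B' f g /\ f r = r'.
Proof.
move=> rB rB' E.
pose f0 x := enum_val (cast_ord E (enum_rank_in rB x)).
pose g0 y := enum_val (cast_ord (esym E) (enum_rank_in rB' y)).
pose t := tperm (f0 r) r'.
have f0B x : f0 x \in B' by exact: enum_valP.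
have tB y : y \in B' -> t y \in B'.
  by move=> yB; rewrite /t; case: tpermP => // _; rewrite ?f0B.
exists (t \o f0), (g0 \o t); split; last by rewrite /= tpermL.
split=> [x xB|y yB] /=; split; rewrite ?tB //; try exact: enum_valP.
  rewrite /t tpermK /g0 /f0 enum_valK_in cast_ordK.
  by rewrite enum_rankK_in.
rewrite /g0 /f0 enum_valK_in cast_ordKV enum_rankK_in ?tB //.
by rewrite /t tpermK.
Qed.

Section Transfer.
Variables (T T' : finType) (B : {set T}) (B' : {set T'}) (f : T -> T') (g : T' -> T).
Hypothesis fg : bij_on B B' f g.
Implicit Types s a : {perm T}.

(** The default value of [insubd] makes this total. For [s] supported on [B] the conjugated function
    is injective and the default is never taken, which is [transportE]. *)
Definition transport s : {perm T'} :=
  insubd (1 : {perm T'}) [ffun y => if y \in B' then f (s (g y)) else y].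

Lemma fB x : x \in B -> f x \in B'. Proof. by case: fg => h _ /h[]. Qed.
Lemma gB y : y \in B' -> g y \in B. Proof. by case: fg => _ h /h[]. Qed.
Lemma gfK x : x \in B -> g (f x) = x. Proof. by case: fg => h _ /h[]. Qed.
Lemma fgK y : y \in B' -> f (g y) = y. Proof. by case: fg => _ h /h[]. Qed.

Lemma transportE s y : perm_on B s ->
  transport s y = if y \in B' then f (s (g y)) else y.
Proof.
move=> sB; rewrite -pvalE /transport -[pval _]/(val _) val_insubd.
case: ifP => [_|]; first by rewrite ffunE.
move/negbT/negP => []; apply/injectiveP => u v; rewrite !ffunE.
have [uB|uB] := boolP (u \in B'); have [vB|vB] := boolP (v \in B').
- move/(congr1 g); rewrite !gfK ?perm_closed ?gB // => /perm_inj /(congr1 f).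
  by rewrite !fgK.
- by move=> E; move: vB; rewrite -E fB // perm_closed // gB.
- by move=> E; move: uB; rewrite E fB // perm_closed // gB.
- by [].
Qed.

Lemma transport_f s x : perm_on B s -> x \in B -> transport s (f x) = f (s x).
Proof. by move=> sB xB; rewrite transportE // fB // gfK. Qed.

Lemma transport_on s : perm_on B s -> perm_on B' (transport s).
Proof. by move=> sB; apply/perm_onP => y yB; rewrite transportE // (negPf yB). Qed.

Lemma transportM s a : perm_on B s -> perm_on B a ->
  transport (s * a) = transport s * transport a.
Proof.
move=> sB aB; apply/permP => y; rewrite permM !transportE //; last exact: perm_onM.
case: (boolP (y \in B')) => [yB|/negPf -> //].
by rewrite fB ?perm_closed ?gB // permM gfK // perm_closed // gB.
Qed.

Lemma porbit_sub s x : perm_on B s -> x \in B -> porbit s x \subset B.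
Proof. by move=> sB; apply: porbit_closed => y; rewrite perm_closed. Qed.

Lemma transport_porbit s x : perm_on B s -> x \in B ->
  porbit (transport s) (f x) = f @: porbit s x.
Proof.
move=> sB xB; apply/setP => y.
have H n : ((transport s) ^+ n) (f x) = f ((s ^+ n) x).
  elim: n => [|n IH]; first by rewrite !expg0 !perm1.
  by rewrite !expgSr !permM IH transport_f // (subsetP (porbit_sub sB xB)) // mem_porbit.
apply/porbitP/imsetP => [[i ->]|[z /porbitP[i ->] ->]].
  by exists ((s ^+ i) x); rewrite ?mem_porbit.
by exists i.
Qed.

Lemma card_transport_porbit s x : perm_on B s -> x \in B ->
  #|porbit (transport s) (f x)| = #|porbit s x|.
Proof.
move=> sB xB; rewrite transport_porbit // card_in_imset // => u v uo vo E.
have sub := subsetP (porbit_sub sB xB).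
by rewrite -(gfK (sub _ uo)) -(gfK (sub _ vo)) E.
Qed.

Lemma transport_connect s a x y : perm_on B s -> perm_on B a -> x \in B ->
  connect (step s a) x y -> connect (step (transport s) (transport a)) (f x) (f y).
Proof.
move=> sB aB + /connectP[p]; elim: p x => [|z p IH] x xB /=; first by move=> _ ->.
case/andP=> xz pth ye.
have zB : z \in B by case/orP: xz => /eqP ->; rewrite perm_closed.
apply: connect_trans (IH _ zB pth ye); rewrite connect1 // /step !transport_f //.
by case/orP: xz => /eqP ->; rewrite eqxx ?orbT.
Qed.

Lemma transport_involutive s : perm_on B s -> involutive s -> involutive (transport s).
Proof.
move=> sB sI y; rewrite !transportE //; case: (boolP (y \in B')) => [yB|/negPf -> //].
by rewrite fB ?perm_closed ?gB // gfK ?perm_closed ?gB // sI fgK.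
Qed.

End Transfer.

Lemma transportK (T T' : finType) (B : {set T}) (B' : {set T'}) f g (s : {perm T})
  (fg : bij_on B B' f g) : perm_on B s -> transport B g f (transport B' f g s) = s.
Proof.
move=> sB; apply/permP => x; have gf := bij_on_sym fg.
rewrite (transportE gf) ?(transport_on fg) //.
case: (boolP (x \in B)) => [xB|xB]; last by rewrite (out_perm sB).
by rewrite (transport_f fg) // (gfK fg) // perm_closed.
Qed.

(** Inside [B] and [B'] the classes correspond; outside, each point is its own class, and the two
    complements may differ in size. *)
Lemma nclass_transfer (T T' : finType) (B : {set T}) (B' : {set T'}) f g
    (e : rel T) (e' : rel T') : bij_on B B' f g ->
  equivalence_rel e -> equivalence_rel e' ->
  (forall x y, x \notin B -> e x y = (x == y)) ->
  (forall x y, x \notin B' -> e' x y = (x == y)) ->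
  (forall x y, x \in B -> e x y -> y \in B) ->
  (forall x y, x \in B' -> e' x y -> y \in B') ->
  (forall x y, x \in B -> y \in B -> e x y = e' (f x) (f y)) ->
  nclass e + #|~: B'| = nclass e' + #|~: B|.
Proof.
have le (S S' : finType) (C : {set S}) (C' : {set S'}) h k (d : rel S) (d' : rel S') :
    bij_on C C' h k -> (forall x y, x \in C -> d x y -> y \in C) ->
    (forall x y, x \in C' -> d' x y -> y \in C') ->
    (forall x y, x \in C -> y \in C -> d x y = d' (h x) (h y)) ->
    #|[set cls d' y | y in C']| <= #|[set cls d x | x in C]|.
  move=> hk cd cd' E; have kh := bij_on_sym hk.
  apply: leq_trans (leq_imset_card (fun X : {set S} => [set h x | x in X]) _).
  apply/subset_leq_card/subsetP => X /imsetP[y yC ->].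
  apply/imsetP; exists (cls d (k y)); first by apply: imset_f; exact: gB hk _ yC.
  have ky := gB hk yC.
  apply/setP => z; rewrite inE; apply/idP/imsetP => [yz|[x]].
    have zC := cd' _ _ yC yz; exists (k z); last by rewrite (fgK hk).
    by rewrite inE E ?(gB hk) // !(fgK hk).
  rewrite inE => kx ->; have xC := cd _ _ ky kx.
  by move: kx; rewrite E // (fgK hk).
move=> fg eE eE' t t' c c' E; have gf := bij_on_sym fg.
have clB (S : finType) (C : {set S}) (d : rel S) : equivalence_rel d ->
    (forall x y, x \notin C -> d x y = (x == y)) ->
    (forall x y, x \in C -> d x y -> y \in C) ->
    nclass d = #|[set cls d x | x in C]| + #|~: C|.
  move=> dE td cd; rewrite (@nclass_closed _ _ C) //.
    congr (_ + _); rewrite card_cls_trivial // => x y; rewrite inE; exact: td.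
  move=> x y xy; have [xC|xC] := boolP (x \in C); first by rewrite (cd _ _ xC xy).
  by move: xy; rewrite td // => /eqP <-; rewrite (negPf xC).
rewrite (clB _ _ _ eE t c) (clB _ _ _ eE' t' c') addnAC; congr (_ + _ + _).
apply/eqP; rewrite eqn_leq (le _ _ _ _ _ _ _ _ fg c c' E) andbT.
apply: (le _ _ _ _ _ _ _ _ gf c' c) => x y xB yB.
by rewrite E ?(gB fg) // !(fgK fg).
Qed.

Section Transfer2.
Variables (T T' : finType) (B : {set T}) (B' : {set T'}) (f : T -> T') (g : T' -> T).
Hypothesis fg : bij_on B B' f g.
Variables (s a : {perm T}) (sB : perm_on B s) (aB : perm_on B a).
Let s' := transport B' f g s.
Let a' := transport B' f g a.

Let s'B : perm_on B' s'. Proof. exact: transport_on fg _ sB. Qed.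
Let a'B : perm_on B' a'. Proof. exact: transport_on fg _ aB. Qed.

Lemma connect_on (S : finType) (C : {set S}) (u v : {perm S}) x y :
  perm_on C u -> perm_on C v -> x \in C -> connect (step u v) x y -> y \in C.
Proof.
move=> uC vC + /connectP[p]; elim: p x => [|z p IH] x xC /=; first by move=> _ ->.
by case/andP=> xz; apply: IH; case/orP: xz => /eqP ->; rewrite perm_closed.
Qed.

Lemma transport_connectE x y : x \in B -> y \in B ->
  connect (step s a) x y = connect (step s' a') (f x) (f y).
Proof.
move=> xB yB; apply/idP/idP; first exact: (transport_connect fg).
have gf := bij_on_sym fg.
move/(transport_connect gf s'B a'B (fB fg xB)).
by rewrite !(transportK fg) // !(gfK fg).
Qed.

Lemma transport_ncc : ncc s a + #|~: B'| = ncc s' a' + #|~: B|.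
Proof.
apply: (nclass_transfer fg); try exact: connect_equiv; try exact: transport_connectE.
- by move=> x y xB; rewrite connect_fix 1?eq_sym ?(out_perm sB) ?(out_perm aB).
- by move=> x y xB; rewrite connect_fix 1?eq_sym ?(out_perm s'B) ?(out_perm a'B).
- by move=> x y xB; exact: connect_on sB aB xB.
- by move=> x y xB; exact: connect_on s'B a'B xB.
Qed.

Lemma transport_ncyc (u : {perm T}) : perm_on B u ->
  ncyc u + #|~: B'| = ncyc (transport B' f g u) + #|~: B|.
Proof.
move=> uB; have u'B := transport_on fg uB.
rewrite !ncycE; apply: (nclass_transfer fg); try exact: porbit_equiv.
- by move=> x y xB; rewrite porbit_fix ?inE 1?eq_sym ?(out_perm uB).
- by move=> x y xB; rewrite porbit_fix ?inE 1?eq_sym ?(out_perm u'B).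
- by move=> x y xB; exact: (subsetP (porbit_sub uB xB)).
- by move=> x y xB; exact: (subsetP (porbit_sub u'B xB)).
- move=> x y xB yB; rewrite (transport_porbit fg) //; apply/idP/imsetP => [h|[z zx E]].
    by exists y.
  have zB := subsetP (porbit_sub uB xB) _ zx.
  by rewrite -(gfK fg yB) E (gfK fg).
Qed.

Lemma transport_supp : #|supp a'| = #|supp a|.
Proof.
have -> : supp a' = f @: supp a.
  apply/setP => y; rewrite !inE /a' (transportE fg _ aB).
  case: (boolP (y \in B')) => [yB|yB].
    apply/idP/imsetP => [h|[x xa E]].
      exists (g y); rewrite ?inE ?(fgK fg) //; apply: contra h => /eqP ->.
      by rewrite (fgK fg).
    have xB : x \in B by apply: contraTT xa => xB; rewrite inE negbK (out_perm aB).
    rewrite E (gfK fg) //; rewrite inE in xa; apply: contra xa => /eqP /(congr1 g).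
    by rewrite !(gfK fg) ?perm_closed // => ->.
  rewrite eqxx; apply/esym/imsetP => -[x xa E].
  have xB : x \in B by apply: contraTT xa => xB; rewrite inE negbK (out_perm aB).
  by rewrite E (fB fg) in yB.
rewrite card_in_imset // => x y xa ya E.
have aB' z : z \in supp a -> z \in B.
  by apply: contraTT => zB; rewrite inE negbK (out_perm aB).
by rewrite -(gfK fg (aB' _ xa)) E (gfK fg) // aB'.
Qed.

Lemma transport_euler : euler s' a' = euler s a.
Proof.
have n1 := transport_ncyc sB; have n2 := transport_ncyc (perm_onM sB aB).
have n3 := transport_ncc; rewrite (transportM fg) // in n2.
rewrite /euler transport_supp; move: n1 n2 n3; rewrite -/s' -/a'; lia.
Qed.

Lemma transport_gmap r lg d : gmap B r lg d s a -> gmap B' (f r) lg d s' a'.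
Proof.
move=> /gmapP gs; have rB := gm_root gs; apply/gmapP; split=> //.
- exact: fB fg _ rB.
- exact: transport_involutive fg _ aB (gm_I gs).
- move=> y yB; rewrite -{1 2}(fgK fg yB) /a' (transport_f fg) ?(gB fg) //.
  have gyB := gB fg yB.
  rewrite -[lg && _]/(lg && (y == f r)) -[in RHS](fgK fg yB).
  have inj u v : u \in B -> v \in B -> (f u == f v) = (u == v).
    move=> uB vB; apply/eqP/eqP => [/(congr1 g)|-> //]; by rewrite !(gfK fg).
  by rewrite !inj ?perm_closed // (gm_fix gs).
- move=> y yB; rewrite -(fgK fg yB) -transport_connectE ?(gB fg) //.
  by rewrite (gm_con gs) // (gB fg).
- by rewrite transport_euler (gm_euler gs).
- by rewrite (card_transport_porbit fg) // (gm_size gs).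
Qed.

Lemma transport_owt (R : comNzRingType) (w : nat -> R) r : r \in B ->
  owt w s' (B' :\: porbit s' (f r)) = owt w s (B :\: porbit s r).
Proof.
move=> rB; rewrite /owt.
have inj u v : u \in B -> v \in B -> f u = f v -> u = v.
  by move=> uB vB /(congr1 g); rewrite !(gfK fg).
have po x : x \in B -> porbit s' (f x) = f @: porbit s x by move=> xB; exact: (transport_porbit fg).
have sub x (xB : x \in B) := subsetP (porbit_sub sB xB).
have -> : [set porbit s' x | x in B' :\: porbit s' (f r)] =
    [set [set f z | z in X : {set T}] | X in [set porbit s x | x in B :\: porbit s r]].
  apply/setP => X; apply/imsetP/imsetP => [[y]|[Y /imsetP[x]]].
    rewrite inE => /andP[yr yB] ->; exists (porbit s (g y)); last by rewrite -po ?(gB fg) // (fgK fg).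
    apply: imset_f; rewrite inE (gB fg) // andbT; apply: contra yr => h.
    by rewrite po //; apply/imsetP; exists (g y); rewrite ?(fgK fg).
  rewrite inE => /andP[xr xB] -> ->; exists (f x); last by rewrite po.
  rewrite inE (fB fg) // andbT po //; apply: contra xr => /imsetP[z zr E].
  by rewrite (inj _ _ xB _ E) // (sub r).
rewrite big_imset /=.
  apply: eq_bigr => X /imsetP[x]; rewrite inE => /andP[_ xB] ->.
  by rewrite card_in_imset // => u v /(sub _ xB) uB /(sub _ xB) vB; exact: inj.
move=> X Y /imsetP[x]; rewrite inE => /andP[_ xB] -> /imsetP[y]; rewrite inE => /andP[_ yB] ->.
rewrite -!po // => E; apply/eqP; rewrite eq_porbit_mem.
have : f x \in porbit s' (f y) by rewrite -E porbit_id.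
rewrite po // => /imsetP[z zy /inj E2]; rewrite E2 // ; exact: sub zy.
Qed.
End Transfer2.

Lemma gsum_transfer (R : comNzRingType) (w : nat -> R) (T T' : finType)
    (B : {set T}) (B' : {set T'}) r r' lg d :
  r \in B -> r' \in B' -> #|B| = #|B'| -> gsum w B r lg d = gsum w B' r' lg d.
Proof.
move=> rB rB' E; have [f [g [fg fr]]] := ex_bij_on rB rB' E.
have gf := bij_on_sym fg.
apply: (@sum_bij _ _ _ _ _ _ _
  (fun p => (transport B' f g p.1, transport B' f g p.2))
  (fun p => (transport B g f p.1, transport B g f p.2))) => -[s a] /= gm.
  have gs := gmapP _ _ _ _ _ _ gm; have [sB aB] := (gm_s gs, gm_a gs).
  rewrite !(transportK fg) //; split=> //; first by rewrite -fr; exact: (transport_gmap fg sB aB gm).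
  by rewrite -fr (transport_owt fg).
have gs := gmapP _ _ _ _ _ _ gm; have [sB aB] := (gm_s gs, gm_a gs).
rewrite !(transportK gf) //; split=> //.
have -> : r = g r' by rewrite -fr (gfK fg).
exact: (transport_gmap gf sB aB gm).
Qed.

Local Close Scope group_scope.
Import Num.Theory.
Local Open Scope ring_scope.

Lemma odd_card_owt (R : comNzRingType) (w : nat -> R) (T : finType) (s : {perm T}) (C : {set T}) :
  (forall d, odd d -> w d = 0) -> (forall x, x \in C -> porbit s x \subset C) ->
  odd #|C| -> owt w s C = 0.
Proof.
move=> w0 cC oC; have : [exists X in [set porbit s x | x in C], odd #|pred_of_set X|].
  apply: contraLR oC; rewrite negb_exists_in => /forall_inP h.
  rewrite -sum1_card (partition_big_imset (porbit s)) /=.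
  apply: (big_ind (fun n => ~~ odd n)) => // [u v|X XC]; first by rewrite oddD => /negPf -> /negPf ->.
  have := h X XC; case/imsetP: XC => x xC ->; rewrite sum1dep_card; congr (~~ odd _).
  apply: eq_card => y; rewrite !inE eq_porbit_mem andb_idl // => yx.
  exact: (subsetP (cC x xC)).
by case/exists_inP => X XC oX; rewrite /owt (bigD1 X) //= w0 // mul0r.
Qed.

(** * Recursion for labelled counts *)

Section Rec.
Variables (R : numFieldType) (w : nat -> R).
Hypothesis w_odd : forall d, odd d -> w d = 0.

Definition GL m d : R := gsum w [set: 'I_m.+1] ord0 true d.
Definition GR m d : R := gsum w [set: 'I_m.+1] ord0 false d.

Lemma gsum_GL (T : finType) (B : {set T}) r m d : r \in B -> #|B| = m.+1 ->
  gsum w B r true d = GL m d.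
Proof. by move=> rB cB; apply: gsum_transfer; rewrite ?inE // cardsT card_ord. Qed.

Lemma gsum_GR (T : finType) (B : {set T}) r m d : r \in B -> #|B| = m.+1 ->
  gsum w B r false d = GR m d.
Proof. by move=> rB cB; apply: gsum_transfer; rewrite ?inE // cardsT card_ord. Qed.

Lemma GL_S m d : (0 < d)%N -> GL m.+1 d.+1 = m.+1%:R * GR m d.
Proof.
move=> d0; rewrite /GL gsum_leg ?inE //.
have c : #|[set: 'I_m.+2] :\ ord0| = m.+1.
  by have := cardsD1 (ord0 : 'I_m.+2) setT; rewrite inE cardsT card_ord => -[].
rewrite (eq_bigr (fun => GR m d)) => [|x xA]; last first.
  by apply: gsum_GR.
by rewrite sumr_const c mulr_natl.
Qed.

Lemma GL0 d : GL 0 d = (d == 1)%:R.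
Proof.
have s1 : [set: 'I_1] = [set ord0] by apply/setP => x; rewrite !inE (ord1 x).
case: d => [|[|d]]; first by rewrite /GL gsum0.
  by rewrite /GL gsum_leg1 ?inE // s1 eqxx.
by rewrite /GL gsum_leg ?inE // s1 setDv big_set0.
Qed.

Lemma GL1 m : GL m.+1 1 = 0.
Proof.
rewrite /GL gsum_leg1 ?inE // (_ : _ == _ = false) //.
by apply/eqP => /(congr1 (fun X : {set _} => #|X|)); rewrite cardsT card_ord cards1.
Qed.

Lemma GL_large m d : (m.+1 < d)%N -> GL m d = 0.
Proof.
move=> md; rewrite /GL /gsum big1 // => -[s a] /= /gmapP gs.
have := max_card (mem (porbit s ord0)); rewrite (gm_size gs) card_ord; lia.
Qed.

(** The [m] darts other than the leg are matched, so [m] is even by Euler's formula; the non-root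
    faces have even degree or weight 0, so the root face has the parity of [m.+1]. *)
Lemma GL_parity m d : odd m || ~~ odd d -> GL m d = 0.
Proof.
move=> od; rewrite /GL /gsum big1 // => -[s a] /= /gmapP gs.
have sa : #|supp a| = m.
  have -> : supp a = [set: 'I_m.+1] :\ ord0.
    by apply/setP => x; rewrite !inE (gm_fix gs) ?inE // andbT.
  by have := cardsD1 (ord0 : 'I_m.+1) setT; rewrite inE cardsT card_ord => -[].
have /eqP := gm_euler gs; rewrite sa => E.
have em : odd m = false by have := congr1 odd E; rewrite oddD !odd_double addbF.
rewrite em /= in od; apply: odd_card_owt => //.
  move=> x; rewrite inE => /andP[xs _]; apply/subsetP => y; rewrite !inE andbT => yx.
  by apply: contra xs; move: yx; rewrite -!eq_porbit_mem => /eqP ->.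
by rewrite cardsD setTI (gm_size gs) cardsT card_ord oddB ?(gm_size gs) /= ?em //;
  rewrite -(gm_size gs) -[X in (_ <= X)%N]card_ord max_card.
Qed.

Lemma card_sub_root (T : finType) (r r' : T) k : r != r' ->
  #|[set B : {set T} | (r \in B) && (r' \notin B) & #|B| == k.+1]| = 'C(#|T|.-2, k).
Proof.
move=> rr'; pose D := ~: [set r; r'].
have <- : #|D| = #|T|.-2 by rewrite cardsCs setCK cards2 rr' subn2.
rewrite -cards_draws -(card_in_imset (f := fun B : {set T} => B :\ r)); last first.
  move=> X Y; rewrite !inE => /andP[/andP[rX _] _] /andP[/andP[rY _] _] E.
  by rewrite -(setD1K rX) E setD1K.
apply: eq_card => X; rewrite inE; apply/imsetP/andP => [[B]|[XD /eqP cX]].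
  rewrite !inE => /andP[/andP[rB r'B] /eqP cB] ->; split.
    apply/subsetP => x; rewrite !inE => /andP[xr xB]; rewrite (negPf xr) /=.
    by apply: contra r'B => /eqP <-.
  by have := cardsD1 r B; rewrite rB cB add1n => -[->].
have rX : r \notin X by apply/negP => /(subsetP XD); rewrite !inE eqxx.
have r'X : r' \notin X by apply/negP => /(subsetP XD); rewrite !inE eqxx orbT.
exists (r |: X); last by rewrite setU1K.
by rewrite !inE eqxx /= negb_or (eq_sym r') rr' r'X cardsU1 rX cX add1n eqxx.
Qed.

(** The partner [r'] of the root has [m.+1] choices. In the isthmus case, the binomial coefficient
    chooses the [k] darts that join [ord0] on its side. *)
Lemma GR_S m d : (0 < d)%N -> GR m.+1 d = m.+1%:R *
  (\sum_(k < m.+1) 'C(m, k)%:R * (\sum_(i < d.+1) GL k i * GL (m - k) (d - i))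
   + \sum_(e < m.+2) w e.+1 * GL m (d + e)).
Proof.
move=> d0; rewrite /GR gsum_root ?inE //.
set X := (X in _ = _ * X).
have c : #|[set: 'I_m.+2] :\ ord0| = m.+1.
  by have := cardsD1 (ord0 : 'I_m.+2) setT; rewrite inE cardsT card_ord => -[].
rewrite (eq_bigr (fun => X)) => [|r']; first by rewrite sumr_const c mulr_natl.
rewrite in_setD1 => /andP[r'0 _]; congr (_ + _); last first.
  rewrite card_ord; apply: eq_bigr => e _; congr (_ * _); apply: gsum_GL; first by rewrite !inE eq_sym r'0.
  by have := cardsD1 r' [set: 'I_m.+2]; rewrite inE cardsT card_ord => -[].
have r0' : ord0 != r' by rewrite eq_sym.
transitivity (\sum_(B : {set 'I_m.+2} | (ord0 \in B) && (r' \notin B))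
    \sum_(i < d.+1) GL #|B|.-1 i * GL (m - #|B|.-1) (d - i)).
  apply: eq_big => [B|B /and3P[_ rB r'B]]; first by rewrite subsetT.
  have cB : #|B| = #|B|.-1.+1 by rewrite prednK //; apply/card_gt0P; exists ord0.
  apply: eq_bigr => i _; congr (_ * _); apply: gsum_GL => //; first by rewrite !inE r'B.
  have := cardsC B; rewrite card_ord setTD; have : (0 < #|~: B|)%N by apply/card_gt0P; exists r'; rewrite inE.
  rewrite cB /=; lia.
rewrite (partition_big (fun B : {set 'I_m.+2} => inord #|B|.-1 : 'I_m.+1) xpredT) //=.
apply: eq_bigr => k _.
have <- : #|[set B : {set 'I_m.+2} | (ord0 \in B) && (r' \notin B) & #|B| == k.+1]| = 'C(m, k).
  by rewrite card_sub_root // card_ord.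
have lt (B : {set 'I_m.+2}) : ord0 \in B -> r' \notin B -> (0 < #|B|)%N /\ (#|B|.-1 < m.+1)%N.
  move=> rB r'B; have c1 : (0 < #|B|)%N by apply/card_gt0P; exists ord0.
  have c2 : (0 < #|~: B|)%N by apply/card_gt0P; exists r'; rewrite inE.
  have := cardsC B; rewrite card_ord => c3; split=> //.
  by move: c1 c2 c3; move: #|B| #|~: B| => x y; lia.
rewrite mulr_natl -sumr_const; apply: eq_big => B.
  rewrite inE; have [/andP[rB r'B]|] := boolP ((ord0 \in B) && (r' \notin B)) => //=.
  have [c1 c2] := lt B rB r'B; rewrite -val_eqE /= inordK //.
  by move: c1; case: #|B| => // n _; rewrite eqSS.
case/andP=> /andP[rB r'B] /eqP <-.
by have [c1 c2] := lt B rB r'B; rewrite inordK.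
Qed.

(** Division by the number of labellings of the non-root darts, as in exponential generating
    functions; it turns the binomial convolution of [GR_S] into an ordinary one. *)
Definition gL m d : R := GL m d / m`!%:R.

Lemma gL_rec m d : (0 < d)%N -> gL m.+2 d.+1 =
  \sum_(k < m.+1) \sum_(i < d.+1) gL k i * gL (m - k) (d - i)
  + \sum_(e < m.+2) w e.+1 * gL m (d + e).
Proof.
move=> d0; rewrite /gL GL_S // GR_S //.
have f0 n : n`!%:R != 0 :> R by rewrite pnatr_eq0 -lt0n fact_gt0.
have n0 n : n.+1%:R != 0 :> R by rewrite pnatr_eq0.
rewrite !factS !natrM.
have -> : \sum_(e < m.+2) w e.+1 * (GL m (d + e) / m`!%:R) =
   (\sum_(e < m.+2) w e.+1 * GL m (d + e)) / m`!%:R.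
  by rewrite mulr_suml; apply: eq_bigr => e _; rewrite mulrA.
have -> : \sum_(k < m.+1) \sum_(i < d.+1) GL k i / k`!%:R * (GL (m - k) (d - i) / (m - k)`!%:R) =
   (\sum_(k < m.+1) 'C(m, k)%:R * (\sum_(i < d.+1) GL k i * GL (m - k) (d - i))) / m`!%:R.
  rewrite mulr_suml; apply: eq_bigr => k _; rewrite mulr_sumr mulr_suml.
  apply: eq_bigr => i _; have := bin_fact (leq_ord k) => /(congr1 (fun n => n%:R : R)).
  rewrite !natrM => <-; have C0 : 'C(m, k)%:R != 0 :> R by rewrite pnatr_eq0 -lt0n bin_gt0 leq_ord.
  by field; rewrite C0 !f0.
set X := \sum_(k < _) _; set Y := \sum_(e < _) _.
by field; rewrite f0 nat1r -natrD !pnatr_eq0.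
Qed.

Lemma sum_even_ord (V : nmodType) (F : nat -> V) n : (forall k, odd k -> F k = 0) ->
  \sum_(k < n.*2.+1) F k = \sum_(k < n.+1) F k.*2.
Proof.
move=> F0; elim: n => [|n IH]; first by rewrite !big_ord1.
by rewrite doubleS 2!big_ord_recr /= IH F0 ?addr0 /= ?odd_double // [RHS]big_ord_recr.
Qed.

Lemma sum_odd_ord (V : nmodType) (F : nat -> V) n : (forall k, ~~ odd k -> F k = 0) ->
  \sum_(k < n.*2) F k = \sum_(k < n) F k.*2.+1.
Proof.
move=> F0; elim: n => [|n IH]; first by rewrite !big_ord0.
by rewrite doubleS 2!big_ord_recr /= IH (F0 n.*2) ?addr0 /= ?odd_double // [RHS]big_ord_recr.
Qed.

(* A map of perimeter 2l with an additional leg attached at the root corner; the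
   vertex map (n = l = 0) is thereby included. *)
Definition legcount n l : R := gL n.*2 l.*2.+1.

Lemma legcount0 l : legcount 0 l = (l == 0)%:R.
Proof. by rewrite /legcount /gL GL0 divr1 eqSS double_eq0. Qed.

Lemma legcountS0 n : legcount n.+1 0 = 0.
Proof. by rewrite /legcount /gL doubleS GL1 mul0r. Qed.

Lemma legcount_large n l : (n < l)%N -> legcount n l = 0.
Proof. by move=> nl; rewrite /legcount /gL GL_large ?mul0r // !ltnS ltn_double. Qed.

Lemma legcount_root n l : (0 < l)%N ->
  legcount n.+1 l = GR n.*2.+1 l.*2 / (n.*2.+1)`!%:R.
Proof.
move=> l0; rewrite /legcount /gL doubleS GL_S ?double_gt0 // factS natrM.
have f0 : (n.*2.+1)`!%:R != 0 :> R by rewrite pnatr_eq0 -lt0n fact_gt0.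
by field; rewrite f0 -natrD pnatr_eq0.
Qed.

Lemma legcount_rec n l : legcount n.+1 l.+1 =
  \sum_(k < n.+1) \sum_(i < l.+1) legcount k i * legcount (n - k) (l - i)
  + \sum_(k < n.+1) w k.+1.*2 * legcount n (l + k.+1).
Proof.
rewrite /legcount !doubleS gL_rec //; congr (_ + _).
  rewrite (@sum_even_ord _ (fun k => \sum_(i < l.*2.+3) gL k i * gL (n.*2 - k) (l.*2.+2 - i))).
    apply: eq_bigr => k _; rewrite big_ord_recr /= subnn [X in _ + X](_ : _ = 0) ?addr0; last first.
      by rewrite {2}/gL /GL gsum0 mul0r mulr0.
    rewrite (@sum_odd_ord _ (fun i => gL k.*2 i * gL (n.*2 - k.*2) (l.*2.+2 - i)) l.+1).
      by apply: eq_bigr => i _; congr (_ * gL _ _); [rewrite doubleB|have := leq_ord i; lia].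
    by move=> i oi; rewrite {1}/gL GL_parity ?oi ?orbT // !mul0r.
  by move=> k ok; rewrite big1 // => i _; rewrite {1}/gL GL_parity ?ok // !mul0r.
rewrite -doubleS (@sum_odd_ord _ (fun e => w e.+1 * gL n.*2 (l.*2.+2 + e)) n.+1).
  by apply: eq_bigr => k _; congr (w _ * gL _ _); lia.
by move=> e oe; rewrite w_odd ?mul0r.
Qed.

End Rec.

From mathcomp Require Import all_classical all_reals all_analysis.
Import Order.TTheory GRing.Theory Num.Theory numFieldNormedType.Exports.
Local Open Scope ring_scope.

(** * Comparison with the counts [Wn] *)

Definition face_weight (R : nzRingType) (q : nat -> R) (d : nat) : R :=
  if odd d then 0 else q (d %/ 2)%N.

(** A map in [Wn] is given by its vertex rotation, one in [gmap] by its face rotation;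
    [(s, a) -> (s * a, a)] exchanges them and is its own inverse. Maps with an odd face occur only
    on the right, with weight 0. The leg adds one to the root degree and supplies the shift
    [n.+1]. *)
Lemma Wn_legcount (R : realType) (q : nat -> R) l n : (0 < l)%N ->
  Wn q l n = legcount (face_weight q) n.+1 l.
Proof.
move=> l0; rewrite legcount_root // /Wn /GR /gsum; congr (_ / _).
rewrite pair_big_dep /=.
rewrite [RHS](bigID (fun p : {perm 'I_n.*2.+2} * {perm 'I_n.*2.+2} =>
  [forall f in porbits p.1, ~~ odd #|pred_of_set f|])) /= [X in _ = _ + X]big1 ?addr0; last first.
  move=> [s a] /= /andP[/gmapP gs]; rewrite negb_forall_in => /exists_inP[X XP]; rewrite negbK => oX.
  rewrite /owt (bigD1 X) /=; first by rewrite /face_weight oX mul0r.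
  case/imsetP: XP oX => x _ -> ox; apply: imset_f; rewrite !inE andbT.
  by apply: contraL ox; rewrite -eq_porbit_mem => /eqP ->; rewrite (gm_size gs) odd_double.
have saa (s a : {perm 'I_n.*2.+2}) : involutive a -> (s * a * a)%g = s.
  by move=> aI; apply/permP => x; rewrite !permM aI.
apply: (@sum_bij _ _ _ _ _ _ _ (fun p => (p.1 * p.2, p.2)%g) (fun p => (p.1 * p.2, p.2)%g)) => -[s a] /=.
  rewrite /is_bip_planar_map => /and5P[/forallP h1 /forallP h2 /forallP h3 h4 /andP[h5 h6]].
  have aI : involutive a by move=> x; apply/eqP.
  rewrite /face_perm in h4 h5; have sE := saa s a aI.
  have cn x y : connect (step s a) x y by move/forallP: (h3 x); apply.
  have sa : supp a = [set: 'I_n.*2.+2] by apply/setP => x; rewrite !inE h1.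
  have n1 : ncc s a = 1%N.
    rewrite /ncc /nclass (_ : [set cls _ x | x in _] = [set [set: 'I_n.*2.+2]]) ?cards1 //.
    apply/setP => X; rewrite inE; apply/imsetP/eqP => [[x _ ->]|->].
      by apply/setP => y; rewrite !inE cn.
    by exists ord0; rewrite ?inE //; apply/setP => y; rewrite !inE cn.
  split; last 1 first.
  - rewrite /map_weight /owt /root_face /face_perm /porbits.
    have -> : [set porbit (s * a) x | x in [set: 'I_n.*2.+2] :\: porbit (s * a) ord0] =
       [set X in porbits (s * a)%g | X != porbit (s * a) ord0].
      apply/setP => X; rewrite inE; apply/imsetP/andP => [[x]|[/imsetP[x _ ->] xr]].
        by rewrite !inE andbT => xr ->; rewrite imset_f // eq_porbit_mem.
      by exists x => //; rewrite !inE andbT -eq_porbit_mem.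
    rewrite [RHS](eq_bigl (fun X => (X \in porbits (s * a)%g) && (X != porbit (s * a) ord0))); last by move=> X; rewrite inE.
    apply: eq_bigr => X /andP[XP _]; rewrite /face_weight.
    by move/forall_inP: h5 => /(_ X XP) /negPf ->.
  - rewrite h5 andbT; apply/gmapP; split=> //; rewrite ?inE //; try by apply/perm_onP => x; rewrite inE.
    + by move=> x _; apply/negbTE/h1.
    + by move=> x _; rewrite connect_mul cn.
    + rewrite /euler sE ncc_mul n1 sa cardsT card_ord /ncyc; move/eqP: h4; move: #|porbits s| #|porbits (s * a)%g| => x y h4; apply/eqP; lia.
    + exact/eqP.
  - by rewrite sE.
case/andP=> /gmapP gs ev; have aI := gm_I gs; have sE := saa s a aI.
split; last by rewrite sE.
rewrite /is_bip_planar_map /face_perm /root_face /face_perm sE ev (gm_size gs) eqxx !andbT /=.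
have afp x : a x != x by rewrite (gm_fix gs) ?inE.
have cn x : connect (step (s * a) a) ord0 x by rewrite connect_mul (gm_con gs) ?inE.
apply/and4P; split.
- exact/forallP.
- by apply/forallP => x; rewrite aI.
- apply/forallP => x; apply/forallP => y.
  by apply: (@connect_trans _ _ ord0); rewrite -/(step _ _) ?cn // connect_step_sym cn.
- have := gm_euler gs; rewrite /euler.
  have n1 : ncc s a = 1%N.
    rewrite -ncc_mul /ncc /nclass (_ : [set cls _ x | x in _] = [set [set: 'I_n.*2.+2]]) ?cards1 //.
    have cxy x y : connect (step (s * a) a) x y.
      by apply: (@connect_trans _ _ ord0); rewrite ?cn // connect_step_sym cn.
    apply/setP => X; rewrite inE; apply/imsetP/eqP => [[x _ ->]|->].
      by apply/setP => y; rewrite !inE cxy.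
    by exists ord0; rewrite ?inE //; apply/setP => y; rewrite !inE cxy.
  have -> : supp a = [set: 'I_n.*2.+2] by apply/setP => x; rewrite !inE afp.
  rewrite n1 cardsT card_ord /ncyc => /eqP; move: #|porbits s| #|porbits (s * a)%g| => x y h4; apply/eqP; lia.
Qed.

Local Open Scope classical_set_scope.
Local Open Scope ring_scope.

(** * Absolutely convergent series *)

Lemma cvgn_eq (R : realType) (u v : nat -> R) (l : R) :
  u =1 v -> u n @[n --> \oo] --> l -> v n @[n --> \oo] --> l.
Proof. by move=> /funext ->. Qed.

Section AbsSum.
Variable R : realType.
Implicit Types u v : nat -> R.

(** Summability is kept as a bound on absolute partial sums, and [sm] is a total function, so that
    sums can be rewritten pointwise before summability is discussed. *)
Definition absum u := exists M, forall n, \sum_(i < n) `|u i| <= M.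
Definition sm u : R := limn (fun n => \sum_(i < n) u i).

Lemma eq_sm u v : u =1 v -> sm u = sm v.
Proof. by move=> /funext ->. Qed.

Lemma eq_absum u v : u =1 v -> absum u -> absum v.
Proof. by move=> /funext ->. Qed.

Lemma seriesordE u : series u = (fun n => \sum_(i < n) u i).
Proof. by apply/funext => n; rewrite /series /= big_mkord. Qed.

Lemma absum_cvg u : absum u -> (\sum_(i < n) u i) @[n --> \oo] --> sm u.
Proof.
case=> M uM; suff : cvgn (series u) by rewrite seriesordE.
apply: normed_cvg; have -> : [normed series u] = series (fun n => `|u n|) by [].
rewrite seriesordE; apply: nondecreasing_is_cvgn.
  by apply/nondecreasing_seqP => n; rewrite big_ord_recr /= lerDl.
by exists M => _ [n _ <-].
Qed.

Lemma sm_unique u l : (\sum_(i < n) u i) @[n --> \oo] --> l -> sm u = l.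
Proof. by move=> ul; apply: cvg_lim. Qed.

Lemma absum_ge0 u M : (forall i, 0 <= u i) -> (forall n, \sum_(i < n) u i <= M) -> absum u.
Proof.
by move=> u0 uM; exists M => n; under eq_bigr => i _ do rewrite ger0_norm //.
Qed.

Lemma absumW u v : (forall i, `|u i| <= v i) -> absum v -> absum u.
Proof.
move=> uv [M vM]; exists M => n; apply: le_trans (vM n).
by apply: ler_sum => i _; apply: le_trans (uv i) (ler_norm _).
Qed.

Lemma absum_norm u : absum u -> absum (fun i => `|u i|).
Proof. by case=> M uM; exists M => n; under eq_bigr => i _ do rewrite normr_id. Qed.

Lemma sm_le u M : absum u -> (forall n, \sum_(i < n) u i <= M) -> sm u <= M.
Proof.
move=> /absum_cvg uc uM; rewrite -(cvg_lim _ uc) //.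
by apply: limr_le; [apply: cvgP uc|apply: nearW].
Qed.

Lemma le_sm u v : absum u -> absum v -> (forall i, u i <= v i) -> sm u <= sm v.
Proof.
move=> /absum_cvg uc /absum_cvg vc uv.
apply: (ler_cvg_to uc vc); apply: nearW => n; exact: ler_sum.
Qed.

Lemma sm_ge u n : absum u -> (forall i, 0 <= u i) -> \sum_(i < n) u i <= sm u.
Proof.
move=> /absum_cvg uc u0; rewrite -(cvg_lim _ uc) //.
apply: nondecreasing_cvgn_le; last exact: cvgP uc.
by apply/nondecreasing_seqP => k; rewrite big_ord_recr /= lerDl.
Qed.

Lemma sm_ge0 u : absum u -> (forall i, 0 <= u i) -> 0 <= sm u.
Proof. by move=> ua u0; have := sm_ge 0 ua u0; rewrite big_ord0. Qed.

Lemma sm_term u n : absum u -> (forall i, 0 <= u i) -> u n <= sm u.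
Proof.
move=> ua u0; apply: le_trans (sm_ge n.+1 ua u0).
by rewrite big_ord_recr /= lerDr sumr_ge0.
Qed.

Lemma absumD u v : absum u -> absum v -> absum (fun i => u i + v i).
Proof.
move=> [M uM] [N vN]; exists (M + N) => n.
apply: le_trans (lerD (uM n) (vN n)); rewrite -big_split; apply: ler_sum => i _.
exact: ler_normD.
Qed.

Lemma absumZ k u : absum u -> absum (fun i => k * u i).
Proof.
move=> [M uM]; exists (`|k| * M) => n.
under eq_bigr => i _ do rewrite normrM.
by rewrite -mulr_sumr ler_wpM2l.
Qed.

Lemma absumN u : absum u -> absum (fun i => - u i).
Proof.
move=> ua; apply: (absumW _ (absum_norm ua)) => i; by rewrite normrN. Qed.

Lemma absumB u v : absum u -> absum v -> absum (fun i => u i - v i).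
Proof. by move=> ua va; apply: absumD => //; exact: absumN. Qed.

Lemma smD u v : absum u -> absum v -> sm (fun i => u i + v i) = sm u + sm v.
Proof.
move=> /absum_cvg uc /absum_cvg vc; apply: sm_unique.
under eq_cvg => n do rewrite big_split /=.
exact: cvgD uc vc.
Qed.

Lemma smZ k u : absum u -> sm (fun i => k * u i) = k * sm u.
Proof.
move=> /absum_cvg uc; apply: sm_unique.
under eq_cvg => n do rewrite -mulr_sumr.
exact: cvgMr uc.
Qed.

Lemma smN u : absum u -> sm (fun i => - u i) = - sm u.
Proof.
move=> ua; rewrite -mulN1r -smZ //; apply: eq_sm => i; by rewrite mulN1r.
Qed.

Lemma smB u v : absum u -> absum v -> sm (fun i => u i - v i) = sm u - sm v.
Proof. by move=> ua va; rewrite smD ?smN //; exact: absumN. Qed.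

Lemma absum0 : absum (fun=> 0).
Proof. by exists 0 => n; rewrite normr0 big1. Qed.

Lemma sm0 : sm (fun=> 0) = 0.
Proof. by apply: sm_unique; under eq_cvg => n do rewrite big1 //; exact: cvg_cst. Qed.

Lemma sm_norm u : absum u -> `|sm u| <= sm (fun i => `|u i|).
Proof.
move=> ua; have na := absum_norm ua; rewrite ler_norml -smN //; apply/andP; split; apply: le_sm => //.
- exact: absumN.
- by move=> i; rewrite lerNl -normrN ler_norm.
- by move=> i; exact: ler_norm.
Qed.

Lemma absum_fin (f : nat -> nat -> R) n :
  (forall j, (j < n)%N -> absum (f j)) -> absum (fun i => \sum_(j < n) f j i).
Proof.
elim: n => [|n IH] fa; first by apply: eq_absum absum0 => i; rewrite big_ord0.
have := absumD (IH (fun j jn => fa j (ltnW jn))) (fa n (ltnSn n)).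
by apply: eq_absum => i; rewrite big_ord_recr.
Qed.

Lemma sm_fin (f : nat -> nat -> R) n : (forall j, (j < n)%N -> absum (f j)) ->
  sm (fun i => \sum_(j < n) f j i) = \sum_(j < n) sm (f j).
Proof.
elim: n => [|n IH] fa.
  by rewrite big_ord0 -[RHS]sm0; apply: eq_sm => i; rewrite big_ord0.
have fa' j : (j < n)%N -> absum (f j) by move=> /ltnW; exact: fa.
rewrite big_ord_recr /= -(IH fa') -(smD (absum_fin fa') (fa n (ltnSn n))).
by apply: eq_sm => i; rewrite big_ord_recr.
Qed.

Lemma absum_shift n u : absum u <-> absum (fun k => u (n + k)%N).
Proof.
split=> -[M uM].
  exists M => k; apply: le_trans (uM (n + k)%N).
  by rewrite big_split_ord /= lerDr sumr_ge0.
exists (\sum_(i < n) `|u i| + M) => k; apply: le_trans (lerD (lexx _) (uM k)).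
apply: le_trans (_ : _ <= \sum_(i < n + k) `|u i|) _; last by rewrite big_split_ord.
by rewrite addnC big_split_ord /= lerDl sumr_ge0.
Qed.

Lemma sm_shift n u : absum u -> sm u = \sum_(i < n) u i + sm (fun k => u (n + k)%N).
Proof.
move=> ua; have /absum_cvg va := (absum_shift n u).1 ua.
apply: sm_unique; rewrite -(cvg_shiftn n) /=.
have : (\sum_(i < n) u i + \sum_(i < k) u (n + i)%N) @[k --> \oo] -->
    \sum_(i < n) u i + sm (fun k => u (n + k)%N) by apply: cvgD va; exact: cvg_cst.
apply: cvg_trans; apply: near_eq_cvg; apply: nearW => k.
by rewrite addnC big_split_ord.
Qed.

Lemma sm_recl u : absum u -> sm u = u 0%N + sm (fun k => u k.+1).
Proof. by move=> ua; rewrite (sm_shift 1 ua) big_ord1. Qed.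

Lemma sm_tail u e : absum u -> 0 < e ->
  exists N, forall n, (N <= n)%N -> sm (fun k => `|u (n + k)%N|) <= e.
Proof.
move=> /absum_norm ua e0; have /cvgrPdist_le /(_ e e0)[N _ H] := absum_cvg ua.
exists N => n Nn; have := H n Nn; rewrite (sm_shift n ua) addrC addKr => h.
exact: le_trans (ler_norm _) h.
Qed.

Lemma sm_finsupp u n : (forall k, (n <= k)%N -> u k = 0) -> sm u = \sum_(i < n) u i.
Proof.
move=> u0; apply: sm_unique; rewrite -(cvg_shiftn n) /=.
apply: (cvg_trans _ (@cvg_cst _ (\sum_(i < n) u i) _ \oo _)); apply: near_eq_cvg; apply: nearW => k /=.
by rewrite addnC big_split_ord /= [X in _ = _ + X]big1 ?addr0 // => i _; rewrite u0 // leq_addr.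
Qed.

Lemma absum_finsupp u n : (forall k, (n <= k)%N -> u k = 0) -> absum u.
Proof.
move=> u0; rewrite (absum_shift n); apply: eq_absum absum0 => k.
by rewrite u0 // leq_addr.
Qed.

Section Fubini.
Variable f : nat -> nat -> R.

Lemma fubini_nneg : (forall i j, 0 <= f i j) -> (forall i, absum (f i)) ->
  absum (fun i => sm (f i)) ->
  [/\ forall j, absum (fun i => f i j), absum (fun j => sm (fun i => f i j)) &
      sm (fun j => sm (fun i => f i j)) <= sm (fun i => sm (f i))].
Proof.
move=> f0 fa fs.
have sf0 i : 0 <= sm (f i) by apply: sm_ge0.
have ca j : absum (fun i => f i j).
  by apply: absumW fs => i; rewrite ger0_norm // sm_term.
have B n : \sum_(j < n) sm (fun i => f i j) <= sm (fun i => sm (f i)).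
  rewrite -(@sm_fin (fun j i => f i j)) //; apply: le_sm => //.
    by apply: (@absum_fin (fun j i => f i j)) => j _.
  by move=> i; exact: sm_ge.
have sa : absum (fun j => sm (fun i => f i j)).
  by apply: (absum_ge0 _ B) => j; apply: sm_ge0.
by split=> //; exact: sm_le.
Qed.

End Fubini.

Lemma fubini_nneg_eq (f : nat -> nat -> R) : (forall i j, 0 <= f i j) -> (forall i, absum (f i)) ->
  absum (fun i => sm (f i)) ->
  sm (fun i => sm (f i)) = sm (fun j => sm (fun i => f i j)).
Proof.
move=> f0 fa fs; have [ca cs le] := fubini_nneg f0 fa fs.
by apply/eqP; rewrite eq_le le andbT; have [] := @fubini_nneg (fun j i => f i j) (fun j i => f0 i j) ca cs.
Qed.

Lemma fubini (f : nat -> nat -> R) : (forall i, absum (f i)) ->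
  absum (fun i => sm (fun j => `|f i j|)) ->
  [/\ forall j, absum (fun i => f i j), absum (fun j => sm (fun i => `|f i j|)) &
   sm (fun i => sm (f i)) = sm (fun j => sm (fun i => f i j))].
Proof.
move=> fa fs; have na i : absum (fun j => `|f i j|) by apply: absum_norm.
have [ca cs _] := @fubini_nneg (fun i j => `|f i j|) (fun i j => normr_ge0 _) na fs.
have E1 := @fubini_nneg_eq (fun i j => `|f i j|) (fun i j => normr_ge0 _) na fs.
pose g i j := `|f i j| - f i j.
have g0 i j : 0 <= g i j by rewrite subr_ge0 ler_norm.
have ga i : absum (g i) by apply: absumB.
have ca' j : absum (fun i => f i j).
  by apply: (absumW _ (ca j)).
have sfa : absum (fun i => sm (f i)).
  by apply: (absumW _ fs) => i; exact: sm_norm.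
have gs : absum (fun i => sm (g i)).
  by apply: eq_absum (absumB fs sfa) => i; rewrite smB.
have E2 := fubini_nneg_eq g0 ga gs.
have sfa' : absum (fun j => sm (fun i => f i j)).
  by apply: (absumW _ cs) => i; exact: sm_norm.
split=> //.
have L : sm (fun i => sm (g i)) = sm (fun i => sm (fun j => `|f i j|)) - sm (fun i => sm (f i)).
  by rewrite -smB //; apply: eq_sm => i; rewrite smB.
have L' : sm (fun j => sm (fun i => g i j)) =
    sm (fun j => sm (fun i => `|f i j|)) - sm (fun j => sm (fun i => f i j)).
  by rewrite -smB //; apply: eq_sm => i; rewrite smB.
by move: E2; rewrite L L' -E1 => /addrI /oppr_inj.
Qed.

Lemma absumM u v : absum u -> absum v -> absum (fun n => \sum_(i < n.+1) u i * v (n - i)%N) /\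
  sm (fun n => \sum_(i < n.+1) u i * v (n - i)%N) = sm u * sm v.
Proof.
move=> ua va; pose f i n := if (i <= n)%N then u i * v (n - i)%N else 0.
have fi i : absum (f i).
  rewrite (absum_shift i); apply: eq_absum (absumZ (u i) va) => k.
  by rewrite /f leq_addr addKn.
have sfi (x y : nat -> R) i : absum y -> sm (fun n => if (i <= n)%N then x i * y (n - i)%N else 0) = x i * sm y.
  move=> ya; have fa : absum (fun n => if (i <= n)%N then x i * y (n - i)%N else 0).
    rewrite (absum_shift i); apply: eq_absum (absumZ (x i) ya) => k.
    by rewrite leq_addr addKn.
  rewrite (sm_shift i fa) big1 ?add0r => [|k _]; last by rewrite leqNgt ltn_ord.
  by rewrite -smZ //; apply: eq_sm => k; rewrite leq_addr addKn.
have nf i n : `|f i n| = if (i <= n)%N then `|u i| * `|v (n - i)%N| else 0.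
  by rewrite /f; case: ifP => _; rewrite ?normrM ?normr0.
have fs : absum (fun i => sm (fun n => `|f i n|)).
  apply: eq_absum (absumZ (sm (fun k => `|v k|)) (absum_norm ua)) => i.
  rewrite mulrC -(sfi (fun i => `|u i|) (fun k => `|v k|)); last exact: absum_norm.
  by apply: eq_sm => n; rewrite nf.
have [ca cs E] := fubini fi fs.
have cE n : sm (fun i => f i n) = \sum_(i < n.+1) u i * v (n - i)%N.
  rewrite (@sm_finsupp _ n.+1) => [|k nk]; last by rewrite /f leqNgt nk.
  by apply: eq_bigr => i _; rewrite /f -ltnS ltn_ord.
split.
  apply: (absumW _ cs) => n; rewrite -cE; exact: sm_norm.
rewrite -(eq_sm cE) -E; under eq_sm => i do rewrite /f sfi //.
by under eq_sm => i do rewrite mulrC; rewrite smZ // mulrC.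
Qed.

End AbsSum.

(** * Tutte's equation for the partition functions *)

Lemma legcount_ge0 (R : realType) (w : nat -> R) n l :
  (forall d, (0 < d)%N -> 0 <= w d) -> 0 <= legcount w n l.
Proof.
move=> w0; rewrite /legcount /gL divr_ge0 ?ler0n // /GL /gsum sumr_ge0 // => -[s a] _.
rewrite /owt prodr_ge0 // => X /imsetP[x _ ->].
by apply: w0; rewrite lt0n card_porbit_neq0.
Qed.

Section Tutte.
Variables (R : realType) (q : nat -> R).
Hypotheses (q0 : forall k, (0 < k)%N -> 0 <= q k) (qadm : admissible q).

Let w := face_weight q.
Let w_odd d : odd d -> w d = 0. Proof. by rewrite /w /face_weight => ->. Qed.
Let w_ge0 d : (0 < d)%N -> 0 <= w d.
Proof.
move=> d0; rewrite /w /face_weight; case: ifP => // /negbT ev; apply: q0.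
by rewrite divn_gt0 //; case: d d0 ev => [|[|]].
Qed.

(** Agrees with [Wr q l] for [l > 0]; at [l = 0] it counts the vertex map alone, which gives the
    convention [W_0 = 1]. *)
Definition disk l : R := sm (fun n => legcount w n l).

Lemma absum_Wr l : (0 < l)%N -> absum (fun n => Wn q l n) /\ Wr q l = sm (fun n => Wn q l n).
Proof.
move=> l0; have W0 n : 0 <= Wn q l n by rewrite Wn_legcount // legcount_ge0.
have Wfin : W q l \is a fin_num.
  rewrite ge0_fin_numE ?qadm // /W; apply: nneseries_ge0 => n _ _; by rewrite lee_fin.
have B n : \sum_(i < n) Wn q l i <= Wr q l.
  rewrite -lee_fin /Wr fineK // -sumEFin -(big_mkord xpredT (fun i => (Wn q l i)%:E)).
  by apply: nneseries_lim_ge => i _ _; rewrite lee_fin.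
have Wa : absum (fun n => Wn q l n) by exact: absum_ge0 B.
split=> //; rewrite /Wr /W.
have H : (\sum_(0 <= i < n) (Wn q l i)%:E)%E @[n --> \oo] --> (sm (fun n => Wn q l n))%:E.
  apply: cvg_EFin; first by apply: nearW => n; rewrite sumEFin.
  apply: cvg_trans (absum_cvg Wa); apply: near_eq_cvg; apply: nearW => n /=.
  by rewrite sumEFin /= big_mkord.
by rewrite (cvg_lim _ H).
Qed.

Lemma disk0 : disk 0 = 1.
Proof.
rewrite /disk (@sm_finsupp _ _ 1) => [|[|k] // _]; last exact: legcountS0.
by rewrite big_ord1 legcount0.
Qed.

Lemma absum_disk l : absum (fun n => legcount w n l).
Proof.
case: l => [|l].
  by apply: (@absum_finsupp _ _ 1) => -[|k] // _; exact: legcountS0.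
rewrite (absum_shift 1); have [+ _] := @absum_Wr l.+1 isT.
by apply: eq_absum => n; rewrite Wn_legcount.
Qed.

Lemma disk_Wr l : (0 < l)%N -> disk l = Wr q l.
Proof.
move=> l0; rewrite /disk (sm_recl (absum_disk l)) legcount0 gtn_eqF // add0r.
by have [_ ->] := absum_Wr l0; apply: eq_sm => n; rewrite Wn_legcount.
Qed.

Lemma disk_ge0 l : 0 <= disk l.
Proof. by apply: sm_ge0; [exact: absum_disk|move=> n; exact: legcount_ge0]. Qed.

Lemma disk_tutte l :
  absum (fun k => q k.+1 * disk (l + k.+1)%N) /\
  disk l.+1 = (\sum_(i < l.+1) disk i * disk (l - i)%N) + sm (fun k => q k.+1 * disk (l + k.+1)%N).
Proof.
have lc0 n m : 0 <= legcount w n m by exact: legcount_ge0.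
have wq k : w k.+1.*2 = q k.+1.
  by rewrite /w /face_weight odd_double -muln2 mulnK.
pose F n := \sum_(k < n.+1) \sum_(i < l.+1) legcount w k i * legcount w (n - k) (l - i).
pose G n := \sum_(k < n.+1) q k.+1 * legcount w n (l + k.+1).
have rec n : legcount w n.+1 l.+1 = F n + G n.
  rewrite legcount_rec //; congr (_ + _); apply: eq_bigr => k _; by rewrite wq.
have F0 n : 0 <= F n by rewrite /F sumr_ge0 // => k _; rewrite sumr_ge0 // => i _; rewrite mulr_ge0.
have G0 n : 0 <= G n by rewrite /G sumr_ge0 // => k _; rewrite mulr_ge0 // q0.
have FGa : absum (fun n => F n + G n).
  by have := (absum_shift 1 _).1 (absum_disk l.+1); apply: eq_absum => n; rewrite rec.
have Fa : absum F by apply: (absumW _ FGa) => n; rewrite ger0_norm // lerDl.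
have Ga : absum G by apply: (absumW _ FGa) => n; rewrite ger0_norm // lerDr.
have dE : disk l.+1 = sm F + sm G.
  rewrite /disk (sm_recl (absum_disk l.+1)) legcount0 add0r -smD //.
  by apply: eq_sm => n; rewrite rec.
have FE : sm F = \sum_(i < l.+1) disk i * disk (l - i).
  have FE n : F n = \sum_(i < l.+1) \sum_(k < n.+1) legcount w k i * legcount w (n - k) (l - i).
    by rewrite /F exchange_big.
  rewrite (eq_sm FE) (@sm_fin _ (fun i n => \sum_(k < n.+1) legcount w k i * legcount w (n - k) (l - i))).
    apply: eq_bigr => i _; exact: (absumM (absum_disk i) (absum_disk (l - i))).2.
  by move=> i _; exact: (absumM (absum_disk i) (absum_disk (l - i))).1.
pose f n k := q k.+1 * legcount w n (l + k.+1).
have f0 n k : 0 <= f n k by rewrite mulr_ge0 // q0.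
have fz n k : (n.+1 <= k)%N -> f n k = 0.
  by move=> nk; rewrite /f legcount_large ?mulr0 //; lia.
have fa n : absum (f n) by apply: (absum_finsupp (fz n)).
have sfE n : sm (f n) = G n by rewrite (sm_finsupp (fz n)).
have sfa : absum (fun n => sm (f n)) by apply: eq_absum Ga => n; rewrite sfE.
have [_ ca _] := fubini_nneg f0 fa sfa; have E := fubini_nneg_eq f0 fa sfa.
have cE k : sm (fun n => f n k) = q k.+1 * disk (l + k.+1).
  by rewrite /f smZ //; exact: absum_disk.
split; first by apply: eq_absum ca => k; rewrite cE.
by rewrite dE FE -(eq_sm cE) -E; congr (_ + _); apply: eq_sm => n; rewrite sfE.
Qed.

End Tutte.

(** * Central binomial coefficients *)

Section HSeq.
Variable R : realType.

(** The coefficients of [(1 - z)^(-1/2)]. The [locked] keeps simplification from unfolding the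
    product. *)
Definition hb (n : nat) : R :=
  locked (fun n => \prod_(i < n) ((2 * i%:R + 1) / (2 * i%:R + 2))) n.

Lemma hb0 : hb 0 = 1. Proof. by rewrite /hb -lock big_ord0. Qed.

Lemma hbS n : hb n.+1 = hb n * ((2 * n%:R + 1) / (2 * n%:R + 2)).
Proof. by rewrite /hb -lock big_ord_recr. Qed.

Lemma hb_gt0 n : 0 < hb n.
Proof.
elim: n => [|n IH]; first by rewrite hb0 ltr01.
rewrite hbS; by rewrite mulr_gt0 // divr_gt0 //; have := ler0n R n; lra.
Qed.

Lemma hb_ge0 n : 0 <= hb n. Proof. exact: ltW (hb_gt0 n). Qed.

Lemma hb_recE n : (n.+1%:R) * hb n.+1 = (n%:R + 2^-1) * hb n.
Proof.
rewrite hbS -natr1; have := ler0n R n => n0; field; lra.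
Qed.

Lemma hb_leS n : hb n.+1 <= hb n.
Proof.
rewrite hbS ler_piMr ?hb_ge0 // ler_pdivrMr; have := ler0n R n; lra.
Qed.

Lemma hb_le m n : (m <= n)%N -> hb n <= hb m.
Proof.
move=> /subnK <-; elim: (n - m)%N => [|k IH] //; rewrite addSn.
exact: le_trans (hb_leS _) IH.
Qed.

Lemma hb_le1 n : hb n <= 1. Proof. by rewrite -hb0; exact: hb_le. Qed.

(** The square of [(1 - z)^(-1/2)] is [1 / (1 - z)]. Weighting each term by its index gives half of
    [n] times the sum, by symmetry; [hb_recE] compares the weighted sums for [n] and [n.+1]. *)
Lemma hb_conv n : \sum_(i < n.+1) hb i * hb (n - i) = 1.
Proof.
elim: n => [|n IH]; first by rewrite big_ord1 hb0 mulr1.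
set S := \sum_(i < _) _.
have rev : \sum_(i < n.+2) i%:R * (hb i * hb (n.+1 - i)) =
    \sum_(i < n.+2) (n.+1 - i)%:R * (hb i * hb (n.+1 - i)).
  rewrite [LHS](reindex_inj rev_ord_inj) /=; apply: eq_bigr => i _.
  by rewrite subSS subKn ?leq_ord // [hb (_ - _) * _]mulrC.
have sS : 2 * (\sum_(i < n.+2) i%:R * (hb i * hb (n.+1 - i))) = n.+1%:R * S.
  rewrite [LHS]mulr_natl mulr2n {2}rev -big_split /= mulr_sumr; apply: eq_bigr => i _.
  by rewrite -mulrDl -natrD subnKC ?leq_ord.
have E : \sum_(i < n.+2) i%:R * (hb i * hb (n.+1 - i)) =
   \sum_(i < n.+1) (i%:R + 2^-1) * (hb i * hb (n - i)).
  rewrite big_ord_recl /= mul0r add0r; apply: eq_bigr => i _.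
  by rewrite /bump /= !add1n subSS mulrA hb_recE !mulrA.
have rev2 : \sum_(i < n.+1) i%:R * (hb i * hb (n - i)) =
    \sum_(i < n.+1) (n - i)%:R * (hb i * hb (n - i)).
  rewrite [LHS](reindex_inj rev_ord_inj) /=; apply: eq_bigr => i _.
  by rewrite subSS subKn ?leq_ord // [hb (_ - _) * _]mulrC.
have sS2 : 2 * (\sum_(i < n.+1) i%:R * (hb i * hb (n - i))) = n%:R.
  transitivity (n%:R * \sum_(i < n.+1) hb i * hb (n - i)); last by rewrite IH mulr1.
  rewrite [LHS]mulr_natl mulr2n {2}rev2 -big_split /= mulr_sumr; apply: eq_bigr => i _.
  by rewrite -mulrDl -natrD subnKC ?leq_ord.
have E2 : \sum_(i < n.+1) (i%:R + 2^-1) * (hb i * hb (n - i)) =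
   \sum_(i < n.+1) i%:R * (hb i * hb (n - i)) + 2^-1.
  transitivity (\sum_(i < n.+1) i%:R * (hb i * hb (n - i)) + 2^-1 * \sum_(i < n.+1) hb i * hb (n - i)).
    by rewrite mulr_sumr -big_split /=; apply: eq_bigr => i _; rewrite mulrDl.
  by rewrite IH mulr1.
have n1 : n.+1%:R != 0 :> R by rewrite pnatr_eq0.
apply: (mulfI n1); rewrite -sS E E2 mulr1 mulrDr sS2 -[n.+1%:R]natr1; congr (_ + _).
by rewrite divff ?pnatr_eq0.
Qed.

Definition al (p : nat) : R := if p is n.+1 then hb n - hb n.+1 else 0.

Lemma alE n : al n.+1 = hb n / (2 * n%:R + 2).
Proof. rewrite /al hbS; have := ler0n R n => n0; field; lra. Qed.

Lemma al_ge0 p : 0 <= al p.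
Proof. by case: p => //= n; rewrite subr_ge0 hb_leS. Qed.

Lemma al_gt0 p : 0 < al p.+1.
Proof. by rewrite alE divr_gt0 ?hb_gt0 //; have := ler0n R p; lra. Qed.

Lemma al1 : al 1 = 2^-1.
Proof. by rewrite alE hb0 mulr0 add0r mul1r. Qed.

Lemma al_sum n : \sum_(p < n.+1) al p = 1 - hb n.
Proof.
elim: n => [|n IH]; first by rewrite big_ord1 /= hb0 subrr.
by rewrite big_ord_recr IH /= addrA subrK.
Qed.

Lemma al_le1 p : al p <= 1.
Proof.
by case: p => [|n]; [exact: ler01|have := hb_le1 n; have := hb_ge0 n.+1; rewrite /al; lra].
Qed.

Lemma absum_al : absum al.
Proof.
apply: (@absum_ge0 _ _ 1) => [|n]; first exact: al_ge0.
case: n => [|n]; first by rewrite big_ord0.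
by rewrite al_sum gerBl hb_ge0.
Qed.

(** The coefficients of [sqrt (1 - z)], hence the convolution inverse of [hb]; that its square is
    [1 - z] gives [al_conv]. *)
Definition gal (p : nat) : R := (p == 0)%:R - al p.

Lemma gal0 : gal 0 = 1. Proof. by rewrite /gal /= subr0. Qed.
Lemma galS p : gal p.+1 = hb p.+1 - hb p. Proof. by rewrite /gal /= sub0r opprB. Qed.

Lemma gal_mul (u : nat -> R) n :
  \sum_(i < n.+1) gal i * u (n - i)%N =
  \sum_(i < n.+1) hb i * u (n - i)%N - (if n is m.+1 then \sum_(i < m.+1) hb i * u (m - i)%N else 0).
Proof.
rewrite !big_ord_recl gal0 hb0 /= -addrA; congr (_ + _).
case: n => [|m]; first by rewrite !big_ord0 subr0.
by rewrite -sumrB; apply: eq_bigr => i _; rewrite /bump /= galS subSS mulrBl.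
Qed.

Lemma gal_hb n : \sum_(i < n.+1) gal i * hb (n - i) = (n == 0)%:R.
Proof. by rewrite gal_mul hb_conv; case: n => [|n]; rewrite ?subr0 // hb_conv subrr. Qed.

Lemma hb_gal n : \sum_(i < n.+1) hb i * gal (n - i) = (n == 0)%:R.
Proof.
rewrite -gal_hb (reindex_inj rev_ord_inj) /=; apply: eq_bigr => i _.
by rewrite subSS subKn ?leq_ord // mulrC.
Qed.

Lemma al_conv p : (1 < p)%N -> \sum_(i < p.+1) al i * al (p - i) = 2 * al p.
Proof.
case: p => [|[|p]] // _; have := gal_mul gal p.+2; rewrite !hb_gal /= subr0.
have -> : \sum_(i < p.+3) gal i * gal (p.+2 - i) =
    \sum_(i < p.+3) al i * al (p.+2 - i) - 2 * al p.+2.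
  rewrite big_ord_recl big_ord_recr [in RHS]big_ord_recl [in RHS]big_ord_recr /=.
  rewrite /bump /= add1n subnn gal0 mul1r mulr1 mul0r mulr0 add0r addr0.
  rewrite (eq_bigr (fun i : 'I_p.+1 => al (bump 0 i) * al (p.+2 - bump 0 i))) => [|i _].
    by rewrite /gal /=; ring.
  rewrite /bump /= /gal !add1n /= subSS; have -> : (p.+1 - i == 0)%N = false.
    by apply/negbTE; rewrite subn_eq0 -ltnNge.
  by rewrite !sub0r mulrNN.
by move/eqP; rewrite subr_eq0 => /eqP.
Qed.

(** Here and in [hb_sqr_ge] a rational multiple of [hb n ^+ 2] is monotone in [n]. The two bounds
    [1/(4n) <= hb n ^+ 2 <= 1/(2n+1)] take the place of Stirling's formula. *)
Lemma hb_sqr_le n : hb n ^+ 2 * (2 * n%:R + 1) <= 1.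
Proof.
elim: n => [|n IH]; first by rewrite hb0 expr1n mulr0 add0r mulr1.
apply: le_trans IH; rewrite hbS -natr1 exprMn -mulrA ler_wpM2l ?sqr_ge0 //.
have n0 := ler0n R n; rewrite expr_div_n mulrAC ler_pdivrMr; last by apply: exprn_gt0; lra.
nra.
Qed.

Lemma hb_sqr_ge n : 1 <= hb n.+1 ^+ 2 * (4 * n.+1%:R).
Proof.
elim: n => [|n IH]; first by rewrite hbS hb0 mulr0 !add0r !mul1r expr2; lra.
apply: le_trans IH _; rewrite (hbS n.+1) exprMn -[leRHS]mulrA ler_wpM2l ?sqr_ge0 //.
rewrite -[n.+2%:R]natr1; have n0 : 0 <= n.+1%:R :> R by exact: ler0n.
set x := n.+1%:R in n0 *; rewrite expr_div_n mulrAC ler_pdivlMr; last by apply: exprn_gt0; lra.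
nra.
Qed.

Lemma hb_cvg0 e : 0 < e -> exists N, forall n, (N <= n)%N -> hb n <= e.
Proof.
move=> e0; exists (Num.bound (e ^- 2)) => n Nn.
rewrite -(ler_pXn2r (ltn0Sn 1)) ?nnegrE ?hb_ge0 ?(ltW e0) //.
have n0 := ler0n R n; have e2 : 0 < e ^+ 2 by exact: exprn_gt0.
have : e ^- 2 <= n%:R.
  apply: le_trans (ltW (archi_boundP _)) _; first by rewrite invr_ge0 ltW.
  by rewrite ler_nat.
rewrite -div1r ler_pdivrMr // => h; have := hb_sqr_le n; nra.
Qed.

End HSeq.

(** * Wiener-Hopf factorisation *)

Section Pairing.
Variable R : realType.
Implicit Types a b u v : nat -> R.

(* [corr b v p] is the coefficient of z^p in b(1/z) v(z) *)
Definition corr b v p : R := sm (fun k => b k * v (p + k)%N).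

Definition bounded_seq u := exists M, forall i, `|u i| <= M.

Lemma absum_bounded u : absum u -> bounded_seq u.
Proof.
case=> M uM; exists M => i; apply: le_trans (uM i.+1).
by rewrite big_ord_recr /= lerDr sumr_ge0.
Qed.

Lemma absum_mul_bounded u v : absum u -> bounded_seq v -> absum (fun k => u k * v k).
Proof.
move=> ua [M vM]; apply: (absumW _ (absumZ M (absum_norm ua))) => i.
by rewrite normrM mulrC ler_wpM2r.
Qed.

Lemma absum_corr b v p : absum b -> bounded_seq v -> absum (fun k => b k * v (p + k)%N).
Proof. by move=> ba [M vM]; apply: absum_mul_bounded => //; exists M => i. Qed.

Lemma absum_shift_bounded u p : bounded_seq u -> bounded_seq (fun k => u (p + k)%N).
Proof. by case=> M uM; exists M => i. Qed.

Definition tl u k : R := sm (fun j => u (k + j)%N).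

Lemma absum_tlE u k : absum u -> absum (fun j => u (k + j)%N).
Proof. by move=> /(absum_shift k). Qed.

Lemma tl_split u k : absum u -> sm u = \sum_(i < k) u i + tl u k.
Proof. exact: sm_shift. Qed.

Lemma tl_ge0 u k : absum u -> (forall i, 0 <= u i) -> 0 <= tl u k.
Proof. by move=> ua u0; apply: sm_ge0 => //; exact: absum_tlE. Qed.

Lemma tl_le u k : absum u -> (forall i, 0 <= u i) -> tl u k <= sm u.
Proof. by move=> ua u0; rewrite (tl_split k ua) lerDr sumr_ge0. Qed.

Lemma tlS u k : absum u -> tl u k = u k + tl u k.+1.
Proof.
move=> ua; rewrite /tl (sm_recl (absum_tlE k ua)) addn0; congr (_ + _).
by apply: eq_sm => j; rewrite addSnnS.
Qed.

Lemma tl_corr b v m : absum b -> absum v -> (forall k, 0 <= b k) -> (forall k, 0 <= v k) ->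
  absum (corr b v) /\ tl (corr b v) m = sm (fun k => b k * tl v (m + k)).
Proof.
move=> ba va b0 v0; pose f k p := b k * v (p + k)%N.
have vb := absum_bounded va.
have f0 k p : 0 <= f k p by rewrite mulr_ge0.
have fa k : absum (f k).
  by apply: absumZ; apply: eq_absum ((absum_shift k v).1 va) => p; rewrite addnC.
have sfa : absum (fun k => sm (f k)).
  apply: (absumW _ (absumZ (sm v) ba)) => k.
  rewrite ger0_norm; last exact: sm_ge0.
  rewrite /f smZ; last by apply: eq_absum ((absum_shift k v).1 va) => p; rewrite addnC.
  rewrite mulrC ler_wpM2r // -[leRHS]/(sm v) (eq_sm (v := fun p => v (k + p)%N)); last by move=> p; rewrite addnC.
  exact: tl_le.
have [ca cs _] := fubini_nneg f0 fa sfa.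
split; first exact: cs.
pose g k p := b k * v (m + p + k)%N.
have g0 k p : 0 <= g k p by rewrite mulr_ge0.
have ga k : absum (g k).
  by apply: eq_absum ((absum_shift m (f k)).1 (fa k)) => p.
have gE k : sm (g k) = b k * tl v (m + k).
  rewrite /g smZ; last first.
    by apply: eq_absum ((absum_shift (m + k) v).1 va) => p; rewrite addnAC.
  by congr (_ * _); apply: eq_sm => p; rewrite addnAC.
have gsa : absum (fun k => sm (g k)).
  apply: (absumW _ (absumZ (sm v) ba)) => k.
  rewrite gE ger0_norm ?mulr_ge0 ?tl_ge0 // mulrC ler_wpM2r //; exact: tl_le.
rewrite -(eq_sm gE) (fubini_nneg_eq g0 ga gsa).
by apply: eq_sm => p.
Qed.

(* The two cross terms of (sum_p a_p z^p) (sum_k b_k z^{-k}) add up to the product of the sums. *)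
Lemma corr_mass a b : absum a -> absum b -> (forall k, 0 <= a k) -> (forall k, 0 <= b k) ->
  tl (corr b a) 1 + sm (corr a b) = sm a * sm b.
Proof.
move=> aa ba a0 b0.
have [_ ->] := tl_corr 1 ba aa b0 a0.
have [ca E0] := tl_corr 0 aa ba a0 b0.
have -> : sm (corr a b) = sm (fun k => a k * tl b k).
  have := E0; rewrite /tl /= => E; rewrite -[LHS](eq_sm (u := fun j => corr a b (0 + j))) //.
pose f p m := if (p <= m)%N then a p * b m else 0.
have f0 p m : 0 <= f p m by rewrite /f; case: ifP => // _; rewrite mulr_ge0.
have fa p : absum (f p).
  rewrite (absum_shift p); apply: eq_absum (absumZ (a p) (absum_tlE p ba)) => j.
  by rewrite /f leq_addr.
have fE p : sm (f p) = a p * tl b p.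
  rewrite (sm_shift p (fa p)) big1 ?add0r => [|k _]; last by rewrite /f leqNgt ltn_ord.
  by rewrite -smZ; [apply: eq_sm => j; rewrite /f leq_addr|exact: absum_tlE].
have sfa : absum (fun p => sm (f p)).
  apply: (absumW _ (absumZ (sm b) aa)) => p.
  by rewrite fE ger0_norm ?mulr_ge0 ?tl_ge0 // mulrC ler_wpM2r // tl_le.
rewrite -[in X in _ + X](eq_sm fE) (fubini_nneg_eq f0 fa sfa).
have cE m : sm (fun p => f p m) = b m * \sum_(p < m.+1) a p.
  rewrite (@sm_finsupp _ _ m.+1) => [|k mk]; last by rewrite /f leqNgt mk.
  by rewrite mulr_sumr; apply: eq_bigr => i _; rewrite /f -ltnS ltn_ord mulrC.
have [_ cs _] := fubini_nneg f0 fa sfa.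
have ca2 : absum (fun m => b m * \sum_(p < m.+1) a p).
  by apply: eq_absum cs => m; rewrite cE.
have ca1 : absum (fun k => b k * tl a (1 + k)).
  apply: (absumW _ (absumZ (sm a) ba)) => k.
  by rewrite ger0_norm ?mulr_ge0 ?tl_ge0 // mulrC ler_wpM2r // tl_le.
rewrite (eq_sm cE) -smD // [RHS]mulrC -[RHS]mulrC -smZ //.
by apply: eq_sm => k; rewrite -mulrDr addrC add1n -(tl_split k.+1 aa) mulrC.
Qed.

End Pairing.

Section WienerHopf.
Variables (R : realType) (A B : nat -> R).
Hypotheses (A00 : A 0 = 0) (A0 : forall p, 0 <= A p) (B0 : forall k, 0 <= B k).
Hypotheses (Aa : absum A) (Ba : absum B) (AB1 : sm A + sm B <= 1).

(** The positive and the nonpositive powers in [(1 - a(z)) (1 - b(1/z)) = 1 - A(z) - B(1/z)] read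
    [a = A + corr b a] and [b = B + corr a b]; this is the corresponding fixed-point map. The case
    [p = 0] keeps [a] free of a constant term. *)
Definition wh_step (x : (nat -> R) * (nat -> R)) : (nat -> R) * (nat -> R) :=
  (fun p => A p + (if p == 0 then 0 else corr x.2 x.1 p), fun k => B k + corr x.1 x.2 k).

Definition wh_iter n := iter n wh_step (fun=> 0, fun=> 0).

Definition wh_ok (x : (nat -> R) * (nat -> R)) :=
  [/\ (forall p, 0 <= x.1 p) /\ (forall k, 0 <= x.2 k), x.1 0%N = 0, absum x.1 /\ absum x.2,
      sm x.1 <= 1 /\ sm x.2 <= 1 &
      (forall p, x.1 p <= (wh_step x).1 p) /\ (forall k, x.2 k <= (wh_step x).2 k)].

Lemma le_corr (a a' b b' : nat -> R) p : absum b -> absum a -> absum b' -> absum a' ->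
  (forall k, 0 <= b k) -> (forall k, 0 <= a k) ->
  (forall k, b k <= b' k) -> (forall k, a k <= a' k) -> corr b a p <= corr b' a' p.
Proof.
move=> ba aa ba' aa' b0 a0 bb aa2; apply: le_sm.
- by apply: absum_corr => //; exact: absum_bounded.
- by apply: absum_corr => //; exact: absum_bounded.
- by move=> k; rewrite ler_pM.
Qed.

Lemma corr_ge0 (a b : nat -> R) p : absum b -> absum a ->
  (forall k, 0 <= b k) -> (forall k, 0 <= a k) -> 0 <= corr b a p.
Proof.
move=> ba aa b0 a0; apply: sm_ge0 => [|k]; last by rewrite mulr_ge0.
by apply: absum_corr => //; exact: absum_bounded.
Qed.

Lemma wh_step_ok x : wh_ok x -> wh_ok (wh_step x).
Proof.
case: x => a b [/= [a0 b0] az [aa ba] [a1 b1] [la lb]].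
have C1 p : 0 <= corr b a p by exact: corr_ge0.
have C2 p : 0 <= corr a b p by exact: corr_ge0.
have [ca1 _] := tl_corr 0 ba aa b0 a0; have [ca2 _] := tl_corr 0 aa ba a0 b0.
pose d p := if p == 0%N then 0 else corr b a p.
have d0 p : 0 <= d p by rewrite /d; case: ifP.
have da : absum d.
  by apply: (absumW _ ca1) => p; rewrite ger0_norm // /d; case: ifP.
have sd : sm d = tl (corr b a) 1.
  by rewrite (sm_recl da) {1}/d eqxx add0r; apply: eq_sm.
have aa' : absum (fun p => A p + d p) by exact: absumD.
have ba' : absum (fun k => B k + corr a b k) by exact: absumD.
have mass : sm (fun p => A p + d p) + sm (fun k => B k + corr a b k) <= 1 + sm a * sm b.
  rewrite !smD // sd; have := corr_mass aa ba a0 b0; have := AB1; lra.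
have sa0 : 0 <= sm a by exact: sm_ge0.
have sb0 : 0 <= sm b by exact: sm_ge0.
have ma : sm a <= sm (fun p => A p + d p) by apply: le_sm.
have mb : sm b <= sm (fun k => B k + corr a b k) by apply: le_sm.
split=> /=.
- by split=> p; [rewrite -[if _ then _ else _]/(d p) addr_ge0|rewrite addr_ge0].
- by rewrite A00 addr0.
- by [].
(* With [x, y] the old masses and [x', y'] the new ones, [x' + y' <= 1 + x y] and [y <= y'] give
   [x' <= 1 - y (1 - x) <= 1], and likewise for [y']. *)
- split; nra.
- have na p : 0 <= A p + d p by rewrite addr_ge0.
  have nb k : 0 <= B k + corr a b k by rewrite addr_ge0.
  split=> p; rewrite lerD2l; last exact: le_corr.
  by case: ifP => // _; apply: le_corr.
Qed.

Lemma wh_iter_ok n : wh_ok (wh_iter n).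
Proof.
elim: n => [|n IH]; last exact: wh_step_ok.
split=> //=; rewrite ?sm0 ?ler01 //; try (split; exact: absum0).
have c0 p : corr (fun=> 0) (fun=> 0) p = 0 :> R.
  by rewrite /corr -[RHS]sm0; apply: eq_sm => k; rewrite mul0r.
by split=> p; rewrite c0 ?if_same addr0.
Qed.

Let ai n := (wh_iter n).1.
Let bi n := (wh_iter n).2.

Lemma nondec_lim (u : nat -> R) M : (forall n, u n <= u n.+1) -> (forall n, u n <= M) ->
  [/\ u @ \oo --> limn u, forall n, u n <= limn u & limn u <= M].
Proof.
move=> un uM; have nd : {homo u : n m / (n <= m)%N >-> n <= m} by apply/nondecreasing_seqP.
have uc : cvgn u by apply: nondecreasing_is_cvgn => //; exists M => _ [n _ <-].
by split=> // [n|]; [exact: nondecreasing_cvgn_le|apply: limr_le => //; apply: nearW].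
Qed.

Lemma sum_lim_le (u : nat -> nat -> R) (l : nat -> R) N M :
  (forall i, u n i @[n --> \oo] --> l i) -> (forall n, \sum_(i < N) u n i <= M) ->
  \sum_(i < N) l i <= M.
Proof.
move=> ul uM; have H : (\sum_(i < N) u n i) @[n --> \oo] --> \sum_(i < N) l i.
  elim: N {uM} => [|N IH].
    by rewrite big_ord0; under eq_cvg do rewrite big_ord0; exact: cvg_cst.
  by rewrite big_ord_recr /=; under eq_cvg do rewrite big_ord_recr /=; exact: cvgD.
rewrite -(cvg_lim _ H) //; apply: limr_le; first exact: cvgP H.
exact: nearW.
Qed.

(** Iterating from zero, everything is nonnegative and increasing, and the masses stay at most 1;
    the coordinatewise limits solve the fixed-point equations. *)
Theorem wiener_hopf : exists a b : nat -> R,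
  [/\ (forall p, 0 <= a p) /\ (forall k, 0 <= b k), a 0%N = 0, absum a /\ absum b,
      sm a <= 1 /\ sm b <= 1 &
      (forall p, a p.+1 = A p.+1 + corr b a p.+1) /\ (forall k, b k = B k + corr a b k)].
Proof.
have le1 (u : nat -> R) p : absum u -> (forall i, 0 <= u i) -> sm u <= 1 -> u p <= 1.
  by move=> ua u0; apply: le_trans; exact: sm_term.
have al_ p : [/\ ai n p @[n --> \oo] --> limn (fun n => ai n p),
    forall n, ai n p <= limn (fun n => ai n p) & limn (fun n => ai n p) <= 1].
  apply: nondec_lim => n; first by have [_ _ _ _ [+ _]] := wh_iter_ok n; apply.
  by have [[? ?] _ [? ?] [? ?] _] := wh_iter_ok n; exact: le1.
have bl_ p : [/\ bi n p @[n --> \oo] --> limn (fun n => bi n p),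
    forall n, bi n p <= limn (fun n => bi n p) & limn (fun n => bi n p) <= 1].
  apply: nondec_lim => n; first by have [_ _ _ _ [_ +]] := wh_iter_ok n; apply.
  by have [[? ?] _ [? ?] [? ?] _] := wh_iter_ok n; exact: le1.
pose a p := limn (fun n => ai n p); pose b p := limn (fun n => bi n p).
have ac p : ai n p @[n --> \oo] --> a p by have [] := al_ p.
have bc p : bi n p @[n --> \oo] --> b p by have [] := bl_ p.
have aU n p : ai n p <= a p by have [_ + _] := al_ p; apply.
have bU n p : bi n p <= b p by have [_ + _] := bl_ p; apply.
have a0 p : 0 <= a p := aU 0%N p.
have b0 p : 0 <= b p := bU 0%N p.
have aS N : \sum_(i < N) a i <= 1.
  apply: (sum_lim_le ac) => n; have [[? ?] _ [? ?] [? ?] _] := wh_iter_ok n.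
  by apply: le_trans (sm_ge _ _ _) _; last eassumption.
have bS N : \sum_(i < N) b i <= 1.
  apply: (sum_lim_le bc) => n; have [[? ?] _ [? ?] [? ?] _] := wh_iter_ok n.
  by apply: le_trans (sm_ge _ _ _) _; last eassumption.
have aa : absum a by exact: absum_ge0 aS.
have ba : absum b by exact: absum_ge0 bS.
exists a, b; split=> //.
- apply/eqP; rewrite eq_le a0 andbT; have [_ _ +] := al_ 0%N => _.
  apply: (limr_le (cvgP _ (ac 0%N))); apply: nearW => n.
  by have [_ E _ _ _] := wh_iter_ok n; rewrite /ai E.
- by split; exact: sm_le.
(* Monotone convergence in [corr], stated once for both equations with the roles of [a] and [b]
   exchanged: one inequality by domination, the other from finite partial sums. *)
have key (u v : nat -> nat -> R) (l m w : nat -> R) C p :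
    (forall n, absum (u n) /\ absum (v n)) -> (forall n k, 0 <= u n k /\ 0 <= v n k) ->
    absum l -> absum m -> (forall n k, u n k <= l k /\ v n k <= m k) ->
    (forall k, u n k @[n --> \oo] --> l k) -> (forall k, v n k @[n --> \oo] --> m k) ->
    (forall n, w n.+1 = C + corr (u n) (v n) p) -> (forall n, w n <= limn w) ->
    w @ \oo --> limn w -> limn w = C + corr l m p.
  move=> uva uv0 la ma uvl uc vc wE wU wc; have l0 k : 0 <= l k.
    exact: le_trans (uv0 0%N k).1 (uvl 0%N k).1.
  have m0 k : 0 <= m k by exact: le_trans (uv0 0%N k).2 (uvl 0%N k).2.
  apply/eqP; rewrite eq_le; apply/andP; split.
    have wc' : w n.+1 @[n --> \oo] --> limn w by have := wc; rewrite -cvg_shiftS.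
    rewrite -{1}(cvg_lim _ wc') //; apply: (limr_le (cvgP _ wc')); apply: nearW => n.
    rewrite wE lerD2l; have [? ?] := uva n; apply: le_corr => // k.
    - exact: (uv0 n k).1.
    - exact: (uv0 n k).2.
    - exact: (uvl n k).1.
    - exact: (uvl n k).2.
  rewrite addrC -lerBrDr; apply: sm_le; first by apply: absum_corr => //; exact: absum_bounded.
  move=> N; apply: (@sum_lim_le (fun n k => u n k * v n (p + k)%N) (fun k => l k * m (p + k)%N)).
    by move=> k; exact: cvgM (uc k) (vc _).
  move=> n; rewrite lerBrDr addrC; apply: le_trans (wU n.+1); rewrite wE lerD2l.
  have [? ?] := uva n; apply: sm_ge; first by apply: absum_corr => //; exact: absum_bounded.
  by move=> k; have [? _] := uv0 n k; have [_ ?] := uv0 n (p + k)%N; rewrite mulr_ge0.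
have oka n : absum (ai n) /\ absum (bi n) by have [_ _ + _ _] := wh_iter_ok n.
have ok0 n k : 0 <= ai n k /\ 0 <= bi n k by have [[h1 h2] _ _ _ _] := wh_iter_ok n; split; [exact: h1|exact: h2].
split=> p.
- apply: (key bi ai b a (fun n => ai n p.+1)) => //; first by move=> n; have [] := oka n.
  by move=> n k; have [] := ok0 n k.
- by apply: (key ai bi a b (fun n => bi n p)).
Qed.

End WienerHopf.

(** * The one-sided operator of multiplication by [1 - b(1/z)] *)

Section Toeplitz.
Variable R : realType.
Implicit Types b u v f : nat -> R.

Definition conv u v p : R := \sum_(i < p.+1) u i * v (p - i)%N.
(* coefficient of z^p in (1 - b(1/z)) v(z) *)
Definition toep b v p : R := v p - corr b v p.

Definition vanishing v := forall e, 0 < e -> exists N, forall p, (N <= p)%N -> `|v p| <= e.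

Lemma absum_vanishing u : absum u -> vanishing u.
Proof.
move=> ua e e0; have [N H] := sm_tail ua e0; exists N => p Np.
apply: le_trans (H p Np); have := sm_term 0 (absum_norm (absum_tlE p ua)) (fun=> normr_ge0 _).
by rewrite addn0.
Qed.

Lemma vanishing_bounded v : vanishing v -> bounded_seq v.
Proof.
move=> /(_ 1 ltr01)[N H]; exists (1 + \sum_(i < N) `|v i|) => p.
have [Np|pN] := leqP N p; first by apply: le_trans (H p Np) _; rewrite lerDl sumr_ge0.
rewrite (bigD1 (Ordinal pN)) //= addrCA lerDl addr_ge0 ?ler01 // sumr_ge0 //.
Qed.

Lemma toep_vanishing b v : absum b -> (forall k, 0 <= b k) -> sm b <= 1 -> vanishing v ->
  vanishing (toep b v).
Proof.
move=> ba b0 b1 vv e e0; have [N H] := vv (e / 2) ltac:(lra); exists N => p Np.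
have vb := vanishing_bounded vv.
have ca := absum_corr p ba vb.
apply: le_trans (ler_normB _ _) _; rewrite [leRHS](splitr e) lerD ?H //.
apply: le_trans (sm_norm ca) _.
apply: le_trans (_ : _ <= sm (fun k => e / 2 * b k)) _.
  apply: le_sm; [exact: absum_norm|exact: absumZ|move=> k].
  by rewrite normrM ger0_norm // mulrC ler_wpM2r // H // (leq_trans Np) // leq_addr.
by rewrite smZ // ler_piMr //; lra.
Qed.

(** The equation reads [v_p = sum_k b_k v_(p+k)], so values further right control those to the left.
    A bound [e] valid far out is carried leftwards one index at a time, [b 0 < 1] allowing the
    diagonal term to be absorbed. *)
Lemma toep_inj b v m : absum b -> (forall k, 0 <= b k) -> sm b <= 1 -> b 0%N < 1 ->
  vanishing v -> (forall p, (m <= p)%N -> toep b v p = 0) ->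
  forall p, (m <= p)%N -> v p = 0.
Proof.
move=> ba b0 b1 b01 vv T p mp; apply/eqP; rewrite -normr_le0.
apply/ler_addgt0Pl => e e0; rewrite addr0; have [N H] := vv e e0.
suff K d : forall j, (m <= j)%N -> (N <= j + d)%N -> `|v j| <= e by apply: (K N) => //; rewrite leq_addl.
elim: d => [|d IH] j mj Nj; first by apply: H; rewrite addn0 in Nj.
have big k : `|v (j + k.+1)%N| <= e by apply: IH; lia.
have vb := vanishing_bounded vv; have ca := absum_corr j ba vb.
have : v j = corr b v j by apply/eqP; rewrite -subr_eq0 -/(toep b v j) T.
rewrite /corr (sm_recl ca) addn0; set X := sm _ => E.
have ba' : absum (fun k => b k.+1) := (absum_shift 1 b).1 ba.
have ca' : absum (fun k => b k.+1 * v (j + k.+1)%N) := (absum_shift 1 _).1 ca.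
have XB : `|X| <= e * (sm b - b 0%N).
  apply: le_trans (sm_norm ca') _.
  rewrite (sm_recl ba) addrC addKr -smZ //; apply: le_sm; [exact: absum_norm|exact: absumZ|move=> k].
  by rewrite normrM ger0_norm // mulrC ler_wpM2r.
have := ler_normD (b 0%N * v j) X; rewrite -E normrM ger0_norm // => h.
have : `|v j| * (1 - b 0%N) <= e * (1 - b 0%N) by nra.
by rewrite ler_pM2r // subr_gt0.
Qed.

(** Truncation to nonnegative degrees is not multiplicative: the coefficients of [b(1/z) f(z)] in
    degree [-(j+1)], which [toep b f] discards, meet [v_(p+j+1)]. The double sum is this
    correction. *)
Lemma toep_conv b f v p : absum b -> absum f -> absum v ->
  toep b (conv f v) p = conv (toep b f) v p
    - sm (fun j => sm (fun i => b (i + j.+1)%N * f i) * v (p + j.+1)%N).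
Proof.
move=> ba fa va; have fb := absum_bounded fa; have vb := absum_bounded va.
pose g k m := if (m < k)%N then b k * f (k - m.+1)%N * v (p + m.+1)%N else 0.
have gfin k m : (k <= m)%N -> g k m = 0 by move=> km; rewrite /g ltnNge km.
have ga k : absum (g k) by exact: absum_finsupp (gfin k).
have [Mf fM] := fb.
have Mf0 : 0 <= Mf by apply: le_trans (fM 0%N).
have va1 : absum (fun m => v (p + m.+1)%N).
  by apply: eq_absum (absum_tlE (p + 1) va) => m; rewrite -addnA.
pose V := sm (fun m => `|v (p + m.+1)%N|).
have gsa : absum (fun k => sm (fun m => `|g k m|)).
  apply: (absumW _ (absumZ (Mf * V) (absum_norm ba))) => k.
  rewrite ger0_norm; last by apply: sm_ge0 => //; exact: absum_norm.
  rewrite mulrAC -smZ; last exact: absum_norm.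
  apply: le_sm; [exact: absum_norm|by apply: absumZ; exact: absum_norm|move=> m].
  rewrite /g; case: ifP => _; last by rewrite normr0 !mulr_ge0.
  by rewrite !normrM ler_wpM2r // mulrC ler_wpM2r.
have [ca cs E] := fubini ga gsa.
have gE k : sm (g k) = b k * \sum_(i < k) f i * v (p + k - i)%N.
  rewrite (sm_finsupp (gfin k)) mulr_sumr (reindex_inj rev_ord_inj) /=.
  apply: eq_bigr => i _; rewrite /g ltn_subrL; have ik := ltn_ord i.
  case: ifP => [_|/negbT]; last by rewrite negb_and; lia.
  by rewrite mulrA; congr (b _ * f _ * v _); lia.
have gcE m : sm (fun k => g k m) = sm (fun i => b (i + m.+1)%N * f i) * v (p + m.+1)%N.
  rewrite (sm_shift m.+1 (ca m)) big1 ?add0r => [|k _]; last by rewrite gfin // -ltnS.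
  rewrite mulrC -smZ; last first.
    apply: absum_mul_bounded => //; apply: eq_absum (absum_tlE m.+1 ba) => i; by rewrite addnC.
  by apply: eq_sm => i; rewrite /g ltnS leq_addr addKn addnC mulrC.
rewrite /toep /corr.
have split_conv k : b k * conv f v (p + k)%N =
    \sum_(i < p.+1) v i * (b k * f ((p - i) + k)%N) + sm (g k).
  rewrite gE /conv -addnS -[(p + k.+1)%N]addSnnS addnC big_split_ord /= mulrDr addrC; congr (_ + _).
  rewrite mulr_sumr (reindex_inj rev_ord_inj) /=; apply: eq_bigr => i _.
  rewrite [RHS]mulrC -mulrA; congr (_ * (f _ * v _)); have := ltn_ord i; lia.
rewrite (eq_sm split_conv) smD; last first.
- by apply: (absumW _ gsa) => k; exact: sm_norm.
- apply: (@absum_fin _ (fun i k => v i * (b k * f ((p - i) + k)%N))) => i _.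
  by apply: absumZ; exact: absum_corr.
rewrite E (eq_sm gcE) opprD addrA; congr (_ - _).
rewrite (@sm_fin _ (fun i k => v i * (b k * f ((p - i) + k)%N))); last first.
  by move=> i _; apply: absumZ; exact: absum_corr.
rewrite /conv [RHS](reindex_inj rev_ord_inj) /= [X in X - _](reindex_inj rev_ord_inj) /= -sumrB.
apply: eq_bigr => i _; rewrite subSS subKn ?leq_ord // smZ; last exact: absum_corr.
by rewrite mulrBl [corr _ _ _ * _]mulrC.
Qed.

Lemma toep_shift_comb b c v p : absum b -> absum c -> absum v ->
  absum (fun p => sm (fun j => c j * v (p + j.+1)%N)) /\
  toep b (fun p => sm (fun j => c j * v (p + j.+1)%N)) p =
  sm (fun j => c j * toep b v (p + j.+1)%N).
Proof.
move=> ba ca va; have vb := absum_bounded va.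
have sh n : absum (fun j => c j * v (n + j.+1)%N).
  by apply: absum_mul_bounded => //; case: vb => M vM; exists M.
have aS : absum (fun p => sm (fun j => c j * v (p + j.+1)%N)).
  have va' j : absum (fun p => `|v (p + j.+1)%N|).
    by apply: absum_norm; apply: eq_absum (absum_tlE j.+1 va) => n; rewrite addnC.
  pose f j n := `|c j| * `|v (n + j.+1)%N|.
  have f0 j n : 0 <= f j n by rewrite mulr_ge0.
  have fa j : absum (f j) by exact: absumZ.
  have fs : absum (fun j => sm (f j)).
    apply: (absumW _ (absumZ (sm (fun n => `|v n|)) (absum_norm ca))) => j.
    rewrite ger0_norm; last exact: sm_ge0.
    rewrite /f smZ // mulrC ler_wpM2r //.
    rewrite (eq_sm (v := fun n => `|v (j.+1 + n)%N|)); last by move=> n; rewrite addnC.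
    by apply: (@tl_le _ (fun n => `|v n|)) => //; exact: absum_norm.
  have [_ cs _] := fubini_nneg f0 fa fs.
  apply: (absumW _ cs) => n; apply: le_trans (sm_norm (sh n)) _.
  by rewrite le_eqVlt; apply/orP; left; apply/eqP/eq_sm => j; rewrite normrM.
split=> //; rewrite /toep.
have [Mv vM] := vb.
pose g k j := b k * (c j * v (p + k + j.+1)%N).
have ga k : absum (g k) by apply: absumZ.
have gs : absum (fun k => sm (fun j => `|g k j|)).
  apply: (absumW _ (absumZ (Mv * sm (fun j => `|c j|)) (absum_norm ba))) => k.
  rewrite ger0_norm; last by apply: sm_ge0 => //; exact: absum_norm.
  rewrite mulrAC -smZ; last exact: absum_norm.
  apply: le_sm; [exact: absum_norm|by apply: absumZ; exact: absum_norm|move=> j].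
  rewrite /g !normrM mulrA mulrC -mulrA ler_wpM2r // ?mulr_ge0 //.
have [gcol gcs E] := fubini ga gs.
have gE k : sm (g k) = b k * sm (fun j => c j * v (p + k + j.+1)%N) by rewrite /g smZ.
have gcE j : sm (fun k => g k j) = c j * corr b v (p + j.+1).
  rewrite /corr -smZ; last exact: absum_corr.
  by apply: eq_sm => k; rewrite /g mulrCA addnAC.
rewrite /corr -(eq_sm gE) E (eq_sm gcE) -smB //.
  by apply: eq_sm => j; rewrite -mulrBr.
by apply: (absumW _ gcs) => j; rewrite -gcE; apply: sm_norm; exact: gcol.
Qed.

End Toeplitz.

(** * Identification of the positive factor with [1 - sqrt (1 - z)] *)

Section Factor.
Variables (R : realType) (A B : nat -> R).
Hypotheses (A00 : A 0 = 0) (Apos : forall p, 0 < A p.+1) (B0 : forall k, 0 <= B k).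
Hypothesis tutteA : forall p, (1 < p)%N -> absum (fun k => B k * A (p + k)%N) /\
  2 * A p = conv A A p + 2 * corr B A p.
Hypothesis ratioA : A n.+2 / A n.+1 @[n --> \oo] --> (1 : R).

Let A0 p : 0 <= A p.
Proof. by case: p => [|p]; rewrite ?A00 // ltW. Qed.

Lemma ratio_shift i j : A (n + i.+1)%N / A (n + j.+1)%N @[n --> \oo] --> (1 : R).
Proof.
have H k : A (n + k.+1)%N / A n.+1 @[n --> \oo] --> (1 : R).
  elim: k => [|k IH].
    under eq_cvg => n do rewrite addn1 divff ?gt_eqF //; exact: cvg_cst.
  have r : A (n + k).+2 / A (n + k).+1 @[n --> \oo] --> (1 : R).
    by have := ratioA; rewrite -(cvg_shiftn k).
  rewrite -[X in _ --> X]mulr1; apply: (cvgn_eq _ (cvgM r IH)) => n /=.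
  by rewrite !addnS; field; rewrite !gt_eqF.
have E1 : (1 : R) = 1 * 1^-1 by rewrite invr1 mulr1.
rewrite [X in _ --> X]E1.
by apply: (cvgn_eq _ (cvgM (H i) (cvgV (oner_neq0 _) (H j)))) => n /=; rewrite !addnS; field; rewrite !gt_eqF.
Qed.

(** Divide Tutte's equation at [p] by [A p] and keep finitely many terms: both ends of the
    convolution contribute the sum of [A], the shifts twice the sum of [B], and all ratios tend to
    1. *)
Lemma mass_le1 N : \sum_(i < N) A i + \sum_(k < N) B k <= 1.
Proof.
pose r n := \sum_(i < N) A i * (A (n + (N - i).+1)%N / A (n + N.+1)%N) +
            \sum_(k < N) B k * (A (n + (N + k).+1)%N / A (n + N.+1)%N).
have rc : r n @[n --> \oo] --> (\sum_(i < N) A i + \sum_(k < N) B k : R).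
  have S (u : nat -> R) (v : nat -> nat -> R) M : (forall i, v i n @[n --> \oo] --> (1 : R)) ->
      \sum_(i < M) u i * v i n @[n --> \oo] --> (\sum_(i < M) u i : R).
    move=> vc; elim: M => [|M IH]; first by rewrite big_ord0; under eq_cvg do rewrite big_ord0; exact: cvg_cst.
    rewrite big_ord_recr /=; under eq_cvg do rewrite big_ord_recr /=.
    by apply: cvgD => //; rewrite -[X in _ --> X]mulr1; apply: cvgMr.
  apply: cvgD.
  - by apply: (S A (fun i n => A (n + (N - i).+1)%N / A (n + N.+1)%N)) => i; exact: ratio_shift.
  - by apply: (S B (fun i n => A (n + (N + i).+1)%N / A (n + N.+1)%N)) => i; exact: ratio_shift.
rewrite -(cvg_lim _ rc) //; apply: (limr_le (cvgP _ rc)).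
exists N.+1 => // n /= Nn; set p := (n + N.+1)%N.
(* Beyond [2N] the two ends of the convolution do not overlap. *)
have pN : (N.*2 < p)%N by rewrite /p; lia.
have p1 : (1 < p)%N by rewrite /p; lia.
have [ca E] := tutteA p1.
have Ap : 0 < A p by rewrite /p addnS.
rewrite -(ler_pM2r Ap) mul1r /r mulrDl !mulr_suml.
have -> : \sum_(i < N) A i * (A (n + (N - i).+1)%N / A p) * A p = \sum_(i < N) A i * A (p - i)%N.
  apply: eq_bigr => i _; rewrite -!mulrA mulVf ?gt_eqF // mulr1; congr (_ * A _).
  by rewrite /p; have := ltn_ord i; lia.
have -> : \sum_(i < N) B i * (A (n + (N + i).+1)%N / A p) * A p = \sum_(i < N) B i * A (p + i)%N.
  apply: eq_bigr => i _; rewrite -!mulrA mulVf ?gt_eqF // mulr1; congr (_ * A _).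
  by rewrite /p; lia.
have B1 : \sum_(i < N) B i * A (p + i)%N <= corr B A p.
  by apply: sm_ge => // i; rewrite mulr_ge0.
have A1 : 2 * \sum_(i < N) A i * A (p - i)%N <= conv A A p.
  have -> : conv A A p = \sum_(i < N) A i * A (p - i)%N +
      (\sum_(i < (p.+1 - N.*2)%N) A (N + i)%N * A (p - (N + i))%N + \sum_(i < N) A i * A (p - i)%N).
    have [m mE] : exists m, m = (p.+1 - N.*2)%N by exists (p.+1 - N.*2)%N.
    have pE : p.+1 = (N + (m + N))%N by lia.
    rewrite /conv -mE pE !big_split_ord /=; congr (_ + (_ + _)).
    rewrite (reindex_inj rev_ord_inj) /=; apply: eq_bigr => i _; rewrite mulrC.
    by have := ltn_ord i => iN; congr (A _ * A _); lia.
  by rewrite mulr_natl mulr2n lerD2l lerDr sumr_ge0 // => i _; rewrite mulr_ge0.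
lra.
Qed.

(** With [f = 1 - a], applying [toep b] twice to the square of [f] gives the part of [K(z)^2] in
    degrees at least 2, which is zero. By [toep_inj], used twice, the square of [f] is a polynomial
    of degree at most 1. *)
Theorem sqrt_factor : exists b : nat -> R,
  [/\ forall k, 0 <= b k, absum b, sm b <= 1,
      forall p, A p.+1 = al R p.+1 - corr b (al R) p.+1 &
      forall k, b k = B k + corr (al R) b k].
Proof.
have Aa : absum A.
  apply: (absum_ge0 (M := 1)) => // n; apply: le_trans (mass_le1 n).
  by rewrite lerDl sumr_ge0.
have Ba : absum B.
  apply: (absum_ge0 (M := 1)) => // n; apply: le_trans (mass_le1 n).
  by rewrite lerDr sumr_ge0.
have AB1 : sm A + sm B <= 1.
  rewrite -smD //; apply: sm_le; first exact: absumD.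
  by move=> n; rewrite big_split; exact: mass_le1.
have [a [b [[a0 b0] a00 [aa ba] [a1 b1] [aE bE]]]] := wiener_hopf A00 A0 B0 Aa Ba AB1.
(* If [b 0 = 1], the mass bound leaves no other term, and the equation for [a 1] becomes
   [a 1 = A 1 + a 1]. *)
have b01 : b 0%N < 1.
  rewrite lt_neqAle (le_trans (sm_term 0 ba b0) b1) andbT; apply/eqP => b01.
  have bz k : b k.+1 = 0.
    apply/eqP; rewrite eq_le b0 andbT.
    have := b1; rewrite (sm_recl ba) b01 gerDl; apply: le_trans.
    exact: (sm_term k ((absum_shift 1 b).1 ba) (fun k => b0 k.+1)).
  have := aE 0%N; rewrite /corr (sm_finsupp (n := 1)) => [|[|k] // _]; last by rewrite bz mul0r.
  rewrite big_ord1 b01 mul1r addn0 => /eqP; rewrite eq_sym addrC -subr_eq0 addrAC subrr add0r.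
  by rewrite gt_eqF.
pose f p : R := (p == 0)%:R - a p.
have fa : absum f.
  by apply: absumB => //; apply: (@absum_finsupp _ _ 1) => -[|k].
have sf (u : nat -> R) : absum u -> sm (fun i => u i * f i) = u 0%N - sm (fun i => u i * a i).
  move=> ua; have uaa : absum (fun i => u i * a i) by apply: absum_mul_bounded => //; exact: absum_bounded.
  have ud : absum (fun i => u i * (i == 0)%:R) by apply: (@absum_finsupp _ _ 1) => -[|k] // _; rewrite mulr0.
  rewrite -[X in X - _](_ : sm (fun i => u i * (i == 0)%:R) = _); last first.
    by rewrite (sm_finsupp (n := 1)) => [|[|k] // _]; rewrite ?mulr0 // big_ord1 mulr1.
  by rewrite -smB //; apply: eq_sm => i; rewrite -mulrBr.
have gf p : toep b f p.+1 = - A p.+1.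
  rewrite /toep {1}/f sub0r aE opprD; rewrite -[RHS]addr0 -addrA; congr (_ + _).
  apply/eqP; rewrite subr_eq0 /corr -smN; last by apply: absum_corr => //; exact: absum_bounded.
  by apply/eqP/eq_sm => k; rewrite /f addSn sub0r mulrN.
have bS j : absum (fun i => b (i + j)%N).
  by apply: eq_absum (absum_tlE j ba) => i; rewrite addnC.
(* These are the coefficients of [b(1/z) f(z)] in degree [-j]; the fixed-point equation for [b]
   identifies them with [B]. *)
have cE j : sm (fun i => b (i + j)%N * f i) = B j.
  rewrite sf // add0n (bE j) -[RHS]addr0 -addrA; congr (_ + _).
  apply/eqP; rewrite subr_eq0; apply/eqP/eq_sm => i; by rewrite mulrC addnC.
have gf0 : toep b f 0 = 1 - B 0%N.
  rewrite /toep {1}/f a00 subr0; congr (_ - _); rewrite /corr -(cE 0%N).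
  by apply: eq_sm => i; rewrite add0n addn0.
pose g := toep b f.
have ga : absum g.
  rewrite (absum_shift 1); apply: eq_absum (absumN ((absum_shift 1 A).1 Aa)) => p.
  by rewrite add1n -gf.
pose F := conv f f.
have Fa : absum F := (absumM fa fa).1.
pose c j := B j.+1.
have cab : absum c := (absum_shift 1 B).1 Ba.
have GF : toep b F = fun p => conv g f p - sm (fun j => c j * f (p + j.+1)%N).
  apply/funext => p; rewrite toep_conv //; congr (_ - _); apply: eq_sm => j.
  by rewrite cE.
have convC u v p : conv u v p = conv v u p :> R.
  rewrite /conv (reindex_inj rev_ord_inj) /=; apply: eq_bigr => i _.
  by rewrite subSS subKn ?leq_ord // mulrC.
have toepB u v p : absum u -> absum v -> toep b (fun p => u p - v p) p = toep b u p - toep b v p.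
  move=> ua va; rewrite /toep /corr.
  have -> : sm (fun k => b k * (u (p + k)%N - v (p + k)%N)) =
      sm (fun k => b k * u (p + k)%N) - sm (fun k => b k * v (p + k)%N).
    rewrite -smB; [|by apply: absum_corr => //; exact: absum_bounded..].
    by apply: eq_sm => k; rewrite mulrBr.
  ring.
(* Each application of [toep b] leaves a boundary term equal to the sum of [B_j A_(q+j)] over
   [j >= 1]. Together with [conv g g] they rebuild Tutte's equation. *)
have GGF p : (1 < p)%N -> toep b (toep b F) p = 0.
  case: p => [|[|p]] // _; set q := p.+2.
  have [sca scE] := toep_shift_comb q ba cab fa.
  have cga : absum (conv g f) := (absumM ga fa).1.
  rewrite GF toepB // scE -/g.
  have -> : toep b (conv g f) q = toep b (conv f g) q.
    by congr (toep b _ q); apply/funext => n; exact: convC.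
  rewrite toep_conv // -/g.
  have -> : sm (fun j => sm (fun i => b (i + j.+1)%N * f i) * g (q + j.+1)%N) = - sm (fun j => c j * A (q + j.+1)%N).
    rewrite -smN; last by apply: absum_mul_bounded => //; case: (absum_bounded Aa) => M AM; exists M.
    by apply: eq_sm => j; rewrite cE /g addSn gf mulrN -addSn.
  have -> : sm (fun j => c j * toep b f (q + j.+1)%N) = - sm (fun j => c j * A (q + j.+1)%N).
    rewrite -smN; last by apply: absum_mul_bounded => //; case: (absum_bounded Aa) => M AM; exists M.
    by apply: eq_sm => j; rewrite addSn gf mulrN -addSn.
  have [ta tE] := tutteA (isT : (1 < q)%N).
  rewrite /corr (sm_recl ta) addn0 -/(c _) in tE.
  have -> : conv g g q = conv A A q - 2 * (1 - B 0%N) * A q.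
    have S (u : nat -> R) : conv u u p.+2 =
        2 * (u 0%N * u p.+2) + \sum_(i < p.+1) u i.+1 * u (p.+1 - i)%N.
      rewrite /conv big_ord_recl big_ord_recr /= /bump /= !add1n subnn subn0.
      rewrite (eq_bigr (fun i : 'I_p.+1 => u i.+1 * u (p.+1 - i)%N)) => [|i _]; last first.
        by rewrite add1n subSS.
      ring.
    rewrite /q !S A00 {1}/g gf0 {1}/g gf.
    rewrite (eq_bigr (fun i : 'I_p.+1 => A i.+1 * A (p.+1 - i)%N)) => [|i _]; first by ring.
    by rewrite /g subSn ?leq_ord // !gf mulrNN.
  by move: tE; rewrite /c; lra.
have Fv : vanishing F by exact: absum_vanishing.
have F0 p : (1 < p)%N -> F p = 0.
  move: p; apply: (toep_inj ba b0 b1 b01 Fv).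
  exact: (toep_inj ba b0 b1 b01 (toep_vanishing ba b0 b1 Fv) GGF).
pose x := 2 * a 1%N.
have a1gt : 0 < a 1%N.
  by rewrite aE; apply: ltr_pwDl => //; exact: corr_ge0.
have x0 : 0 < x by rewrite mulr_gt0.
have arec p : 2 * a p.+2 = \sum_(i < p.+1) a i.+1 * a (p.+1 - i)%N.
  have := F0 p.+2 isT; rewrite /F /conv big_ord_recl big_ord_recr /= /bump /= !add1n subnn subn0.
  rewrite (eq_bigr (fun i : 'I_p.+1 => a i.+1 * a (p.+1 - i)%N)) => [|i _].
    by rewrite /f a00 /=; lra.
  rewrite /f !add1n subSS /= sub0r; have -> : (p.+1 - i == 0)%N = false.
    by apply/negbTE; rewrite subn_eq0 -ltnNge.
  by rewrite sub0r mulrNN.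
have alrec p : 2 * al R p.+2 = \sum_(i < p.+1) al R i.+1 * al R (p.+1 - i)%N.
  rewrite -al_conv // big_ord_recl big_ord_recr /= /bump /= !add1n subnn mul0r mulr0 add0r addr0.
  by apply: eq_bigr => i _; rewrite add1n subSS.
(* [a] and [al] satisfy the same quadratic recursion, which determines a sequence from its term of
   index 1. *)
have aX p : a p = x ^+ p * al R p.
  have [n] := ubnP p; elim: n p => // n IH [|[|p]] pn; first by rewrite a00 mulr0.
    by rewrite al1 expr1 /x mulrAC divff ?pnatr_eq0 // mul1r.
  apply: (@mulfI _ 2); first by rewrite pnatr_eq0.
  rewrite arec mulrCA alrec mulr_sumr; apply: eq_bigr => i _.
  have iP := ltn_ord i; rewrite !IH; [|lia..].
  rewrite mulrACA -exprD; congr (x ^+ _ * _); lia.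
(* For [x > 1] the first [N.+1] terms of [a] sum to at least [x (1 - hb N)], and
   [hb N <= (x - 1) / (2 x)] makes this at least [(1 + x) / 2 > 1]. *)
have x_le1 : x <= 1.
  rewrite leNgt; apply/negP => x1.
  have e0 : 0 < (x - 1) / (2 * x) by rewrite divr_gt0 ?subr_gt0 // mulr_gt0.
  have [N HN] := hb_cvg0 e0.
  have := sm_ge N.+1 aa a0; apply/negP; rewrite -ltNge; apply: (le_lt_trans a1).
  have h1 : x * (1 - hb R N) <= \sum_(i < N.+1) a i.
    rewrite -al_sum mulr_sumr; apply: ler_sum => i _; rewrite aX.
    case: (nat_of_ord i) => [|k]; first by rewrite !mulr0.
    by rewrite ler_wpM2r ?al_ge0 // exprS ler_peMr ?(ltW x0) // exprn_ege1 // ltW.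
  apply: lt_le_trans h1; have := HN N (leqnn _); rewrite ler_pdivlMr; last by rewrite mulr_gt0.
  have := hb_ge0 R N; nra.
(* For [x < 1] the bound [A <= a] makes [A] decay at least like powers of [x], whereas the ratio
   limit keeps it above a constant times powers of [y], with [x < y < 1]. *)
have x_ge1 : 1 <= x.
  rewrite leNgt; apply/negP => x1; pose y := (1 + x) / 2.
  have y1 : y < 1 by rewrite /y; lra.
  have xy : x < y by rewrite /y; lra.
  have y0 : 0 < y by lra.
  have [N _ HN] : \forall n \near \oo, y < A n.+2 / A n.+1.
    exact: (cvgr_gt _ ratioA).
  have Ay k : y ^+ k * A N.+1 <= A (N + k).+1.
    elim: k => [|k IH]; first by rewrite expr0 mul1r addn0.
    rewrite exprS addnS -mulrA; apply: le_trans (_ : y * A (N + k).+1 <= _); first by rewrite ler_wpM2l // ltW.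
    have := HN (N + k)%N (leq_addr _ _); rewrite /= ltr_pdivlMr // => h; exact: ltW.
  have Ax k : A (N + k).+1 <= x ^+ k.
    apply: le_trans (_ : a (N + k).+1 <= _).
      by rewrite aE lerDl corr_ge0.
    rewrite aX; apply: le_trans (_ : x ^+ (N + k).+1 * 1 <= _).
      by rewrite ler_wpM2l ?al_le1 // exprn_ge0 // ltW.
    by rewrite mulr1 -addSn addnC exprD ler_piMr ?exprn_ge0 ?exprn_ile1 ?(ltW x0) // ltW.
  have z1 : `|x / y| < 1.
    rewrite ger0_norm; last by rewrite divr_ge0 // ltW.
    by rewrite ltr_pdivrMr // mul1r.
  have [M _ HM] : \forall n \near \oo, (x / y) ^+ n < A N.+1.
    exact: (cvgr_lt _ (cvg_expr z1)).
  have := HM M (leqnn M); rewrite /= expr_div_n ltr_pdivrMr ?exprn_gt0 // mulrC.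
  by apply/negP; rewrite -leNgt; apply: le_trans (Ay M) (Ax M).
have xE : x = 1 by apply/eqP; rewrite eq_le x_le1.
have aal : a = al R by apply/funext => p; rewrite aX xE expr1n mul1r.
rewrite aal in aE bE.
exists b; split=> // p; by rewrite aE addrK.
Qed.

End Factor.

Arguments al : simpl never.

(** * Superharmonicity of the tail *)

Section Kernel.
Variable R : realType.
Local Notation hb := (hb R).
Local Notation al := (al R).

Lemma alB n : al n.+1 = hb n - hb n.+1. Proof. by []. Qed.

Lemma al0 : al 0 = 0. Proof. by []. Qed.

Definition kap (m : nat) : R := sm (fun n => hb n * al (n + m)%N).

Lemma absum_kap m : absum (fun n => hb n * al (n + m)%N).
Proof.
apply: (absumW _ (absum_tlE m (absum_al R))) => n.
by rewrite ger0_norm ?mulr_ge0 ?hb_ge0 ?al_ge0 // addnC ler_piMl ?al_ge0 ?hb_le1.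
Qed.

Lemma al_ratio p : (p.+2)%:R * al p.+2 = (p.+1%:R - 2^-1) * al p.+1.
Proof.
rewrite !alE hbS -[p.+2%:R]natr1 -[p.+1%:R]natr1; have := ler0n R p => p0.
field; lra.
Qed.

Lemma tl_al p : tl al p.+1 = hb p.
Proof.
have E n : \sum_(i < n) al (p.+1 + i)%N = hb p - hb (p + n).
  elim: n => [|n IH]; first by rewrite big_ord0 addn0 subrr.
  by rewrite big_ord_recr /= IH addSn alB addnS addrA subrK.
apply: sm_unique.
suff H : hb p - hb (p + n) @[n --> \oo] --> hb p - 0.
  by rewrite subr0 in H; apply: cvgn_eq H => n; rewrite E.
apply: cvgB; first exact: cvg_cst.
apply/cvgrPdist_le => e e0; have [N HN] := hb_cvg0 e0.
exists N => // n /= Nn; rewrite sub0r normrN ger0_norm ?hb_ge0 //.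
by apply: HN; rewrite (leq_trans Nn) // leq_addl.
Qed.

(** The difference of the two sides telescopes, with partial sums [- N hb_N al_(N+m+1)] tending to
    0. It gives the closed form [kapE]. *)
Lemma kap_rec m : (m.+1%:R + 2^-1) * kap m.+2 = (m.+1%:R - 2^-1) * kap m.+1.
Proof.
apply/eqP; rewrite -subr_eq0 /kap -!smZ; [|exact: absum_kap..].
rewrite -smB; [|by apply: absumZ; exact: absum_kap..].
apply/eqP; apply: sm_unique.
have E N : \sum_(n < N) ((m.+1%:R + 2^-1) * (hb n * al (n + m.+2)) -
    (m.+1%:R - 2^-1) * (hb n * al (n + m.+1))) = - (N%:R * hb N * al (N + m.+1)).
  elim: N => [|N IH]; first by rewrite big_ord0 !mul0r oppr0.
  rewrite big_ord_recr /= IH hb_recE; have := al_ratio (N + m).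
  rewrite -[(N + m).+2%:R]natr1 -[(N + m).+1%:R]natr1 natrD -!addnS -[m.+1%:R]natr1.
  rewrite addSn -!addnS.
  set x := al _; set y := al _; set z := hb N => rt.
  have [nz mz] : 0 <= N%:R :> R /\ 0 <= m%:R :> R by split; exact: ler0n.
  have xE : x = (N%:R + m%:R + 1 - 2^-1) / (N%:R + m%:R + 1 + 1) * y.
    by apply: (mulfI (_ : N%:R + m%:R + 1 + 1 != 0)); [lra|rewrite rt; field; lra].
  rewrite xE; field; lra.
suff H : - (N%:R * hb N * al (N + m.+1)) @[N --> \oo] --> (- 0 : R).
  by rewrite oppr0 in H; apply: cvgn_eq H => N; rewrite E.
apply: cvgN; apply/cvgrPdist_le => e e0; have [N HN] := hb_cvg0 e0.
exists N => // n /= Nn; rewrite sub0r normrN ger0_norm ?mulr_ge0 ?hb_ge0 ?al_ge0 //.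
apply: le_trans (HN n Nn); rewrite addnS alE -mulrA mulrC -mulrA ler_piMr ?hb_ge0 //.
have h1 := hb_le1 R (n + m); have h0 := hb_ge0 R (n + m).
rewrite mulrAC ler_pdivrMr; last by have := ler0n R (n + m); lra.
have : n%:R <= (n + m)%:R :> R by rewrite ler_nat leq_addr.
have := ler0n R n; nra.
Qed.

Definition kap0 : R := kap 1 / 2.

Lemma kap_gt0 m : 0 < kap m.+1.
Proof.
apply: lt_le_trans (sm_term 0 (absum_kap m.+1) _); last by move=> i; rewrite mulr_ge0 ?hb_ge0 ?al_ge0.
by rewrite hb0 mul1r al_gt0.
Qed.

Lemma kap0_gt0 : 0 < kap0. Proof. by rewrite divr_gt0 ?kap_gt0. Qed.

Lemma kapE m : kap m.+1 = kap0 / (m%:R + 2^-1).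
Proof.
have H : kap m.+1 * (m%:R + 2^-1) = kap0.
  elim: m => [|m IH]; first by rewrite add0r /kap0.
  rewrite -IH mulrC kap_rec mulrC; congr (_ * _); rewrite -[m.+1%:R]natr1; lra.
by rewrite -H mulfK //; have := ler0n R m; lra.
Qed.

(** Expand [kap] and group by the total index: [hb] convolved with itself is constantly 1, so the
    double sum collapses to the tail of [al] from [k.+1], which is [hb k]. *)
Lemma kap_hb k : absum (fun j => kap (k + j).+1 * hb j) /\ sm (fun j => kap (k + j).+1 * hb j) = hb k.
Proof.
pose f j m := if (j <= m)%N then hb j * hb (m - j)%N * al (k.+1 + m)%N else 0.
have f0 j m : 0 <= f j m by rewrite /f; case: ifP => // _; rewrite !mulr_ge0 ?hb_ge0 ?al_ge0.
have alk := absum_tlE k.+1 (absum_al R).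
have fa j : absum (f j).
  apply: (absumW _ alk) => m; rewrite ger0_norm // /f; case: ifP => _; last exact: al_ge0.
  by rewrite ler_piMl ?al_ge0 // mulr_ile1 ?hb_ge0 ?hb_le1.
have fE j : sm (f j) = kap (k + j).+1 * hb j.
  rewrite (sm_shift j (fa j)) big1 ?add0r => [|i _]; last by rewrite /f leqNgt ltn_ord.
  rewrite mulrC -smZ; last exact: absum_kap.
  by apply: eq_sm => n; rewrite /f leq_addr addKn -mulrA; congr (_ * (_ * al _)); lia.
have cE m : sm (fun j => f j m) = al (k.+1 + m)%N.
  rewrite (@sm_finsupp _ _ m.+1) => [|i mi]; last by rewrite /f leqNgt mi.
  rewrite -[RHS]mul1r -(hb_conv R m) mulr_suml; apply: eq_bigr => i _.
  by rewrite /f -ltnS ltn_ord.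
(* swap the roles: columns are summable with summable sums *)
have ca m : absum (fun j => f j m) by apply: (@absum_finsupp _ _ m.+1) => i mi; rewrite /f leqNgt mi.
have cs : absum (fun m => sm (fun j => f j m)) by apply: eq_absum alk => m; rewrite cE.
have [_ rs _] := @fubini_nneg _ (fun m j => f j m) (fun m j => f0 j m) ca cs.
have E := @fubini_nneg_eq _ (fun m j => f j m) (fun m j => f0 j m) ca cs.
split; first by apply: eq_absum rs => j; rewrite fE.
by rewrite -(eq_sm fE) -E (eq_sm cE); exact: tl_al.
Qed.

Definition dd m : R := al m.+1 - al m.+2.

Lemma ddE m : dd m = al m.+1 * (3 / 2) / (m%:R + 2).
Proof.
have := al_ratio m; rewrite /dd -[m.+2%:R]natr1 -[m.+1%:R]natr1; have := ler0n R m => m0 E.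
have -> : al m.+2 = (m%:R + 1 - 2^-1) / (m%:R + 1 + 1) * al m.+1.
  by apply: (mulfI (_ : m%:R + 1 + 1 != 0)); [lra|rewrite E; field; lra].
field; lra.
Qed.

Lemma dd_gt0 m : 0 < dd m.
Proof. by rewrite ddE divr_gt0 ?mulr_gt0 ?al_gt0 //; have := ler0n R m; lra. Qed.

Lemma dd_leS m : dd m.+1 <= dd m.
Proof.
have := ler0n R m => m0; rewrite !ddE -[m.+1%:R]natr1.
rewrite ler_pM ?mulr_ge0 ?invr_ge0 ?al_ge0 //; try lra.
  by rewrite ler_wpM2r; [|lra|rewrite -subr_ge0; exact: ltW (dd_gt0 m)].
by rewrite lef_pV2 ?posrE; lra.
Qed.

Lemma dd_le m n : (m <= n)%N -> dd n <= dd m.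
Proof.
move=> /subnK <-; elim: (n - m)%N => [|k IH] //; rewrite addSn.
exact: le_trans (dd_leS _) IH.
Qed.

End Kernel.

(** * The tail of [b]: mass one, and superharmonicity *)

Section Tails.
Variables (R : realType) (A B b : nat -> R).
Local Notation hb := (hb R).
Local Notation al := (al R).
Hypotheses (Apos : forall p, 0 < A p.+1) (Aa : absum A) (Ba : absum B) (B0 : forall k, 0 <= B k).
Hypotheses (b0 : forall k, 0 <= b k) (ba : absum b) (b1 : sm b <= 1).
Hypotheses (AE : forall p, A p.+1 = al p.+1 - corr b al p.+1)
           (bE : forall k, b k = B k + corr al b k).
Hypothesis AB : forall k, A k.+2 <= B k.

Let T := tl b.

Lemma T_ge0 k : 0 <= T k. Proof. exact: tl_ge0. Qed.

Lemma T_leS k : T k.+1 <= T k. Proof. by rewrite /T (tlS k ba) lerDr. Qed.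

Lemma T_le m n : (m <= n)%N -> T n <= T m.
Proof.
move=> /subnK <-; elim: (n - m)%N => [|k IH] //; rewrite addSn.
exact: le_trans (T_leS _) IH.
Qed.

Lemma T_bounded : bounded_seq T.
Proof. by exists (sm b) => i; rewrite ger0_norm ?T_ge0 //; exact: tl_le. Qed.

Lemma T_rec k : T k = tl B k + sm (fun p => al p * T (k + p)).
Proof.
have [ca <-] := tl_corr k (absum_al R) ba (@al_ge0 R) b0.
rewrite /T /tl -smD; [|exact: absum_tlE|exact: (absum_tlE k ca)].
by apply: eq_sm => j; rewrite bE.
Qed.

(** [T_rec] says that [tl B] is [T] minus its forward average by [al]. Its formal inverse is the sum
    with coefficients [hb], and by positivity truncation costs only an inequality. *)
Lemma T_ge_hb N k : \sum_(n < N) hb n * tl B (k + n) <= T k.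
Proof.
case: N => [|N]; first by rewrite big_ord0 T_ge0.
have alT m : absum (fun p => al p * T (m + p)).
  by apply: absum_mul_bounded; [exact: absum_al|exact: absum_shift_bounded T_bounded].
(* The inner sum stops at [N - n], so that the double sum is grouped by total index at most [N];
   [hb_gal] then leaves [T k] alone. *)
apply: le_trans (_ : \sum_(n < N.+1) hb n * (T (k + n) - \sum_(p < (N - n).+1) al p * T (k + n + p)) <= _).
  apply: ler_sum => n _; rewrite ler_wpM2l ?hb_ge0 // [X in X - _]T_rec lerBrDr lerD2l.
  by apply: sm_ge => // i; rewrite mulr_ge0 ?al_ge0 ?T_ge0.
under eq_bigr => n _ do rewrite mulrBr.
rewrite sumrB.
have -> : \sum_(n < N.+1) hb n * (\sum_(p < (N - n).+1) al p * T (k + n + p)) =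
   \sum_(m < N.+1) (\sum_(i < m.+1) hb i * al (m - i)) * T (k + m).
  elim: N => [|N IH]; first by rewrite !big_ord1 /= !addn0 mulrA.
  have c : \sum_(i < N.+2) hb i * al (N.+1 - i) = \sum_(i < N.+1) hb i * al (N.+1 - i).
    by rewrite big_ord_recr /= subnn al0 mulr0 addr0.
  rewrite [RHS]big_ord_recr /= -IH c big_ord_recr /= subnn big_ord1 /= al0 mul0r mulr0 addr0.
  rewrite mulr_suml -big_split /=.
  apply: eq_bigr => n _; have nN := ltn_ord n.
  rewrite -mulrA -mulrDr; congr (_ * _).
  rewrite subSn; last by rewrite -ltnS.
  rewrite big_ord_recr /=; congr (_ + al _ * T _); lia.
rewrite -sumrB (eq_bigr (fun m : 'I_N.+1 => (m == 0%N :> nat)%:R * T (k + m))) => [|m _].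
  rewrite big_ord_recl /= mul1r addn0 big1 ?addr0 // => i _; by rewrite mul0r.
rewrite -mulrBl; congr (_ * _); rewrite -hb_gal /gal.
under [RHS]eq_bigr => i _ do rewrite mulrBr.
rewrite sumrB; congr (_ - _); rewrite big_ord_recr /= subnn mulr1 big1 ?add0r // => i _.
by rewrite subn_eq0 leqNgt ltn_ord mulr0.
Qed.

Lemma mass_A p : tl A p.+1 = hb p - sm (fun j => b j * hb (p + j)).
Proof.
have [ca E] := tl_corr p.+1 ba (absum_al R) b0 (@al_ge0 R).
have -> : sm (fun j => b j * hb (p + j)) = tl (corr b al) p.+1.
  by rewrite E; apply: eq_sm => j; rewrite addSn tl_al.
rewrite -tl_al /tl -smB; [|exact: (absum_tlE p.+1 (absum_al R))|exact: (absum_tlE p.+1 ca)].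
by apply: eq_sm => j; rewrite addSn AE.
Qed.

Lemma tl_AB k : tl A k.+2 <= tl B k.
Proof.
apply: le_sm; [exact: absum_tlE|exact: absum_tlE|move=> j].
by rewrite !addSn AB.
Qed.

Lemma T_gt0 k : 0 < T k.
Proof.
apply: lt_le_trans (T_ge_hb 1 k); rewrite big_ord1 hb0 mul1r addn0.
apply: lt_le_trans (tl_AB k).
have tA := absum_tlE k.+2 Aa.
apply: lt_le_trans (sm_term 0 tA _); first by rewrite addn0.
by move=> i; rewrite addSn ltW.
Qed.

(** A defect [1 - sm b > 0] would give [tl A p.+1 >= (1 - sm b) hb p], and [T_ge_hb] would bound the
    sum of [hb n * hb n.+1], which dominates a quarter of the harmonic series. *)
Lemma sm_b_eq1 : sm b = 1.
Proof.
apply/eqP; rewrite eq_le b1 /= leNgt; apply/negP => lt1.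
have hbb p : sm (fun j => b j * hb (p + j)) <= sm b * hb p.
  rewrite mulrC -smZ //; apply: le_sm.
  - apply: absum_mul_bounded => //; exists 1 => i; by rewrite ger0_norm ?hb_ge0 ?hb_le1.
  - exact: absumZ.
  - by move=> j; rewrite mulrC ler_wpM2r // hb_le // leq_addr.
have H N : (1 - sm b) * \sum_(n < N) hb n * hb n.+1 <= T 0.
  apply: le_trans (T_ge_hb N 0); rewrite mulr_sumr; apply: ler_sum => n _.
  rewrite mulrCA ler_wpM2l ?hb_ge0 //; apply: le_trans (tl_AB _).
  rewrite mass_A add0n mulrBl mul1r lerD2l lerN2; exact: hbb.
have H2 N : \sum_(n < N) harmonic n <= 4 * (T 0 / (1 - sm b)).
  rewrite -ler_pdivrMl // ler_pdivlMr ?subr_gt0 // mulrC; apply: le_trans (H N).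
  rewrite ler_wpM2l ?subr_ge0 ?(ltW lt1) // mulr_sumr; apply: ler_sum => n _.
  apply: le_trans (_ : hb n.+1 * hb n.+1 <= _); last by rewrite ler_wpM2r ?hb_ge0 // hb_leS.
  rewrite /harmonic /= -invfM -div1r ler_pdivrMr ?mulr_gt0 // -expr2; exact: hb_sqr_ge.
apply: (@dvg_harmonic R); rewrite seriesordE; apply: nondecreasing_is_cvgn.
  by apply/nondecreasing_seqP => n; rewrite big_ord_recr /= lerDl harmonic_ge0.
by exists (4 * (T 0 / (1 - sm b))) => _ [n _ <-].
Qed.

(* Abel summation: b_j = T_j - T_{j+1} *)
Lemma sm_abel (g : nat -> R) : (forall i, 0 <= g i) -> absum g ->
  absum (fun i => T i.+1 * g i) /\
  sm (fun j => b j * \sum_(i < j) g i) = sm (fun i => T i.+1 * g i).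
Proof.
move=> g0 ga; pose f i j := if (i < j)%N then b j * g i else 0.
have f0 i j : 0 <= f i j by rewrite /f; case: ifP => // _; rewrite mulr_ge0.
have fa i : absum (f i).
  apply: (absumW _ (absumZ (g i) ba)) => j; rewrite ger0_norm // /f mulrC.
  by case: ifP => // _; rewrite mulr_ge0.
have fE i : sm (f i) = T i.+1 * g i.
  rewrite (sm_shift i.+1 (fa i)) big1 ?add0r => [|j _]; last by rewrite /f ltnNge -ltnS ltn_ord.
  rewrite mulrC /T /tl -smZ; last exact: absum_tlE.
  by apply: eq_sm => j; rewrite /f ltnS leq_addr mulrC.
have fs : absum (fun i => sm (f i)).
  apply: (absumW _ (absumZ (sm b) ga)) => i.
  rewrite fE ger0_norm ?mulr_ge0 ?T_ge0 // ler_wpM2r //; exact: tl_le.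
split; first by apply: eq_absum fs => i; rewrite fE.
rewrite -(eq_sm fE) (fubini_nneg_eq f0 fa fs); apply: eq_sm => j.
rewrite (@sm_finsupp _ _ j) => [|i ij]; last by rewrite /f ltnNge ij.
by rewrite mulr_sumr; apply: eq_bigr => i _; rewrite /f ltn_ord.
Qed.

(** As [b] has mass 1, [A p.+1] is the sum of [b_j (al_(p+1) - al_(p+1+j))]; summation by parts
    moves the difference onto [dd]. *)
Lemma A_T p : absum (fun i => T i.+1 * dd R (p + i)) /\ A p.+1 = sm (fun i => T i.+1 * dd R (p + i)).
Proof.
have S n : \sum_(i < n) dd R (p + i) = al p.+1 - al (p + n).+1.
  elim: n => [|n IH]; first by rewrite big_ord0 addn0 subrr.
  by rewrite big_ord_recr /= IH /dd addnS addrA subrK.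
have da : absum (fun i => dd R (p + i)).
  apply: (absum_ge0 (M := al p.+1)) => [i|n]; first exact: ltW (dd_gt0 _ _).
  by rewrite S gerBl al_ge0.
have [ca <-] := sm_abel (fun i => ltW (dd_gt0 R (p + i))) da.
split=> //; rewrite AE -[X in X - _]mul1r -sm_b_eq1 mulrC /corr -smZ // -smB.
- by apply: eq_sm => j; rewrite S addSn; ring.
- exact: absumZ.
- by apply: absum_corr => //; apply: absum_bounded; exact: absum_al.
Qed.

Lemma tlA_T p : absum (fun i => T i.+1 * al (p + i).+1) /\ tl A p.+1 = sm (fun i => T i.+1 * al (p + i).+1).
Proof.
have S n : \sum_(i < n) al (p + i).+1 = hb p - hb (p + n).
  elim: n => [|n IH]; first by rewrite big_ord0 addn0 subrr.
  by rewrite big_ord_recr /= IH alB addnS addrA subrK.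
have da : absum (fun i => al (p + i).+1).
  by have := absum_tlE p.+1 (absum_al R).
have [ca <-] := sm_abel (fun i => al_ge0 R (p + i).+1) da.
split=> //; rewrite mass_A -[X in X - _]mul1r -sm_b_eq1 mulrC -smZ // -smB.
- by apply: eq_sm => j; rewrite S; ring.
- exact: absumZ.
- apply: absum_mul_bounded => //; exists 1 => i; by rewrite ger0_norm ?hb_ge0 ?hb_le1.
Qed.

(** Chain [T_ge_hb], then [tl B >= tl A], then [tlA_T]: the coefficient of [T i.+1] becomes the sum
    of [hb n * al (n + k + i + 2)], which is [kap]. Site 0 does not occur on the left. *)
Lemma T_super k I : \sum_(i < I) kap R (k + i).+2 * T i.+1 <= T k.
Proof.
pose u i n := hb n * al (n + (k + i).+2) * T i.+1.
have ua i : absum (u i).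
  by apply: eq_absum (absumZ (T i.+1) (absum_kap R (k + i).+2)) => n; rewrite mulrC.
have uE i : sm (u i) = kap R (k + i).+2 * T i.+1.
  by rewrite mulrC /kap -smZ; [apply: eq_sm => n; rewrite /u mulrC|exact: absum_kap].
under eq_bigr => i _ do rewrite -uE.
rewrite -sm_fin //; apply: sm_le; first exact: absum_fin.
move=> N; apply: le_trans (T_ge_hb N k); apply: ler_sum => n _.
under eq_bigr => i _ do rewrite /u -mulrA.
rewrite -mulr_sumr ler_wpM2l ?hb_ge0 //; apply: le_trans (tl_AB _).
have [ta ->] := tlA_T (k + n).+1.
apply: le_trans (_ : \sum_(i < I) T i.+1 * al ((k + n).+1 + i).+1 <= _).
  rewrite le_eqVlt; apply/orP; left; apply/eqP/eq_bigr => i _.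
  by rewrite mulrC; congr (_ * al _); lia.
by apply: sm_ge => // i; rewrite mulr_ge0 ?T_ge0 ?al_ge0.
Qed.

End Tails.

(** * Energy estimates *)

Section Energy.
Variable R : realType.
Local Notation hb := (hb R).
Local Notation kap := (kap R).
Implicit Types chi S : nat -> R.

Definition cond k j : R := kap (k + j).+1 * hb k * hb j.
(** By [kap_hb] the total conductance at [k] is [hb k ^+ 2]; this is the part going to sites beyond
    [J], which vanishes as [J] grows. *)
Definition leak J k : R := hb k ^+ 2 - \sum_(j < J) cond k j.
Definition energy J chi : R := \sum_(k < J) \sum_(j < J) cond k j * (chi k - chi j) ^+ 2.

Lemma cond_ge0 k j : 0 <= cond k j.
Proof. by rewrite !mulr_ge0 ?hb_ge0 // ltW // kap_gt0. Qed.

Lemma condC k j : cond k j = cond j k.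
Proof. by rewrite /cond addnC mulrAC. Qed.

Lemma condE k j : cond k j = hb k * (kap (k + j).+1 * hb j).
Proof. by rewrite /cond; ring. Qed.

Lemma kap_hb_le J k : \sum_(j < J) kap (k + j).+1 * hb j <= hb k.
Proof.
have [ka kE] := kap_hb R k; rewrite -kE.
by apply: sm_ge => // j; rewrite mulr_ge0 ?hb_ge0 // ltW // kap_gt0.
Qed.

Lemma leak_ge0 J k : 0 <= leak J k.
Proof.
rewrite subr_ge0 expr2; under eq_bigr => j _ do rewrite condE.
by rewrite -mulr_sumr ler_wpM2l ?hb_ge0 // kap_hb_le.
Qed.

Lemma leak_small k e : 0 < e -> exists N, forall J, (N <= J)%N -> leak J k <= e.
Proof.
move=> e0; have [ka kE] := kap_hb R k; have [N HN] := sm_tail ka e0.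
exists N => J NJ; apply: le_trans (HN J NJ).
have -> : leak J k = hb k * sm (fun j => kap (k + (J + j)).+1 * hb (J + j)).
  rewrite /leak expr2 -{2}kE (sm_shift J ka) mulrDr mulr_sumr.
  under eq_bigr => j _ do rewrite -condE.
  by rewrite addrAC subrr add0r.
have p0 j : 0 <= kap (k + (J + j)).+1 * hb (J + j).
  by rewrite mulr_ge0 ?hb_ge0 // ltW // kap_gt0.
have s0 : 0 <= sm (fun j => kap (k + (J + j)).+1 * hb (J + j)).
  by apply: sm_ge0 => //; exact: (absum_tlE J ka).
apply: le_trans (_ : sm (fun j => kap (k + (J + j)).+1 * hb (J + j)) <= _).
  by rewrite ler_piMl ?hb_le1.
by rewrite le_eqVlt; apply/orP; left; apply/eqP/eq_sm => j; rewrite ger0_norm.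
Qed.

Lemma leak_sum_small (g : nat -> R) N e : 0 < e -> (forall k, 0 <= g k) ->
  exists N', forall J, (N' <= J)%N -> \sum_(k < N) g k * leak J k <= e.
Proof.
elim: N e => [|N IH] e e0 g0; first by exists 0%N => J _; rewrite big_ord0 ltW.
have e2 : 0 < e / 2 by lra.
have [N1 H1] := IH _ e2 g0.
have e3 : 0 < e / 2 / (g N + 1) by rewrite divr_gt0 //; have := g0 N; lra.
have [N2 H2] := leak_small N e3.
exists (maxn N1 N2) => J; rewrite geq_max => /andP[J1 J2].
rewrite big_ord_recr /= [leRHS](splitr e) lerD ?H1 //.
have := H2 J J2; rewrite ler_pdivlMr; last by have := g0 N; lra.
have := leak_ge0 J N; have := g0 N; nra.
Qed.

Lemma energyE J chi : energy J chi =
  2 * (\sum_(k < J) chi k ^+ 2 * (hb k ^+ 2 - leak J k)) -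
  2 * (\sum_(k < J) \sum_(j < J) cond k j * (chi k * chi j)).
Proof.
have E1 : \sum_(k < J) \sum_(j < J) cond k j * chi k ^+ 2 =
    \sum_(k < J) chi k ^+ 2 * (hb k ^+ 2 - leak J k).
  apply: eq_bigr => k _; rewrite /leak subKr mulr_sumr.
  by apply: eq_bigr => j _; rewrite mulrC.
have E2 : \sum_(k < J) \sum_(j < J) cond k j * chi j ^+ 2 =
    \sum_(k < J) chi k ^+ 2 * (hb k ^+ 2 - leak J k).
  rewrite exchange_big -E1 /=; apply: eq_bigr => k _; apply: eq_bigr => j _.
  by rewrite condC.
rewrite !mulr_natl !mulr2n -{1}E1 -E2 -!big_split /= -sumrB; apply: eq_bigr => k _.
by rewrite -!big_split /= -sumrB; apply: eq_bigr => j _; ring.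
Qed.

Lemma energy_le J J' chi : (J <= J')%N -> energy J chi <= energy J' chi.
Proof.
have p k j : 0 <= cond k j * (chi k - chi j) ^+ 2 by rewrite mulr_ge0 ?cond_ge0 ?sqr_ge0.
move=> JJ; rewrite -(subnKC JJ) /energy big_split_ord /=.
apply: le_trans (_ : _ <= \sum_(i < J) \sum_(j < J + (J' - J)) cond i j * (chi i - chi j) ^+ 2) _.
  by apply: ler_sum => k _; rewrite big_split_ord /= lerDl sumr_ge0.
by rewrite lerDl sumr_ge0 // => k _; rewrite sumr_ge0.
Qed.

(* Barta's trick: test the supersolution S against (chi h)^2 / S. *)
Lemma barta S chi N M E : (forall k, 0 <= S k) -> (forall k, chi k != 0 -> 0 < S k) ->
  (forall k J, chi k != 0 -> \sum_(j < J) kap (k + j).+1 * S j <= S k) ->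
  (forall k, (N <= k)%N -> chi k = 0) ->
  (forall J, energy J chi <= E) ->
  \sum_(k < M) \sum_(j < M) kap (k + j).+1 * (S k * S j) *
     (chi k * hb k / S k - chi j * hb j / S j) ^+ 2 <= E.
Proof.
move=> S0 Spos Ssup chiN chiE; apply/ler_addgt0Pr => e e0.
have e2 : 0 < e / 2 by lra.
have [N' HN'] := leak_sum_small N e2 (fun k => sqr_ge0 (chi k)).
(* All sums are finite; [J] is so large that the leakage from the support of [chi] is at most
   [e / 2]. *)
pose J := (maxn (maxn N N') M).
have JN : (N <= J)%N by rewrite /J; lia.
have JM : (M <= J)%N by rewrite /J; lia.
have JN' : (N' <= J)%N by rewrite /J; lia.
pose t k j := kap (k + j).+1 * (S k * S j) * (chi k * hb k / S k - chi j * hb j / S j) ^+ 2.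
have t0 k j : 0 <= t k j.
  by rewrite mulr_ge0 ?sqr_ge0 // mulr_ge0 ?mulr_ge0 // ltW // kap_gt0.
apply: le_trans (_ : \sum_(k < J) \sum_(j < J) t k j <= _).
  rewrite -(subnKC JM) big_split_ord /=.
  apply: le_trans (_ : _ <= \sum_(i < M) \sum_(j < M + (J - M)) t i j) _.
    by apply: ler_sum => k _; rewrite big_split_ord /= lerDl sumr_ge0.
  by rewrite lerDl sumr_ge0 // => k _; rewrite sumr_ge0.
pose ph k := chi k * hb k.
(* Expanding the square. [S] is allowed to vanish where [chi] does; there [ph] is 0 and both sides
   are 0. *)
have tE k j : t k j = ph k ^+ 2 / S k * (kap (k + j).+1 * S j) +
    ph j ^+ 2 / S j * (kap (j + k).+1 * S k) - 2 * (cond k j * (chi k * chi j)).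
  rewrite /t -/(ph k) -/(ph j).
  have -> : cond k j * (chi k * chi j) = kap (k + j).+1 * (ph k * ph j) by rewrite /cond /ph; ring.
  rewrite (addnC j k).
  have [Sk|Sk] := eqVneq (S k) 0.
    have -> : ph k = 0.
      have [c0|ck] := eqVneq (chi k) 0; first by rewrite /ph c0 mul0r.
      by have := Spos k ck; rewrite Sk ltxx.
    rewrite Sk; ring.
  have [Sj|Sj] := eqVneq (S j) 0.
    have -> : ph j = 0.
      have [c0|ck] := eqVneq (chi j) 0; first by rewrite /ph c0 mul0r.
      by have := Spos j ck; rewrite Sj ltxx.
    rewrite Sj; ring.
  by field; rewrite Sk Sj.
have half : \sum_(k < J) \sum_(j < J) ph k ^+ 2 / S k * (kap (k + j).+1 * S j) <= \sum_(k < J) ph k ^+ 2.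
  apply: ler_sum => k _; rewrite -mulr_sumr.
  have [c0|ck] := eqVneq (chi k) 0; first by rewrite /ph c0 mul0r expr0n /= !mul0r.
  rewrite mulrAC ler_pdivrMr ?Spos // ler_wpM2l ?sqr_ge0 // Ssup //.
have tS : \sum_(k < J) \sum_(j < J) t k j <= 2 * (\sum_(k < J) ph k ^+ 2) -
    2 * (\sum_(k < J) \sum_(j < J) cond k j * (chi k * chi j)).
  have -> : \sum_(k < J) \sum_(j < J) t k j =
     2 * (\sum_(k < J) \sum_(j < J) ph k ^+ 2 / S k * (kap (k + j).+1 * S j))
     - 2 * (\sum_(k < J) \sum_(j < J) cond k j * (chi k * chi j)).
    rewrite mulr_natl mulr2n [X in _ + X - _]exchange_big /= -big_split /= mulr_sumr -sumrB.
    apply: eq_bigr => k _; rewrite -big_split /= mulr_sumr -sumrB; apply: eq_bigr => j _.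
    exact: tE.
  by rewrite lerD2r ler_wpM2l.
apply: le_trans tS _.
have := chiE J; rewrite energyE.
have -> : \sum_(k < J) chi k ^+ 2 * (hb k ^+ 2 - leak J k) =
   \sum_(k < J) ph k ^+ 2 - \sum_(k < N) chi k ^+ 2 * leak J k.
  rewrite (_ : \sum_(k < N) _ = \sum_(k < J) chi k ^+ 2 * leak J k); last first.
    rewrite -(subnKC JN) big_split_ord /= [X in _ = _ + X]big1 ?addr0 // => i _.
    by rewrite chiN ?leq_addr // expr0n /= mul0r.
  by rewrite -sumrB; apply: eq_bigr => k _; rewrite /ph; ring.
have := HN' J JN'; set X := \sum_(k < N) _; set Y := \sum_(k < J) _; set Z := \sum_(k < J) _.
lra.
Qed.

(* Caccioppoli: v subharmonic off the origin, 0 <= v <= m. *)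
Lemma caccioppoli (v chi : nat -> R) m N M E F : 0 < m ->
  (forall k, 0 <= v k <= m) -> (forall k, (N <= k)%N -> chi k = 0) ->
  (forall k J, (0 < k)%N -> 0 <= (m - v k) * leak J k + \sum_(j < J) cond k j * (v j - v k)) ->
  (forall J, chi 0%N ^+ 2 * v 0%N * \sum_(j < J) cond 0 j * (v 0%N - v j) <= F) ->
  (forall J, energy J chi <= E) ->
  \sum_(k < M) \sum_(j < M) cond k j * (chi k * v k - chi j * v j) ^+ 2 <= 2 * F + m ^+ 2 * E.
Proof.
move=> m0 vm chiN sub HF chiE; apply/ler_addgt0Pr => e e0.
have v0 k : 0 <= v k by have /andP[] := vm k.
have v1 k : v k <= m by have /andP[] := vm k.
have e2 : 0 < e / 2 by lra.
pose g k := chi k ^+ 2 * v k * (m - v k).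
have g0 k : 0 <= g k by rewrite /g mulr_ge0 ?subr_ge0 // mulr_ge0 ?sqr_ge0.
have [N' HN'] := leak_sum_small N e2 g0.
pose J := (maxn (maxn N N') M).+1.
have JN : (N <= J)%N by rewrite /J; lia.
have JM : (M <= J)%N by rewrite /J; lia.
have JN' : (N' <= J)%N by rewrite /J; lia.
pose t k j := cond k j * (chi k * v k - chi j * v j) ^+ 2.
have t0 k j : 0 <= t k j by rewrite mulr_ge0 ?sqr_ge0 ?cond_ge0.
apply: le_trans (_ : \sum_(k < J) \sum_(j < J) t k j <= _).
  rewrite -(subnKC JM) big_split_ord /=.
  apply: le_trans (_ : _ <= \sum_(i < M) \sum_(j < M + (J - M)) t i j) _.
    by apply: ler_sum => k _; rewrite big_split_ord /= lerDl sumr_ge0.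
  by rewrite lerDl sumr_ge0 // => k _; rewrite sumr_ge0.
have s1 : \sum_(k < J) chi k ^+ 2 * v k * \sum_(j < J) cond k j * (v k - v j) <=
    F + \sum_(k < N) g k * leak J k.
  have -> : \sum_(k < N) g k * leak J k = \sum_(k < J) g k * leak J k.
    rewrite -(subnKC JN) big_split_ord /= [X in _ = _ + X]big1 ?addr0 // => i _.
    by rewrite /g chiN ?leq_addr // expr0n /= !mul0r.
  have gen n (f1 f2 : nat -> R) : f1 0%N <= F + f2 0%N -> (forall k, (0 < k)%N -> f1 k <= f2 k) ->
      \sum_(k < n.+1) f1 k <= F + \sum_(k < n.+1) f2 k.
    move=> f0 fS; rewrite !big_ord_recl /= addrA lerD // ler_sum // => i _; exact: fS.
  apply: (gen _ (fun k => chi k ^+ 2 * v k * \sum_(j < J) cond k j * (v k - v j)) (fun k => g k * leak J k)).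
    by apply: le_trans (HF J) _; rewrite lerDl mulr_ge0 ?leak_ge0.
  move=> k k0; rewrite /g -[leRHS]mulrA ler_wpM2l //; first by rewrite mulr_ge0 // sqr_ge0.
  have := sub k J k0.
  have -> : \sum_(j < J) cond k j * (v j - v k) = - \sum_(j < J) cond k j * (v k - v j).
    by rewrite -sumrN; apply: eq_bigr => j _; ring.
  by rewrite subr_ge0.
(* Pointwise, [(x v - y u)^2 = x^2 v (v - u) + y^2 u (u - v) + v u (x - y)^2]; the first two terms
   are equal after summation, by symmetry of [cond]. *)
have s2 : \sum_(k < J) \sum_(j < J) t k j =
   2 * (\sum_(k < J) chi k ^+ 2 * v k * \sum_(j < J) cond k j * (v k - v j)) +
   \sum_(k < J) \sum_(j < J) cond k j * (v k * v j * (chi k - chi j) ^+ 2).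
  rewrite mulr_natl mulr2n.
  have E1 : \sum_(k < J) chi k ^+ 2 * v k * (\sum_(j < J) cond k j * (v k - v j)) =
      \sum_(k < J) \sum_(j < J) cond k j * (chi k ^+ 2 * v k * (v k - v j)).
    by apply: eq_bigr => k _; rewrite mulr_sumr; apply: eq_bigr => j _; ring.
  have E2 : \sum_(k < J) chi k ^+ 2 * v k * (\sum_(j < J) cond k j * (v k - v j)) =
      \sum_(k < J) \sum_(j < J) cond k j * (chi j ^+ 2 * v j * (v j - v k)).
    rewrite E1 exchange_big; apply: eq_bigr => k _; apply: eq_bigr => j _.
    by rewrite condC.
  rewrite {1}E1 E2 -!big_split /=; apply: eq_bigr => k _; rewrite -!big_split /=.
  by apply: eq_bigr => j _; rewrite /t; ring.
have s3 : \sum_(k < J) \sum_(j < J) cond k j * (v k * v j * (chi k - chi j) ^+ 2) <= m ^+ 2 * E.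
  apply: le_trans (_ : m ^+ 2 * energy J chi <= _); last by rewrite ler_wpM2l ?sqr_ge0.
  rewrite mulr_sumr; apply: ler_sum => k _; rewrite mulr_sumr; apply: ler_sum => j _.
  rewrite [leRHS]mulrCA ler_wpM2l ?cond_ge0 // ler_wpM2r ?sqr_ge0 // expr2.
  by rewrite ler_pM.
have := HN' J JN'; rewrite s2; lra.
Qed.

End Energy.

(** * Dyadic blocks and the energy of functions of the block index *)

Definition blk k := trunc_log 2 k.+1.

Lemma blkE p i : (i < 2 ^ p)%N -> blk (2 ^ p - 1 + i) = p.
Proof. by move=> ip; apply: trunc_log_eq => //; rewrite expnS; lia. Qed.

Lemma blk_le k j : (k <= j)%N -> (blk k <= blk j)%N.
Proof. by move=> kj; apply: leq_trunc_log. Qed.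

Lemma blk_bounds k : (2 ^ blk k <= k.+1 < 2 ^ (blk k).+1)%N.
Proof. by rewrite trunc_logP // trunc_log_ltn. Qed.

Lemma blk_lt k p : (k.+1 < 2 ^ p)%N -> (blk k < p)%N.
Proof.
move=> kp; have /andP[b1 _] := blk_bounds k.
by rewrite -(@ltn_exp2l 2) //; apply: leq_ltn_trans kp.
Qed.

Lemma blk_geq k p : (2 ^ p <= k.+1)%N -> (p <= blk k)%N.
Proof.
move=> kp; have /andP[_ b1] := blk_bounds k.
by rewrite -ltnS -(@ltn_exp2l 2) //; apply: leq_ltn_trans b1.
Qed.

Definition ndist p q := ((p - q) + (q - p))%N.

Section Blocks.
Variable R : realType.
Local Notation hb := (hb R).
Local Notation kap := (kap R).
Local Notation cond := (cond R).

Lemma sum_blocks (F : nat -> R) P :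
  \sum_(k < 2 ^ P - 1) F k = \sum_(p < P) \sum_(i < 2 ^ p) F (2 ^ p - 1 + i)%N.
Proof.
elim: P => [|P IH]; first by rewrite !big_ord0.
rewrite big_ord_recr /= -IH.
have -> : (2 ^ P.+1 - 1 = (2 ^ P - 1) + 2 ^ P)%N by rewrite expnS; lia.
by rewrite big_split_ord.
Qed.

Definition bcond p q := \sum_(i < 2 ^ p) \sum_(j < 2 ^ q) cond (2 ^ p - 1 + i) (2 ^ q - 1 + j).

Lemma bcondC p q : bcond p q = bcond q p.
Proof.
by rewrite /bcond exchange_big; apply: eq_bigr => i _; apply: eq_bigr => j _; rewrite condC.
Qed.

Lemma bcond_ge0 p q : 0 <= bcond p q.
Proof. by apply: sumr_ge0 => i _; apply: sumr_ge0 => j _; apply: cond_ge0. Qed.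

Lemma kap_le (m n : nat) : (0 < n)%N -> (n <= m.+1)%N -> kap m.+1 <= 2 * kap0 R / n%:R.
Proof.
move=> n0 nm; rewrite kapE -mulrA [leRHS]mulrCA ler_wpM2l ?(ltW (kap0_gt0 R)) //.
have m0 := ler0n R m; have n1 : 1 <= n%:R :> R by rewrite ler1n.
have : n%:R <= m%:R + 1 :> R by rewrite natr1 ler_nat.
move=> nm1; rewrite ler_pdivlMr; last lra.
by rewrite mulrC ler_pdivrMr; lra.
Qed.

Lemma tk0 : 0 <= 2 * kap0 R.
Proof. by rewrite mulr_ge0 // ltW // kap0_gt0. Qed.

Let r : R := Num.sqrt 2^-1.

Lemma r0 : 0 <= r. Proof. exact: sqrtr_ge0. Qed.
Lemma r2 : r * r = 2^-1. Proof. by rewrite -expr2 sqr_sqrtr. Qed.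
Lemma r34 : r <= 3 / 4.
Proof. by rewrite -[leRHS]ger0_norm // -sqrtr_sqr; apply: ler_wsqrtr; lra. Qed.

Lemma hb_blk p i : hb (2 ^ p - 1 + i) <= r ^+ p.
Proof.
rewrite -ler_sqr ?nnegrE ?hb_ge0 ?exprn_ge0 ?r0 // -exprM mulnC exprM.
rewrite [r ^+ 2]expr2 r2 exprVn -[leRHS]mul1r ler_pdivlMr ?exprn_gt0 //.
apply: le_trans (hb_sqr_le R (2 ^ p - 1 + i)); rewrite ler_wpM2l ?sqr_ge0 //.
have : (2 ^ p <= 2 * (2 ^ p - 1 + i) + 1)%N by have := expn_gt0 2 p; lia.
by rewrite -(ler_nat R) natrX natrD natrM.
Qed.

(** For [p <= q] there are [2^(p+q)] pairs, with kernel of order [2^(-q)] and [hb] factors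
    [2^(-(p+q)/2)]: the conductance is of order [2^(-(q-p)/2)], and [1 / sqrt 2 <= 3/4]. *)
Lemma bcond_le p q : bcond p q <= 2 * kap0 R * (3 / 4) ^+ ndist p q.
Proof.
wlog pq : p q / (p <= q)%N.
  by move=> H; case: (leqP p q) => [|/ltnW]/H //; rewrite bcondC /ndist addnC.
have -> : ndist p q = (q - p)%N by rewrite /ndist; lia.
have q0 : 0 < 2 ^+ q :> R by rewrite exprn_gt0.
apply: le_trans (_ : \sum_(i < 2 ^ p) \sum_(j < 2 ^ q) (2 * kap0 R / 2 ^+ q * (r ^+ p * r ^+ q)) <= _).
  apply: ler_sum => i _; apply: ler_sum => j _; rewrite /cond -mulrA.
  apply: ler_pM; rewrite ?mulr_ge0 ?hb_ge0 //; first exact: ltW (kap_gt0 _ _).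
    rewrite -natrX; apply: kap_le; rewrite ?expn_gt0 //; have := expn_gt0 2 q; lia.
  by apply: ler_pM; rewrite ?hb_ge0 ?hb_blk.
rewrite !sumr_const !card_ord -[leLHS]mulr_natr -[X in X * _ <= _]mulr_natr !natrX.
have -> : 2 * kap0 R / 2 ^+ q * (r ^+ p * r ^+ q) * 2 ^+ q * 2 ^+ p =
   2 * kap0 R * ((r ^+ p * r ^+ p * 2 ^+ p) * r ^+ (q - p)).
  rewrite -{2}(subnKC pq) exprD; field; rewrite gt_eqF //.
rewrite -!exprMn r2 mulVf // expr1n mul1r ler_wpM2l ?tk0 //.
by apply: lerXn2r; rewrite ?nnegrE ?r0 ?r34.
Qed.

Lemma energy_blocks P (th : nat -> R) : energy (2 ^ P - 1) (th \o blk) =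
  \sum_(p < P) \sum_(q < P) bcond p q * (th p - th q) ^+ 2.
Proof.
rewrite /energy (sum_blocks (fun k => \sum_(j < 2 ^ P - 1) cond k j * ((th \o blk) k - (th \o blk) j) ^+ 2)).
apply: eq_bigr => p _.
under eq_bigr => i _ do
  rewrite (sum_blocks (fun j => cond (2 ^ p - 1 + i) j * ((th \o blk) (2 ^ p - 1 + i)%N - (th \o blk) j) ^+ 2)).
rewrite exchange_big; apply: eq_bigr => q _.
rewrite /bcond mulr_suml; apply: eq_bigr => i _; rewrite mulr_suml; apply: eq_bigr => j _.
by rewrite /= !blkE.
Qed.

Lemma geom2_sum n : \sum_(d < n) d%:R ^+ 2 * (3 / 4) ^+ d <= 84 :> R.
Proof.
(* the quadratic for which u d - u (d + 1) is the summand *)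
pose u d : R := (4 * d%:R ^+ 2 + 24 * d%:R + 84) * (3 / 4) ^+ d.
suff -> : \sum_(d < n) d%:R ^+ 2 * (3 / 4) ^+ d = 84 - u n.
  by rewrite gerBl mulr_ge0 ?exprn_ge0 // !addr_ge0 ?mulr_ge0 ?sqr_ge0.
elim: n => [|n IH]; first by rewrite big_ord0 /u expr0; ring.
rewrite big_ord_recr /= IH /u [(3 / 4) ^+ n.+1]exprS -[n.+1%:R]natr1; set e := _ ^+ n; set z := n%:R; lra.
Qed.

Lemma sum_ndist (g : nat -> R) S P p : (forall d, 0 <= g d) ->
  (forall n, \sum_(d < n) g d <= S) -> \sum_(q < P) g (ndist p q) <= 2 * S.
Proof.
move=> g0 gS; apply: le_trans (_ : \sum_(q < p + P) g (ndist p q) <= _).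
  by rewrite addnC big_split_ord /= lerDl sumr_ge0.
rewrite big_split_ord mulr_natl mulr2n lerD //=; last first.
  apply: le_trans (gS P); rewrite le_eqVlt; apply/orP; left; apply/eqP/eq_bigr => i _.
  by congr g; rewrite /ndist; lia.
apply: le_trans (gS p.+1); rewrite big_ord_recl /= -[leLHS]add0r lerD //.
rewrite le_eqVlt; apply/orP; left; apply/eqP; rewrite (reindex_inj rev_ord_inj) /=.
by apply: eq_bigr => i _; congr g; rewrite /ndist /bump; have := ltn_ord i; lia.
Qed.

(* 672 = 2 (ends of an edge) * 2 (directions) * 84 (geom2_sum) * 2. *)
Definition CE : R := 672 * kap0 R.

(** A pair of blocks at distance [d] contributes at most a constant times [d^2 (3/4)^d / Lam^2],
    summable in [d]; a nonzero contribution has an end among the [w] blocks of the support. *)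
Lemma cutoff_energy (t : nat -> nat) lo w Lam J : (0 < Lam)%N ->
  (forall p q, (t p <= t q + ndist p q)%N) ->
  (forall p, t p != 0%N -> (lo <= p < lo + w)%N) ->
  energy J (fun k => (t (blk k))%:R / Lam%:R) <= CE * w%:R / Lam%:R ^+ 2.
Proof.
move=> L0 tl tw.
have JP : (J <= 2 ^ J.+1 - 1)%N.
  by have : (J.+1 < 2 ^ J.+1)%N by [apply: ltn_expl]; lia.
apply: le_trans (energy_le _ JP) _.
rewrite (energy_blocks J.+1 (fun p => (t p)%:R / Lam%:R)).
set P := J.+1.
have L1 : 0 < Lam%:R :> R by rewrite ltr0n.
pose G d : R := 2 * kap0 R / Lam%:R ^+ 2 * (d%:R ^+ 2 * (3 / 4) ^+ d).
have G0 d : 0 <= G d.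
  by rewrite mulr_ge0 // ?divr_ge0 ?tk0 ?mulr_ge0 ?exprn_ge0 ?ler0n.
have GS n : \sum_(d < n) G d <= 2 * kap0 R / Lam%:R ^+ 2 * 84.
  by rewrite -mulr_sumr ler_wpM2l ?geom2_sum // divr_ge0 ?tk0 ?exprn_ge0.
pose I p : R := (t p != 0%N)%:R.
have I0 p : 0 <= I p by rewrite ler0n.
have step p q : bcond p q * ((t p)%:R / Lam%:R - (t q)%:R / Lam%:R) ^+ 2 <=
    I p * G (ndist p q) + I q * G (ndist q p).
  have dC : ndist q p = ndist p q by rewrite /ndist addnC.
  rewrite dC -mulrDl.
  have [z|nz] := boolP ((t p == 0%N) && (t q == 0%N)).
    by have /andP[/eqP -> /eqP ->] := z; rewrite subrr expr0n /= mulr0 mulr_ge0 ?addr_ge0.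
  have I1 : 1 <= I p + I q.
    by rewrite /I; move: nz; rewrite negb_and; case: (t p == _); case: (t q == _) => //= _;
      rewrite ?addr0 ?add0r // lerDl.
  apply: le_trans (_ : G (ndist p q) <= _); last by rewrite ler_peMl.
  have sq : ((t p)%:R / Lam%:R - (t q)%:R / Lam%:R) ^+ 2 <= (ndist p q)%:R ^+ 2 / Lam%:R ^+ 2 :> R.
    rewrite -mulrBl expr_div_n ler_wpM2r ?invr_ge0 ?exprn_ge0 ?(ltW L1) //.
    have := tl p q; have := tl q p; rewrite dC -!(ler_nat R) [(t q + _)%:R]natrD [(t p + _)%:R]natrD.
    set x : R := (t p)%:R; set y : R := (t q)%:R; set d : R := (ndist p q)%:R => h1 h2.
    have : 0 <= (d - (x - y)) * (d + (x - y)) by rewrite mulr_ge0 //; lra.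
    by rewrite !expr2; lra.
  apply: le_trans (ler_pM (bcond_ge0 p q) (sqr_ge0 _) (bcond_le p q) sq) _.
  by rewrite le_eqVlt; apply/orP; left; apply/eqP; rewrite /G; ring.
have Iw : \sum_(p < P) I p <= w%:R.
  rewrite -natr_sum ler_nat.
  apply: leq_trans (_ : \sum_(p < lo + w + P) (t p != 0%N) <= _)%N.
    by rewrite addnC big_split_ord /= leq_addr.
  rewrite -addnA big_split_ord /= big_split_ord /= [X in (X + _)%N]big1 ?add0n => [|i _].
    rewrite [X in (_ + X)%N]big1 ?addn0 => [|i _].
      by rewrite -[leqRHS](card_ord w) -sum1_card leq_sum // => i _; case: eqP.
    apply/eqP; rewrite eqb0 negbK; apply: contraT => /tw; lia.
  apply/eqP; rewrite eqb0 negbK; apply: contraT => /tw; have := ltn_ord i; lia.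
have half : \sum_(p < P) \sum_(q < P) I p * G (ndist p q) <= w%:R * (2 * (2 * kap0 R / Lam%:R ^+ 2 * 84)).
  apply: le_trans (_ : \sum_(p < P) I p * (2 * (2 * kap0 R / Lam%:R ^+ 2 * 84)) <= _).
    by apply: ler_sum => p _; rewrite -mulr_sumr ler_wpM2l // sum_ndist.
  rewrite -mulr_suml ler_wpM2r // mulr_ge0 // mulr_ge0 //.
  by rewrite divr_ge0 ?tk0 ?exprn_ge0.
apply: le_trans (_ : \sum_(p < P) \sum_(q < P) (I p * G (ndist p q) + I q * G (ndist q p)) <= _).
  by apply: ler_sum => p _; apply: ler_sum => q _; exact: step.
rewrite (eq_bigr (fun p : 'I_P => \sum_(q < P) I p * G (ndist p q) + \sum_(q < P) I q * G (ndist q p)));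
  last by move=> p _; rewrite big_split.
rewrite big_split /= [X in _ + X]exchange_big /=.
apply: le_trans (lerD half half) _.
by rewrite le_eqVlt; apply/orP; left; apply/eqP; rewrite /CE; ring.
Qed.

End Blocks.

(** * Cutoffs of small energy, and lower bounds on conductances *)

Section Pre.
Variable R : realType.
Local Notation hb := (hb R).
Local Notation kap := (kap R).
Local Notation cond := (cond R).

Lemma archi_nat (x : R) : exists n : nat, x < n%:R.
Proof.
exists (Num.bound `|x|); apply: le_lt_trans (ler_norm x) _.
exact: archi_boundP.
Qed.

(** A trapezoid in the block index, with a plateau of radius [c] and ramps of length [L]: its energy
    is of order [L / L^2]. [D] depends only on [c] and [e], so plateaus at arbitrarily large scales
    are available. *)
Lemma cutoff c (e : R) : 0 < e -> exists D, forall p0, exists chi N,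
  [/\ forall k, 0 <= chi k <= 1,
      forall k, (ndist (blk k) p0 <= c)%N -> chi k = 1,
      forall k, (N <= k)%N -> chi k = 0,
      forall J, energy J chi <= e
    & (D <= p0)%N -> chi 0%N = 0].
Proof.
move=> e0; have [n Hn] := archi_nat (4 * CE R / e).
pose L := (maxn c n).+1; have L0 : 0 < L%:R :> R by [].
exists (L + c)%N => p0.
pose t p := minn L ((L + c) - ndist p p0)%N.
exists (fun k => (t (blk k))%:R / L%:R), (2 ^ (p0 + L + c)).+1; split.
- move=> k; rewrite divr_ge0 ?ler0n //= ler_pdivrMr // mul1r ler_nat; exact: geq_minl.
- move=> k kc; rewrite /t (minn_idPl _) ?divff ?gt_eqF //; lia.
- move=> k kN; suff -> : t (blk k) = 0%N by rewrite mul0r.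
  have : (p0 + L + c <= blk k)%N by apply: blk_geq; lia.
  by rewrite /t /ndist; lia.
(* The support has radius less than [L + c], and [c < L], so it fits into [4 * L] blocks. *)
- move=> J; apply: le_trans (@cutoff_energy R t (p0 - (L + c)) (4 * L) L J _ _ _) _ => //.
  + by move=> p q; rewrite /t /ndist; lia.
  + by move=> p; rewrite /t /ndist /L; lia.
  rewrite ler_pdivrMr ?exprn_gt0 // natrM.
  have nL : n%:R <= L%:R :> R by rewrite ler_nat /L; lia.
  move: Hn; rewrite ltr_pdivrMr // => Hn.
  have : 4 * CE R <= e * L%:R by nra.
  rewrite expr2; nra.
- move=> pD; rewrite /blk /= /t /ndist trunc_log1.
  by have -> : minn L (L + c - (0 - p0 + (p0 - 0))) = 0%N by [lia]; rewrite mul0r.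
Qed.

Lemma cond_ge n k j : (0 < n)%N -> (k <= n)%N -> (j <= n)%N ->
  kap0 R / (12 * n%:R ^+ 2) <= cond k j.
Proof.
case: n => // n _ kn jn; have K0 := kap0_gt0 R.
have n1 : 1 <= n.+1%:R :> R by rewrite ler1n.
have h2 : (4 * n.+1%:R)^-1 <= hb k * hb j.
  apply: le_trans (_ : hb n.+1 * hb n.+1 <= _); last by rewrite ler_pM ?hb_ge0 ?hb_le.
  by rewrite -div1r ler_pdivrMr ?mulr_gt0 // -expr2 hb_sqr_ge.
have k2 : kap0 R / (3 * n.+1%:R) <= kap (k + j).+1.
  rewrite kapE ler_wpM2l ?(ltW K0) // lef_pV2 ?posrE ?mulr_gt0 //.
    have : (k + j <= 2 * n.+1)%N by lia.
    by rewrite -(ler_nat R) natrM; lra.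
have -> : kap0 R / (12 * n.+1%:R ^+ 2) = kap0 R / (3 * n.+1%:R) * (4 * n.+1%:R)^-1.
  by field; rewrite gt_eqF.
rewrite /cond -[leRHS]mulrA; apply: ler_pM => //.
  by apply: divr_ge0; [exact: ltW|exact: mulr_ge0].
Qed.

Lemma sum_window (F : nat -> R) M k0 m : (forall k, 0 <= F k) -> (k0 + m <= M)%N ->
  \sum_(i < m) F (k0 + i)%N <= \sum_(k < M) F k.
Proof.
move=> F0 kM; rewrite -(subnKC kM) big_split_ord /=.
apply: le_trans (_ : \sum_(k < k0 + m) F k <= _); last by rewrite lerDl sumr_ge0.
by rewrite big_split_ord /= lerDr sumr_ge0.
Qed.

Lemma sum_window2 (F : nat -> nat -> R) M k0 j0 m n : (forall k j, 0 <= F k j) ->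
  (k0 + m <= M)%N -> (j0 + n <= M)%N ->
  \sum_(i < m) \sum_(j < n) F (k0 + i)%N (j0 + j)%N <= \sum_(k < M) \sum_(j < M) F k j.
Proof.
move=> F0 kM jM; apply: le_trans (_ : \sum_(i < m) \sum_(j < M) F (k0 + i)%N j <= _).
  by apply: ler_sum => i _; apply: (sum_window (F := F (k0 + i)%N)).
by apply: (sum_window (F := fun k => \sum_(j < M) F k j)) => // k; apply: sumr_ge0.
Qed.

(** Nonincreasing and at least 1/2, hence convergent to a positive limit; this is the regular
    variation of [hb] with exponent [-1/2]. *)
Definition gs n : R := hb n ^+ 2 * (2 * n%:R + 1).

Lemma gs_ge n : 2^-1 <= gs n.
Proof.
case: n => [|n]; first by rewrite /gs hb0 expr1n mulr0 add0r mulr1; lra.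
have := hb_sqr_ge R n; rewrite /gs; set h := _ ^+ 2; set x := n.+1%:R => H.
have : 0 <= h by exact: sqr_ge0.
lra.
Qed.

Lemma gs_leS n : gs n.+1 <= gs n.
Proof.
rewrite /gs -[n.+1%:R]natr1 hbS exprMn -mulrA ler_wpM2l ?sqr_ge0 //.
rewrite expr_div_n mulrAC ler_pdivrMr; last by rewrite exprn_gt0 //; have := ler0n R n; lra.
have := ler0n R n; set x := n%:R => x0; rewrite !expr2; nra.
Qed.

Lemma gs_ratio e : 0 < e -> exists X, forall k j, (X <= k)%N -> (X <= j)%N -> gs k <= (1 + e) * gs j.
Proof.
move=> e0.
have gd m n : (m <= n)%N -> gs n <= gs m.
  move=> /subnK <-; elim: (n - m)%N => [|i IH] //; rewrite addSn; exact: le_trans (gs_leS _) IH.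
have hinf : has_inf (range gs).
  split; first by exists (gs 0), 0%N.
  by exists 2^-1 => _ [n _ <-]; exact: gs_ge.
have e2 : 0 < e / 2 by lra.
have [_ [X _ <-] HX] := @inf_adherent _ _ _ e2 hinf.
exists X => k j Xk Xj; have g1 := gd _ _ Xk.
have : inf (range gs) <= gs j.
  apply: ge_inf; [by exists 2^-1 => _ [n _ <-]; exact: gs_ge|by exists j].
have := gs_ge j; nra.
Qed.

End Pre.

(** * Slow variation and growth of the tail *)

Section Slow.
Variables (R : realType) (T : nat -> R).
Local Notation hb := (hb R).
Local Notation kap := (kap R).
Local Notation cond := (cond R).
Local Notation gs := (gs R).
Hypotheses (Tpos : forall k, 0 < T k) (Tle : forall m n, (m <= n)%N -> T n <= T m).
Hypothesis Tsup : forall k I, \sum_(i < I) kap (k + i).+2 * T i.+1 <= T k.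

(** If the ratios [T / hb] differed for all pairs in two windows of length about [x / N] near scale
    [x], the sum in [barta] over these pairs would have a lower bound independent of [x],
    contradicting a cutoff of smaller energy. *)
Lemma osc D N (delta : R) : 0 < delta -> (0 < N)%N -> exists X, forall x k0 j0,
  (X <= x)%N -> (x <= 2 * k0)%N -> (x <= 2 * j0)%N ->
  (k0 + x %/ N <= D * x)%N -> (j0 + x %/ N <= D * x)%N ->
  exists k j, [/\ (k0 <= k <= k0 + x %/ N)%N, (j0 <= j <= j0 + x %/ N)%N &
    (T k * hb j - T j * hb k) ^+ 2 <= delta * (T k * T j * (hb k * hb j))].
Proof.
move=> d0 N0; have K0 := kap0_gt0 R.
(* Lower bound for the window sum: about [(x / N)^2] pairs, each with conductance at least
   [kap0 / (12 (D.+1 x)^2)] by [cond_ge]. The cutoff is given half of it. *)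
pose E := kap0 R / (12 * (N%:R ^+ 2 * D.+1%:R ^+ 2)) * delta.
have NR : 0 < N%:R :> R by rewrite ltr0n.
have DR : 0 < D.+1%:R :> R by rewrite ltr0n.
have E0 : 0 < E.
  apply: mulr_gt0 => //; apply: divr_gt0 => //; apply: mulr_gt0 => //.
  by apply: mulr_gt0; rewrite exprn_gt0.
have E2 : 0 < E / 2 by rewrite divr_gt0.
have [B HB] := cutoff D.+1 E2.
exists (2 ^ B.+1)%N => x k0 j0 Xx xk xj kD jD.
have x2 : (2 <= x)%N by apply: leq_trans Xx; rewrite expnS; have := expn_gt0 2 B; lia.
pose p0 := blk x; have /andP[b1 b2] := blk_bounds x; rewrite -/p0 in b1 b2.
have Bp : (B <= p0)%N by apply: blk_geq; rewrite expnS in Xx; lia.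
have p1 : (1 <= p0)%N by apply: blk_geq; lia.
have near k : (x <= 2 * k)%N -> (k <= D * x)%N -> (ndist (blk k) p0 <= D.+1)%N.
  move=> kx kDx.
  have u1 : (blk k < D + p0.+1)%N.
    apply: blk_lt; rewrite expnD; apply: leq_ltn_trans (_ : D.+1 * x < _)%N; first by rewrite mulSn; lia.
    apply: leq_ltn_trans (leq_mul (ltn_expl D (ltnSn 1)) (leqnn x)) _.
    by rewrite ltn_pmul2l ?expn_gt0 //; lia.
  have u2 : (p0.-1 <= blk k)%N.
    apply: blk_geq; move: b1; rewrite -{1}(prednK p1) expnS; lia.
  by rewrite /ndist; lia.
have [chi [M [c01 c1 cM cE /(_ Bp) c0]]] := HB p0.
set m := (x %/ N)%N in kD jD *.
apply: contrapT => H.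
have Hd k j : (k0 <= k <= k0 + m)%N -> (j0 <= j <= j0 + m)%N ->
    delta * (T k * T j * (hb k * hb j)) < (T k * hb j - T j * hb k) ^+ 2.
  move=> kk jj; rewrite ltNge; apply/negP => Hle; apply: H; exists k, j; split=> //.
(* [Tsup] controls sums over positive sites only, so [T] is killed at the origin; the cutoff
   vanishes there. *)
pose S k := if k == 0%N then 0 else T k.
have S0 k : 0 <= S k by rewrite /S; case: eqP => // _; exact: ltW.
have Spos k : chi k != 0 -> 0 < S k.
  by rewrite /S; case: k => [|k] //=; rewrite c0 eqxx.
have Ssup k J : chi k != 0 -> \sum_(j < J) kap (k + j).+1 * S j <= S k.
  case: k => [|k _]; first by rewrite c0 eqxx.
  case: J => [|J]; first by rewrite big_ord0.
  rewrite big_ord_recl /= mulr0 add0r; apply: le_trans (Tsup k.+1 J).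
  by rewrite le_eqVlt; apply/orP; left; apply/eqP/eq_bigr => i _; rewrite /bump /= add1n addnS.
pose M' := (D * x).+1.
have := @barta R S chi M M' (E / 2) S0 Spos Ssup cM cE.
apply/negP; rewrite -ltNge.
pose F k j := kap (k + j).+1 * (S k * S j) * (chi k * hb k / S k - chi j * hb j / S j) ^+ 2.
have F0 k j : 0 <= F k j.
  by rewrite mulr_ge0 ?sqr_ge0 // mulr_ge0 ?mulr_ge0 // ltW // kap_gt0.
apply: lt_le_trans (sum_window2 (F := F) (k0 := k0) (j0 := j0) (m := m.+1) (n := m.+1) F0 _ _);
  [|by rewrite /M'; lia..].
have xR : 0 < (D.+1 * x)%:R :> R by rewrite ltr0n; lia.
apply: lt_le_trans (_ : \sum_(i < m.+1) \sum_(j < m.+1) (kap0 R / (12 * (D.+1 * x)%:R ^+ 2) * delta) <= _); last first.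
  apply: ler_sum => i _; apply: ler_sum => j _.
  set k := (k0 + i)%N; set l := (j0 + j)%N.
  have ii := ltn_ord i; have jj := ltn_ord j.
  have kl : (k0 <= k <= k0 + m)%N by rewrite /k; lia.
  have ll : (j0 <= l <= j0 + m)%N by rewrite /l; lia.
  have Hkl := Hd k l kl ll.
  have ck : chi k = 1 by apply/c1/near; clear -kl kD xk; lia.
  have cl : chi l = 1 by apply/c1/near; clear -ll jD xj; lia.
  have Sk : S k = T k by rewrite /S; case: eqP => // k00; clear -k00 kl xk x2; lia.
  have Sl : S l = T l by rewrite /S; case: eqP => // k00; clear -k00 ll xj x2; lia.
  have cge : kap0 R / (12 * (D.+1 * x)%:R ^+ 2) <= cond k l.
    by apply: (@cond_ge R (D.+1 * x)%N k l); rewrite mulSn; clear -kl ll kD jD x2; lia.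
  rewrite /F ck cl Sk Sl !mul1r.
  have [tk tl] := (Tpos k, Tpos l); have [hk hl] := (hb_gt0 R k, hb_gt0 R l).
  have -> : kap (k + l).+1 * (T k * T l) * (hb k / T k - hb l / T l) ^+ 2 =
     cond k l * ((T k * hb l - T l * hb k) ^+ 2 / (T k * T l * (hb k * hb l))).
    by rewrite /cond; field; rewrite !gt_eqF.
  apply: ler_pM.
  - by apply: divr_ge0; [exact: ltW|apply: mulr_ge0 => //; exact: sqr_ge0].
  - exact: ltW.
  - exact: cge.
  - by rewrite ler_pdivlMr ?mulr_gt0 // ltW.
rewrite !sumr_const !card_ord -[ltRHS]mulr_natr -[X in _ < X * _]mulr_natr.
have mx : x%:R <= N%:R * m.+1%:R :> R.
  by rewrite -natrM ler_nat ltnW // mulnC -ltn_divLR.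
have x0 : 0 < x%:R :> R by rewrite ltr0n; apply: leq_trans x2.
apply: lt_le_trans (_ : E <= _); first lra.
rewrite /E natrM.
set y := m.+1%:R in mx *; set d := D.+1%:R in DR *; set z := N%:R in NR mx *; set w := x%:R in x0 mx *.
rewrite -subr_ge0.
have -> : kap0 R / (12 * (d * w) ^+ 2) * delta * y * y - kap0 R / (12 * (z ^+ 2 * d ^+ 2)) * delta =
  kap0 R * delta * ((z * y - w) * (z * y + w)) / (12 * z ^+ 2 * (d * w) ^+ 2).
  by field; rewrite !gt_eqF.
apply: divr_ge0; last first.
  by apply: mulr_ge0; [apply: mulr_ge0|]; rewrite ?exprn_ge0 ?mulr_ge0 ?ltW.
apply: mulr_ge0; first by rewrite ltW // mulr_gt0.
by apply: mulr_ge0; lra.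
Qed.

End Slow.

Lemma small_pow (R : realType) n (e : R) : 0 < e -> exists d, 0 < d /\ (1 + d) ^+ n <= 1 + e.
Proof.
elim: n e => [|n IH] e e0; first by exists 1; rewrite expr0; split=> //; lra.
have [d [d0 Hd]] := IH (e / 2) ltac:(lra).
pose d' := Num.min d (e / (2 + e)).
have e2 : 0 < e / (2 + e) by rewrite divr_gt0 //; lra.
have d'0 : 0 < d' by rewrite /d' lt_min d0 e2.
have d'1 : d' <= d by rewrite /d' ge_min lexx.
have d'2 : d' <= e / (2 + e) by rewrite /d' ge_min lexx orbT.
exists d'; split=> //; rewrite exprS.
have : (1 + d') ^+ n <= 1 + e / 2 by apply: le_trans Hd; apply: lerXn2r; rewrite ?nnegrE; lra.
rewrite ler_pdivlMr in d'2; last lra.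
set y := _ ^+ n => Hy; have : 0 <= y by rewrite exprn_ge0; lra.
nra.
Qed.

Section Slow.
Variables (R : realType) (T : nat -> R).
Local Notation hb := (hb R).
Local Notation kap := (kap R).
Local Notation cond := (cond R).
Local Notation gs := (gs R).
Hypotheses (Tpos : forall k, 0 < T k) (Tle : forall m n, (m <= n)%N -> T n <= T m).
Hypothesis Tsup : forall k I, \sum_(i < I) kap (k + i).+2 * T i.+1 <= T k.

Definition tau k := T k ^+ 2 * (2 * k%:R + 1).

Lemma tau_ge0 k : 0 <= tau k.
Proof. by rewrite mulr_ge0 ?sqr_ge0 //; have := ler0n R k; lra. Qed.

(** [tau] is the square of [T / hb] times [gs]. Two factors [1 + d] come from squaring the ratio,
    the third from [gs_ratio]. *)
Lemma osc_tau D N (e : R) : 0 < e -> (0 < N)%N -> exists X, forall x k0 j0,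
  (X <= x)%N -> (x <= 2 * k0)%N -> (x <= 2 * j0)%N ->
  (k0 + x %/ N <= D * x)%N -> (j0 + x %/ N <= D * x)%N ->
  exists k j, [/\ (k0 <= k <= k0 + x %/ N)%N, (j0 <= j <= j0 + x %/ N)%N &
    tau j <= (1 + e) * tau k].
Proof.
move=> e0 N0; have [d [d0 Hd]] := small_pow 3 e0.
have [X1 HX1] := gs_ratio d0.
(* With this constant, [(b - a)^2 <= delta a b] forces [b <= (1 + d) a]: otherwise [b - a > d a] and
   [(1 + d) (b - a) > d b]. *)
have del0 : 0 < d ^+ 2 / (1 + d) by rewrite divr_gt0 ?exprn_gt0 //; lra.
have [X2 HX2] := osc Tpos Tsup D del0 N0.
exists (maxn (2 * X1) X2) => x k0 j0; rewrite geq_max => /andP[xX1 xX2] xk xj kD jD.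
have [k [j [kk jj H]]] := HX2 x k0 j0 xX2 xk xj kD jD.
exists k, j; split=> //.
have gkj : gs j <= (1 + d) * gs k by apply: HX1; lia.
have [tk tj] := (Tpos k, Tpos j); have [hk hj] := (hb_gt0 R k, hb_gt0 R j).
have ba : T j * hb k <= (1 + d) * (T k * hb j).
  have a0 : 0 < T k * hb j by rewrite mulr_gt0.
  have b0 : 0 < T j * hb k by rewrite mulr_gt0.
  move: H; rewrite (_ : T k * T j * (hb k * hb j) = (T k * hb j) * (T j * hb k)); last by ring.
  set a := T k * hb j in a0 *; set b := T j * hb k in b0 *; move=> H; rewrite leNgt; apply/negP => ab.
  have : d * a * (d * b) < (1 + d) * (a - b) ^+ 2.
    apply: lt_le_trans (_ : d * a * ((1 + d) * (b - a)) <= _).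
      rewrite ltr_pM2l ?mulr_gt0 //; lra.
    rewrite (_ : (1 + d) * (a - b) ^+ 2 = (b - a) * ((1 + d) * (b - a))); last by ring.
    by apply: ler_wpM2r; [apply: mulr_ge0; nra|lra].
  apply/negP; rewrite -leNgt; rewrite mulrAC ler_pdivlMr in H; last lra.
  by rewrite (_ : d * a * (d * b) = d ^+ 2 * (a * b)); [rewrite mulrC|ring].
have sq : (T j * hb k) ^+ 2 <= (1 + d) ^+ 2 * (T k * hb j) ^+ 2.
  by rewrite -exprMn lerXn2r // nnegrE !mulr_ge0 ?ltW //; lra.
have gk0 := gs_ge R k.
have kR := ler0n R k; have jR := ler0n R j.
rewrite -(ler_pM2r (_ : 0 < gs k)); last by lra.
apply: le_trans (_ : (1 + d) ^+ 2 * tau k * gs j <= _).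
  rewrite /tau /gs; move: sq; rewrite !exprMn.
  set a := T j ^+ 2; set b := T k ^+ 2; set u := hb k ^+ 2; set v := hb j ^+ 2; set c := (1 + d) ^+ 2 => sq.
  rewrite (_ : a * _ * _ = a * u * ((2 * j%:R + 1) * (2 * k%:R + 1))); last by ring.
  rewrite (_ : c * _ * _ = c * (b * v) * ((2 * j%:R + 1) * (2 * k%:R + 1))); last by ring.
  by rewrite ler_wpM2r // mulr_ge0; lra.
apply: le_trans (_ : (1 + d) ^+ 3 * tau k * gs k <= _).
  rewrite (_ : (1 + d) ^+ 3 * tau k * gs k = (1 + d) ^+ 2 * tau k * ((1 + d) * gs k)); last by ring.
  by rewrite ler_wpM2l // mulr_ge0 ?tau_ge0 // exprn_ge0 // addr_ge0 // ltW.
by rewrite ler_wpM2r ?ler_wpM2r ?tau_ge0 //; lra.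
Qed.

(** Take a window ending at [a x] and one starting at [b x]. Since [T] decreases, [T (a x) <= T j]
    and [T k <= T (b x)], so the comparable pair of [osc_tau] compares the fixed points. Squares
    avoid the root in the exponent [-1/2]. *)
Lemma T_slow a b (e : R) : (0 < a)%N -> (0 < b)%N -> 0 < e -> exists X, forall x, (X <= x)%N ->
  a%:R * T (a * x) ^+ 2 <= (1 + e) * (b%:R * T (b * x) ^+ 2).
Proof.
move=> a0 b0 e0; have [d [d0 Hd]] := small_pow 2 e0.
(* Windows short enough for their effect on the indices, a factor at most [(Q + 2) / (Q - 1)] with
   [Q = N], to be absorbed by one more [1 + d]. *)
have [n Hn] := archi_nat (2 * (3 + d) / d).
pose N := n.+2.
have [X HX] := osc_tau (a + b) d0 (ltn0Sn n.+1).
exists (maxn X (2 * N)) => x; rewrite geq_max => /andP[xX xN].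
have mN : (x %/ N * N <= x)%N by exact: leq_trunc_div.
pose m := (x %/ N)%N; rewrite -/m in mN.
have m2 : (2 * m <= x)%N by rewrite /N in mN; lia.
have ax : (x <= a * x)%N by rewrite leq_pmull.
have bx : (x <= b * x)%N by rewrite leq_pmull.
have [k [j [kk jj H]]] : exists k j, [/\ (b * x <= k <= b * x + m)%N,
    (a * x - m <= j <= a * x - m + m)%N & tau j <= (1 + d) * tau k].
  by apply: HX xX _ _ _ _; rewrite -/N -/m ?mulnDl; lia.
have NR : 2 * (3 + d) <= d * N%:R.
  move: Hn; rewrite ltr_pdivrMr // => /ltW Hn; apply: le_trans Hn _.
  by rewrite mulrC ler_wpM2l ?(ltW d0) // ler_nat /N; lia.
have mR : m%:R * N%:R <= x%:R :> R by rewrite -natrM ler_nat.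
have xR : 2 * N%:R <= x%:R :> R by rewrite -natrM ler_nat.
have aR : 1 <= a%:R :> R by rewrite ler1n.
have bR : 1 <= b%:R :> R by rewrite ler1n.
have Tj : T (a * x) ^+ 2 <= T j ^+ 2.
  by rewrite lerXn2r ?nnegrE ?(ltW (Tpos _)) // Tle //; clear -kk jj m2 ax; lia.
have Tk : T k ^+ 2 <= T (b * x) ^+ 2.
  by rewrite lerXn2r ?nnegrE ?(ltW (Tpos _)) // Tle //; clear -kk jj m2 ax; lia.
have jR : (a * x)%:R - m%:R <= j%:R :> R by rewrite lerBlDr -natrD ler_nat; clear -jj m2 ax; lia.
have kR : k%:R <= (b * x)%:R + m%:R :> R by rewrite -natrD ler_nat; clear -kk; lia.
rewrite !natrM in jR kR.
move: H; rewrite /tau => H.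
have p1 := sqr_ge0 (T (a * x)); have p2 := sqr_ge0 (T (b * x)).
set ta := T (a * x) ^+ 2 in p1 Tj *; set tb := T (b * x) ^+ 2 in p2 Tk *.
set tj := T j ^+ 2 in H Tj; set tk := T k ^+ 2 in H Tk.
set A := a%:R in aR jR *; set B := b%:R in bR kR *; set M := m%:R in mR jR kR; set Y := x%:R in xR mR jR kR.
set Q := N%:R in NR mR xR.
have Q2 : 2 <= Q by rewrite /Q /N ler_nat.
have M0 : 0 <= M by rewrite ler0n.
have Y0 : 0 < Y by lra.
have k0 : 0 <= k%:R :> R := ler0n _ _.
have j0 : 0 <= j%:R :> R := ler0n _ _.
have l1 : ta * (2 * (A * Y - M) + 1) <= tj * (2 * j%:R + 1).
  by apply: ler_pM => //; nra.
have l2 : tk * (2 * k%:R + 1) <= tb * (2 * (B * Y + M) + 1).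
  by apply: ler_pM; rewrite ?sqr_ge0 //; lra.
have l3 : ta * (2 * (A * Y - M) + 1) <= (1 + d) * (tb * (2 * (B * Y + M) + 1)).
  by apply: le_trans l1 _; apply: le_trans H _; rewrite ler_wpM2l //; lra.
have l4 : 2 * A * Y * (Q - 1) <= (2 * (A * Y - M) + 1) * Q by nra.
have l5 : (2 * (B * Y + M) + 1) * Q <= 2 * B * Y * (Q + 2) by nra.
have l6 : 2 * Y * (A * ta * (Q - 1)) <= 2 * Y * ((1 + d) * (B * tb) * (Q + 2)).
  rewrite (_ : 2 * Y * (A * ta * (Q - 1)) = ta * (2 * A * Y * (Q - 1))); last by ring.
  apply: le_trans (ler_wpM2l p1 l4) _; rewrite mulrA.
  apply: le_trans (ler_wpM2r _ l3) _; first lra.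
  rewrite (_ : 2 * Y * _ = (1 + d) * tb * (2 * B * Y * (Q + 2))); last by ring.
  rewrite (_ : _ * Q = (1 + d) * tb * ((2 * (B * Y + M) + 1) * Q)); last by ring.
  by rewrite ler_wpM2l // mulr_ge0 // addr_ge0 // ltW.
rewrite ler_pM2l in l6; last lra.
apply: le_trans (_ : (1 + d) ^+ 2 * (B * tb) <= _); last by rewrite ler_wpM2r // mulr_ge0 //; lra.
rewrite -(ler_pM2r (_ : 0 < Q - 1)); last lra.
apply: le_trans l6 _; rewrite (_ : (1 + d) ^+ 2 * _ * _ = (1 + d) * (B * tb) * ((1 + d) * (Q - 1))); last by ring.
rewrite ler_wpM2l //; last by lra.
by rewrite mulr_ge0 ?mulr_ge0 // ?addr_ge0 // ?ltW //; lra.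
Qed.

End Slow.

Lemma cauchy_schwarz (R : realType) (I : finType) (x : I -> R) :
  (\sum_i x i) ^+ 2 <= #|I|%:R * \sum_i x i ^+ 2.
Proof.
have [I0|I0] := posnP #|I|.
  rewrite I0 mul0r big1 ?expr0n // => i _.
  by have := card0_eq I0 i; rewrite inE.
have n0 : 0 < #|I|%:R :> R by rewrite ltr0n.
pose a := (\sum_i x i) / #|I|%:R.
have : 0 <= \sum_i (x i - a) ^+ 2 by apply: sumr_ge0 => i _; exact: sqr_ge0.
have -> : \sum_i (x i - a) ^+ 2 = \sum_i x i ^+ 2 - 2 * a * (\sum_i x i) + #|I|%:R * a ^+ 2.
  rewrite mulr_sumr -sumrB (_ : #|I|%:R * a ^+ 2 = \sum_(i : I) a ^+ 2); last first.
    by rewrite sumr_const mulr_natl.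
  by rewrite -big_split /=; apply: eq_bigr => i _; ring.
rewrite (_ : \sum_i x i = #|I|%:R * a); last by rewrite /a mulrCA divff ?mulr1 ?gt_eqF.
set s := \sum_i _; set n := #|I|%:R in n0 *; move=> H.
have : n * (n * a ^+ 2) <= n * s by rewrite ler_pM2l //; nra.
by rewrite (_ : n * (n * a ^+ 2) = (n * a) ^+ 2); last by ring.
Qed.

(** * Lower bound and logarithmic upper bound for the tail *)

Section Bounds.
Variables (R : realType) (T : nat -> R).
Local Notation hb := (hb R).
Local Notation kap := (kap R).
Local Notation cond := (cond R).
Hypotheses (Tpos : forall k, 0 < T k) (Tle : forall m n, (m <= n)%N -> T n <= T m).
Hypothesis Tsup : forall k I, \sum_(i < I) kap (k + i).+2 * T i.+1 <= T k.
Hypothesis T0 : T 0 <= 1.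

Lemma Tsup1 k J (S : nat -> R) : S 0%N = 0 -> (forall j, S j.+1 <= T j.+1) ->
  \sum_(j < J) kap (k + j).+1 * S j <= T k.
Proof.
move=> S0 SS; case: J => [|J]; first by rewrite big_ord0 ltW.
rewrite big_ord_recl /= S0 mulr0 add0r; apply: le_trans (Tsup k J).
by apply: ler_sum => i _; rewrite /bump /= add1n addnS ler_wpM2l ?SS // ltW // kap_gt0.
Qed.

Lemma hb1 : hb 1 = 2^-1.
Proof. by rewrite hbS hb0 !mulr0 !add0r !mul1r. Qed.

Lemma plateau p1 e : 0 < e -> exists chi N,
  [/\ forall k, 0 <= chi k <= 1, forall k, (blk k <= p1)%N -> chi k = 1,
      forall k, (N <= k)%N -> chi k = 0 & forall J, energy J chi <= e :> R].
Proof.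
move=> e0; have [D HD] := cutoff p1 e0; have [chi [N [c0 c1 cN cE _]]] := HD 0%N.
by exists chi, N; split=> // k kp; apply: c1; rewrite /ndist; lia.
Qed.

(* With S = min(T, m h), Barta with cutoffs of vanishing energy forces S to be
   proportional to h. *)
Lemma T_lower k : (0 < k)%N -> T 1 / 4 * hb k <= T k.
Proof.
(* [S] takes the values [m] and [m / 2] at sites 0 and 1. For superharmonicity at [j >= 2] the term
   [kap j.+2 * T 1] of [Tsup] must pay for both; as [kap j.+1 <= 3 * kap j.+2], this asks for
   [7/2 m <= T 1]. *)
pose m := T 1 / 4; have m0 : 0 < m by rewrite divr_gt0.
pose S k := if (k <= 1)%N then m * hb k else Num.min (T k) (m * hb k).
have Sm j : S j <= m * hb j by rewrite /S; case: ifP => // _; rewrite ge_min lexx orbT.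
have ST j : S j.+2 <= T j.+2 by rewrite /S /= ge_min lexx.
have Spos j : 0 < S j by rewrite /S; case: ifP => _; rewrite ?lt_min ?Tpos mulr_gt0 ?hb_gt0.
have hsup j J : \sum_(i < J) kap (j + i).+1 * S i <= m * hb j.
  apply: le_trans (_ : m * \sum_(i < J) kap (j + i).+1 * hb i <= _); last first.
    by rewrite ler_pM2l ?kap_hb_le.
  rewrite mulr_sumr; apply: ler_sum => i _.
  by rewrite mulrCA ler_wpM2l // ltW // kap_gt0.
have Ssup j J : \sum_(i < J) kap (j + i).+1 * S i <= S j.
  case: (leqP j 1) => j1; first by rewrite [S j]/S j1; exact: hsup.
  rewrite [S j]/S leqNgt j1 /= le_min hsup andbT.
  apply: le_trans (_ : \sum_(i < J.+2) kap (j + i).+1 * S i <= _).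
    rewrite -addn2 big_split_ord /= lerDl sumr_ge0 // => i _.
    by rewrite mulr_ge0 ?ltW ?kap_gt0.
  apply: le_trans (Tsup j J.+1).
  rewrite big_ord_recl big_ord_recl big_ord_recl /= /bump /= !add1n addn0 addrA.
  rewrite lerD //; last first.
    by apply: ler_sum => i _; rewrite !add1n !addnS ler_wpM2l ?ST // ltW // kap_gt0.
  rewrite /S /= hb0 hb1 addn1.
  have k12 : kap j.+1 <= 3 * kap j.+2.
    rewrite !kapE mulrCA ler_wpM2l ?(ltW (kap0_gt0 R)) // ler_pdivlMr; last first.
      by have := ler0n R j.+1; lra.
    rewrite mulrC ler_pdivrMr -?[j.+1%:R]natr1; have := ler0n R j; lra.
  have := kap_gt0 R j.+1; rewrite /m; have := Tpos 1; nra.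
move=> k0.
suff SE : S k = m * hb k.
  case: (leqP k 1) => k1.
    have -> : k = 1%N by lia.
    rewrite -/m hb1 /m; have := Tpos 1; lra.
  by move: SE; rewrite /S leqNgt k1 /= => <-; rewrite ge_min lexx.
have S00 : S 0%N = m by rewrite /S /= hb0 mulr1.
pose Q := kap k.+1 * (S 0%N * S k) * (hb 0%N / S 0%N - hb k / S k) ^+ 2.
have Q0 : Q <= 0.
  apply/ler_addgt0Pr => e e0; rewrite add0r.
  have [chi [N [c0 c1 cN cE]]] := plateau (blk k) e0.
  have := @barta R S chi N k.+1 e (fun j => ltW (Spos j)) (fun j _ => Spos j) (fun j J _ => Ssup j J) cN cE.
  apply: le_trans.
  pose F i j := kap (i + j).+1 * (S i * S j) * (chi i * hb i / S i - chi j * hb j / S j) ^+ 2.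
  have F0 i j : 0 <= F i j.
    by rewrite mulr_ge0 ?sqr_ge0 // mulr_ge0 ?mulr_ge0 ?ltW ?kap_gt0.
  have := @sum_window2 R F k.+1 0 k 1 1 F0.
  rewrite !big_ord1 addn0 add0n addn1 => /(_ _ _) H.
  apply: le_trans (H (ltn0Sn k) (leqnn _)).
  by rewrite /F /= addn0 add0n (c1 0%N) ?blk_le // (c1 k) // !mul1r.
have sq : (hb 0%N / S 0%N - hb k / S k) ^+ 2 <= 0.
  by move: Q0; rewrite /Q pmulr_rle0 // mulr_gt0 ?kap_gt0 // mulr_gt0.
have := sqr_ge0 (hb 0%N / S 0%N - hb k / S k); move=> sq0.
have /eqP : (hb 0%N / S 0%N - hb k / S k) ^+ 2 == 0 by rewrite eq_le sq sq0.
move/eqP; rewrite sqrf_eq0 subr_eq0 hb0 S00 => /eqP H.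
by apply: (mulfI (_ : m^-1 != 0)); rewrite ?invr_eq0 ?gt_eqF // mulKf ?gt_eqF // -div1r H divfK // gt_eqF.
Qed.

Definition bav (u : nat -> R) p := (\sum_(i < 2 ^ p) u (2 ^ p - 1 + i)%N) / 2 ^+ p.

Definition bdir (u : nat -> R) p := \sum_(i < 2 ^ p) \sum_(j < 2 ^ p.+1)
   cond (2 ^ p - 1 + i) (2 ^ p.+1 - 1 + j) * (u (2 ^ p - 1 + i)%N - u (2 ^ p.+1 - 1 + j)%N) ^+ 2.

(** Cauchy-Schwarz over all pairs in consecutive blocks. There are [2 * 4^p] pairs, and [cond_ge] at
    [2^(p+2)] gives conductance at least [kap0 / (192 * 4^p)]; the quotient accounts for 96. *)
Lemma bav_step u p : (bav u p - bav u p.+1) ^+ 2 <= 96 / kap0 R * bdir u p.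
Proof.
have K0 := kap0_gt0 R.
have p20 : 0 < 2 ^+ p :> R by rewrite exprn_gt0.
have p21 : 0 < 2 ^+ p.+1 :> R by rewrite exprn_gt0.
pose d (ij : 'I_(2 ^ p) * 'I_(2 ^ p.+1)) := u (2 ^ p - 1 + ij.1)%N - u (2 ^ p.+1 - 1 + ij.2)%N.
have -> : bav u p - bav u p.+1 = (\sum_ij d ij) / (2 ^+ p * 2 ^+ p.+1).
  rewrite (eq_bigr (fun ij : 'I_(2 ^ p) * 'I_(2 ^ p.+1) => d (ij.1, ij.2))); last by case.
  rewrite -(pair_bigA _ (fun i j => d (i, j))) /d /=.
  under eq_bigr => i _ do rewrite sumrB sumr_const card_ord.
  rewrite sumrB sumr_const card_ord /bav.
  set X := \sum_(j < 2 ^ p.+1) _.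
  rewrite -[X *+ _]mulr_natr natrX.
  rewrite sumrMnl; set Y := \sum_(i < 2 ^ p) _; rewrite -[Y *+ _]mulr_natr natrX.
  by field; rewrite !gt_eqF.
rewrite expr_div_n ler_pdivrMr; last by rewrite exprn_gt0 // mulr_gt0.
apply: le_trans (cauchy_schwarz d) _.
rewrite card_prod !card_ord natrM !natrX.
rewrite (eq_bigr (fun ij : 'I_(2 ^ p) * 'I_(2 ^ p.+1) => d (ij.1, ij.2) ^+ 2)); last by case.
rewrite -(pair_bigA _ (fun i j => d (i, j) ^+ 2)) /d /=.
have c2 (i : 'I_(2 ^ p)) (j : 'I_(2 ^ p.+1)) :
    1 <= 96 / kap0 R * (2 ^+ p * 2 ^+ p.+1) * cond (2 ^ p - 1 + i) (2 ^ p.+1 - 1 + j).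
  have [ii jj] := (ltn_ord i, ltn_ord j).
  have e1 : (2 ^ p.+1 = 2 * 2 ^ p)%N by rewrite expnS.
  have e2 : (2 ^ p.+2 = 4 * 2 ^ p)%N by rewrite !expnS; lia.
  have H : kap0 R / (12 * (2 ^ p.+2)%:R ^+ 2) <= cond (2 ^ p - 1 + i) (2 ^ p.+1 - 1 + j).
    by apply: cond_ge; rewrite ?expn_gt0 //; lia.
  apply: le_trans (ler_wpM2l _ H); last first.
    by apply: mulr_ge0; [apply: divr_ge0 => //; exact: ltW|rewrite ltW // mulr_gt0].
  rewrite natrX !exprS; set z := 2 ^+ p in p20 *.
  by rewrite le_eqVlt; apply/orP; left; apply/eqP; field; rewrite !gt_eqF.
set P := 2 ^+ p * 2 ^+ p.+1 in c2 *.
have P0 : 0 < P by rewrite mulr_gt0.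
have main : \sum_(i < 2 ^ p) \sum_(j < 2 ^ p.+1) (u (2 ^ p - 1 + i)%N - u (2 ^ p.+1 - 1 + j)%N) ^+ 2
    <= 96 / kap0 R * P * bdir u p.
  rewrite /bdir mulr_sumr; apply: ler_sum => i _; rewrite mulr_sumr; apply: ler_sum => j _.
  by rewrite mulrA ler_peMl ?sqr_ge0.
rewrite (_ : _ * _ * P ^+ 2 = P * (96 / kap0 R * P * bdir u p)); last by ring.
by rewrite ler_wpM2l // ltW.
Qed.

(** [M] bounds [T / hb] from below on block [n]: [T] is taken beyond its right end, [hb] at its left
    end. Capped at [M] and killed at 0, [T / hb] has block averages rising from 0 to [M] in [n]
    steps with energy at most [3 M]; Cauchy-Schwarz gives [M^2 <= C n M]. *)
Lemma T_upper : exists C, 0 < C /\ forall n, (0 < n)%N ->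
  T (2 ^ n.+1) <= C * n%:R * hb (2 ^ n - 1).
Proof.
have K0 := kap0_gt0 R.
(* 288 is 96 from [bav_step] times 3: the flux at the origin enters [caccioppoli] as [2 M], and a
   cutoff of energy [1 / M] adds [M]. *)
exists (288 / kap0 R); split; first by rewrite divr_gt0.
move=> n n0; pose M := T (2 ^ n.+1) / hb (2 ^ n - 1).
have hn := hb_gt0 R (2 ^ n - 1).
have M0 : 0 < M by rewrite divr_gt0.
rewrite -ler_pdivrMr // -/M.
pose u (k : nat) : R := if k == 0%N then 0 else Num.min (T k / hb k) M.
have u0 k : 0 <= u k.
  rewrite /u; case: eqP => // _; rewrite le_min (ltW M0) andbT divr_ge0 ?hb_ge0 //; exact: ltW.
have uM k : u k <= M by rewrite /u; case: eqP => [_|_]; rewrite ?ge_min ?lexx ?orbT // ltW.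
have uT k : hb k.+1 * u k.+1 <= T k.+1.
  by rewrite /u /= mulrC -ler_pdivlMr ?hb_gt0 // ge_min lexx.
have iM0 : 0 < M^-1 by rewrite invr_gt0.
have [chi [N [c0 c1 cN cE]]] := plateau n iM0.
have hu k J : \sum_(j < J) kap (k + j).+1 * (hb j * u j) <= T k.
  by apply: (@Tsup1 k J (fun j => hb j * u j)) => //; rewrite /u /= mulr0.
pose v (k : nat) := M - u k.
have vM k : 0 <= v k <= M by rewrite /v subr_ge0 uM gerBl u0.
have sub k J : (0 < k)%N -> 0 <= (M - v k) * leak R J k + \sum_(j < J) cond k j * (v j - v k).
  move=> k0; rewrite /v subKr.
  have -> : \sum_(j < J) cond k j * (M - u j - (M - u k)) =
      u k * (\sum_(j < J) cond k j) - hb k * \sum_(j < J) kap (k + j).+1 * (hb j * u j).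
    rewrite !mulr_sumr -sumrB; apply: eq_bigr => j _; rewrite /cond; ring.
  rewrite /leak.
  set X := \sum_(j < J) cond k j; set Y := \sum_(j < J) _.
  suff : hb k * Y <= u k * hb k ^+ 2 by lra.
  have hk := hb_gt0 R k.
  suff Yu : Y <= u k * hb k.
    by rewrite expr2 [leRHS]mulrCA ler_wpM2l // ltW.
  have uE : u k = Num.min (T k / hb k) M by rewrite /u gtn_eqF.
  have [Mk|Mk] := leP (T k / hb k) M.
    by rewrite uE (min_idPl Mk) divfK ?gt_eqF // /Y hu.
  rewrite uE (min_idPr (ltW Mk)).
  apply: le_trans (_ : M * \sum_(j < J) kap (k + j).+1 * hb j <= _).
    rewrite mulr_sumr; apply: ler_sum => j _.
    rewrite [leRHS]mulrCA ler_wpM2l //; first by rewrite ltW // kap_gt0.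
    by rewrite [leRHS]mulrC ler_wpM2l ?hb_ge0.
  by rewrite ler_wpM2l ?(ltW M0) // kap_hb_le.
(* The flux out of the origin is a kernel sum bounded by [T 0 <= 1]; it is multiplied by
   [v 0 = M]. *)
have HF J : chi 0%N ^+ 2 * v 0%N * \sum_(j < J) cond 0 j * (v 0%N - v j) <= M.
  have -> : \sum_(j < J) cond 0 j * (v 0%N - v j) = \sum_(j < J) kap (0 + j).+1 * (hb j * u j).
    apply: eq_bigr => j _; rewrite /cond /v hb0 /u /=; ring.
  rewrite /v /u /= subr0 c1 ?expr1n ?mul1r; last by rewrite /blk trunc_log1.
  by rewrite ler_piMr ?(ltW M0) //; apply: le_trans (hu 0%N J) T0.
have cac := @caccioppoli R v chi M N (2 ^ n.+1 - 1) M^-1 M M0 vM cN sub HF cE.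
have {}cac : \sum_(k < 2 ^ n.+1 - 1) \sum_(j < 2 ^ n.+1 - 1) cond k j * (u k - u j) ^+ 2 <= 3 * M.
  apply: le_trans (le_trans _ cac) _; last first.
    by rewrite expr2 mulfK ?gt_eqF //; lra.
  apply: ler_sum => k _; apply: ler_sum => j _.
  have bn (i : 'I_(2 ^ n.+1 - 1)) : (blk i <= n)%N.
    by rewrite -ltnS; apply: blk_lt; have := ltn_ord i; lia.
  rewrite !c1 ?bn // !mul1r /v (_ : M - u k - (M - u j) = - (u k - u j)); last by ring.
  by rewrite sqrrN.
pose av := bav u.
have av0 : av 0%N = 0 by rewrite /av /bav big_ord1 /= /u /= mul0r.
have avn : av n = M.
  rewrite /av /bav (eq_bigr (fun=> M)) => [|i _].
    by rewrite sumr_const card_ord -[M *+ _]mulr_natr natrX mulfK // gt_eqF // exprn_gt0.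
  have n2 : (2 <= 2 ^ n)%N by rewrite -{1}(expn1 2) leq_exp2l.
  rewrite /u gtn_eqF; last by lia.
  apply/min_idPr; rewrite ler_pdivlMr ?hb_gt0 //.
  apply: le_trans (_ : T (2 ^ n.+1) <= _).
    by rewrite /M mulrAC ler_pdivrMr // ler_wpM2l ?(ltW (Tpos _)) // hb_le // leq_addr.
  by apply: Tle; have := ltn_ord i; rewrite expnS; lia.
have tele k : \sum_(p < k) (av p - av p.+1) = av 0%N - av k.
  by elim: k => [|k IH]; rewrite ?big_ord0 ?subrr // big_ord_recr /= IH addrA subrK.
have := cauchy_schwarz (fun p : 'I_n => av p - av p.+1).
rewrite tele av0 avn sub0r sqrrN card_ord.
have bd : \sum_(p < n) bdir u p <= 3 * M.
  apply: le_trans cac.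
  pose G k j := cond k j * (u k - u j) ^+ 2.
  have G0 k j : 0 <= G k j by rewrite mulr_ge0 ?cond_ge0 ?sqr_ge0.
  rewrite (sum_blocks (fun k => \sum_(j < 2 ^ n.+1 - 1) G k j)).
  rewrite big_ord_recr /=; apply: le_trans (_ : \sum_(p < n) \sum_(i < 2 ^ p) \sum_(j < 2 ^ n.+1 - 1) G (2 ^ p - 1 + i)%N j <= _).
    apply: ler_sum => p _; apply: ler_sum => i _; apply: (sum_window (F := G (2 ^ p - 1 + i)%N)) => //.
    have : (2 ^ p.+2 <= 2 ^ n.+1)%N by rewrite leq_exp2l // !ltnS.
    by rewrite !expnS; lia.
  by rewrite lerDl; apply: sumr_ge0 => i _; apply: sumr_ge0.
move=> cs.
have : M ^+ 2 <= n%:R * (96 / kap0 R * (3 * M)).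
  apply: le_trans cs _; rewrite ler_wpM2l //.
  apply: le_trans (_ : 96 / kap0 R * \sum_(p < n) bdir u p <= _).
    by rewrite mulr_sumr; apply: ler_sum => p _; exact: bav_step.
  by apply: ler_wpM2l => //; apply: divr_ge0 => //; exact: ltW.
rewrite (_ : n%:R * _ = M * (288 / kap0 R * n%:R)); last by field; rewrite gt_eqF.
by rewrite expr2 ler_pM2l.
Qed.

End Bounds.

(** * Regular variation of the partition functions *)

Section Dd.
Variable R : realType.
Local Notation hb := (hb R).
Local Notation kap := (kap R).
Local Notation dd := (dd R).

Lemma dd_hb m : dd m = 3 / 4 * hb m / ((m%:R + 1) * (m%:R + 2)).
Proof. by rewrite ddE alE; have m0 := ler0n R m; field; rewrite !gt_eqF //; lra. Qed.

(** Domination by the kernel, with a prefactor depending on [p] alone, lets [Tsup] bound the whole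
    series for [A p.+1] by [T p] in [A_upper]. *)
Lemma dd_le_kap p i : dd (p + i) <= 3 / (4 * kap0 R) * hb p / (p%:R + 1) * kap (p + i).+2.
Proof.
have K0 := kap0_gt0 R; rewrite dd_hb kapE -[(p + i).+1%:R]natr1 natrD.
have p0 := ler0n R p; have i0 := ler0n R i; have h0 := hb_ge0 R p.
have hh : hb (p + i) <= hb p by apply: hb_le; rewrite leq_addr.
set x := p%:R in p0 *; set y := i%:R in i0 *.
rewrite (_ : 3 / (4 * kap0 R) * hb p / (x + 1) * (kap0 R / (x + y + 1 + 2^-1)) =
  3 / 4 * (hb p * ((x + 1) * (x + y + 1 + 2^-1))^-1)); last first.
  by field; rewrite !gt_eqF //; lra.
rewrite -mulrA ler_wpM2l //; apply: ler_pM; rewrite ?hb_ge0 ?invr_ge0 ?mulr_ge0 //; try lra.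
by rewrite lef_pV2 ?posrE ?mulr_gt0; [apply: ler_pM|..]; lra.
Qed.

Lemma dd_sq m : dd m ^+ 2 = 9 / 16 * gs R m / ((2 * m%:R + 1) * ((m%:R + 1) * (m%:R + 2)) ^+ 2).
Proof. by rewrite dd_hb /gs; have m0 := ler0n R m; field; rewrite !gt_eqF //; lra. Qed.

Definition ddq (y : R) := (2 * y + 1) * ((y + 1) * (y + 2)) ^+ 2.

Lemma ddq_ge y : 0 <= y -> 2 * y ^+ 5 <= ddq y.
Proof.
move=> y0; rewrite /ddq (_ : 2 * y ^+ 5 = (2 * y) * (y * y) ^+ 2); last by ring.
have sq0 : 0 <= y * y by rewrite mulr_ge0.
apply: ler_pM; rewrite ?exprn_ge0 //; try lra.
by apply: lerXn2r; rewrite ?nnegrE //; [apply: mulr_ge0|apply: ler_pM]; lra.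
Qed.

Lemma ddq_le y d : 0 < y -> 2 <= d * y -> 0 < d -> ddq y <= (1 + d) ^+ 5 * (2 * y ^+ 5).
Proof.
move=> y0 dy d0; rewrite /ddq.
have p : 0 <= (y + 1) * (y + 2) by apply: mulr_ge0; lra.
rewrite (_ : _ * (2 * y ^+ 5) = (2 * (y + d * y)) * ((y + d * y) * (y + d * y)) ^+ 2); last by ring.
apply: ler_pM; rewrite ?exprn_ge0 //; try lra.
by apply: lerXn2r; rewrite ?nnegrE //; [apply: mulr_ge0|apply: ler_pM]; lra.
Qed.

Lemma dd_slow a b (e : R) : (0 < a)%N -> (0 < b)%N -> 0 < e -> exists X, forall x, (X <= x)%N ->
  a%:R ^+ 5 * dd (a * x) ^+ 2 <= (1 + e) * (b%:R ^+ 5 * dd (b * x) ^+ 2).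
Proof.
move=> a0 b0 e0; have [d [d0 Hd]] := small_pow 6 e0.
have [X1 HX1] := gs_ratio d0.
have [X2 HX2] := archi_nat (2 / d).
exists (maxn X1 X2).+1 => x xX.
have aR : 0 < a%:R :> R by rewrite ltr0n.
have bR : 1 <= b%:R :> R by rewrite ler1n.
have xR : 2 <= d * x%:R.
  rewrite mulrC -ler_pdivrMr //; apply: le_trans (ltW HX2) _; rewrite ler_nat; lia.
have x0 : 0 < x%:R :> R by rewrite ltr0n; lia.
have g : gs R (a * x) <= (1 + d) * gs R (b * x).
  by apply: HX1; apply: leq_trans (_ : x <= _)%N; rewrite ?leq_pmull //; lia.
rewrite !dd_sq -!/(ddq _) !natrM.
have ga := gs_ge R (a * x); have gb := gs_ge R (b * x).
set A := a%:R in aR *; set B := b%:R in bR *; set z := x%:R in xR x0 *.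
set u := gs R (a * x) in g ga *; set v := gs R (b * x) in g gb *.
have Az : 0 < A * z by rewrite mulr_gt0.
have Bz : 0 < B * z by rewrite mulr_gt0 //; lra.
have dBz : 2 <= d * (B * z) by rewrite mulrCA; nra.
have qA := ddq_ge (ltW Az); have qB := ddq_le Bz dBz d0.
have qA0 : 0 < 2 * (A * z) ^+ 5 by rewrite mulr_gt0 ?exprn_gt0.
have qB0 : 0 < ddq (B * z) by apply: lt_le_trans (ddq_ge (ltW Bz)); rewrite mulr_gt0 ?exprn_gt0.
apply: le_trans (_ : A ^+ 5 * (9 / 16 * u / (2 * (A * z) ^+ 5)) <= _).
  apply: ler_wpM2l; first by rewrite exprn_ge0 ?ltW.
  by apply: ler_wpM2l; [lra|rewrite lef_pV2 ?posrE //; exact: lt_le_trans qA].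
apply: le_trans (_ : (1 + d) ^+ 6 * (B ^+ 5 * (9 / 16 * v / ddq (B * z))) <= _); last first.
  apply: ler_wpM2r => //; apply: mulr_ge0; first by rewrite exprn_ge0; lra.
  by apply: divr_ge0; [lra|exact: ltW].
rewrite (_ : A ^+ 5 * _ = 9 / 32 * u / z ^+ 5); last by field; rewrite !gt_eqF.
set Q := ddq (B * z) in qB qB0 *.
rewrite (_ : (1 + d) ^+ 6 * _ = 9 / 16 * (1 + d) ^+ 6 * B ^+ 5 * v / Q); last by ring.
rewrite ler_pdivlMr // (_ : 9 / 32 * u / z ^+ 5 * Q = 9 / 32 * (u * Q) / z ^+ 5); last by ring.
rewrite ler_pdivrMr ?exprn_gt0 //.
rewrite (_ : 9 / 16 * (1 + d) ^+ 6 * B ^+ 5 * v * z ^+ 5 = 9 / 32 * ((1 + d) * v * ((1 + d) ^+ 5 * (2 * (B * z) ^+ 5)))); last by field.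
by rewrite ler_wpM2l //; apply: ler_pM => //; [lra|exact: ltW].
Qed.

End Dd.

(** * Transfer from the tail to [A] along integer multiples *)

Section Asymp.
Variables (R : realType) (T A : nat -> R).
Local Notation hb := (hb R).
Local Notation kap := (kap R).
Local Notation dd := (dd R).
Hypotheses (Tpos : forall k, 0 < T k) (Tle : forall m n, (m <= n)%N -> T n <= T m).
Hypothesis Tsup : forall k I, \sum_(i < I) kap (k + i).+2 * T i.+1 <= T k.
Hypothesis T0 : T 0 <= 1.
Hypothesis AT : forall p, absum (fun i => T i.+1 * dd (p + i)) /\
  A p.+1 = sm (fun i => T i.+1 * dd (p + i)).

Let t0 p i : 0 <= T i.+1 * dd (p + i).
Proof. by rewrite mulr_ge0 ?(ltW (Tpos _)) // ltW // dd_gt0. Qed.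

Lemma A_le p q : (p <= q)%N -> A q.+1 <= A p.+1.
Proof.
move=> pq; have [ap ->] := AT p; have [aq ->] := AT q; apply: le_sm => // i.
by rewrite ler_wpM2l ?(ltW (Tpos _)) // dd_le // leq_add2r.
Qed.

Lemma A_ge n p : n%:R * T n * dd (p + n) <= A p.+1.
Proof.
have [ap ->] := AT p; apply: le_trans (sm_ge n ap (t0 p)).
rewrite -mulrA mulr_natl -[X in _ *+ X](card_ord n) -sumr_const; apply: ler_sum => i _.
apply: ler_pM; rewrite ?(ltW (Tpos _)) ?(ltW (dd_gt0 _ _)) ?Tle //.
by apply: dd_le; rewrite leq_add2l ltnW.
Qed.

Lemma A_upper p : A p.+1 <= 3 / (4 * kap0 R) * hb p / (p%:R + 1) * T p.
Proof.
have [ap ->] := AT p; apply: sm_le => // n.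
have K0 := kap0_gt0 R; have p0 := ler0n R p; have h0 := hb_ge0 R p.
have c0 : 0 <= 3 / (4 * kap0 R) * hb p / (p%:R + 1).
  by apply: divr_ge0; [apply: mulr_ge0 => //; apply: divr_ge0 => //; apply: mulr_ge0 => //; exact: ltW|lra].
apply: le_trans (ler_wpM2l c0 (Tsup p n)); rewrite mulr_sumr; apply: ler_sum => i _.
by rewrite mulrA mulrC; apply: ler_wpM2r; [exact: ltW|exact: dd_le_kap].
Qed.

(** By [A_ge], [A p.+1 >= p T_p dd (2p)], and [p T_p] grows at least like [sqrt p] by [T_lower].
    Thus any fixed number of terms of the series for [A] is negligible. *)
Lemma dd_negl (e : R) : 0 < e -> exists X, forall p, (X <= p)%N -> dd p <= e * A p.+1.
Proof.
move=> e0; have [X1 HX1] := @dd_slow R 1 2 1 isT isT ltr01.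
pose m := T 1 / 4; have m0 : 0 < m by rewrite divr_gt0.
have [X2 HX2] := archi_nat ((16 / (e * m)) ^+ 2).
exists (maxn X1 X2).+1 => p pX.
have p0 : (0 < p)%N by lia.
have := HX1 p ltac:(lia); rewrite mul1n expr1n mul1r => H.
(* From [dd_slow] with multipliers 1, 2 and error 1: [dd p ^+ 2 <= 2 * 2^5 * dd (2p) ^+ 2], and
   [64 = 8^2]. *)
have d8 : dd p <= 8 * dd (2 * p).
  rewrite -(ler_pXn2r (ltn0Sn 1)) ?nnegrE ?mulr_ge0 ?(ltW (dd_gt0 _ _)) // exprMn.
  by apply: le_trans H _; rewrite mulrA ler_wpM2r ?sqr_ge0 //; lra.
have Ap : p%:R * T p * dd (2 * p) <= A p.+1 by rewrite mul2n -addnn; exact: A_ge.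
have Tp := @T_lower R T Tpos Tsup T0 p p0; rewrite -/m in Tp.
have pR : 0 < p%:R :> R by rewrite ltr0n.
have hp2 : p%:R <= (2 * (p%:R * hb p)) ^+ 2.
  have := hb_sqr_ge R p.-1; rewrite prednK // => h.
  rewrite (_ : _ ^+ 2 = p%:R * (hb p ^+ 2 * (4 * p%:R))); last by ring.
  by rewrite ler_peMr // ltW.
have hp : 8 / (e * m) <= p%:R * hb p.
  rewrite -(ler_pM2l (_ : 0 < 2)) // -(ler_pXn2r (ltn0Sn 1)) ?nnegrE.
  - apply: le_trans hp2; rewrite (_ : 2 * (8 / (e * m)) = 16 / (e * m)); last by field; rewrite !gt_eqF.
    by apply: le_trans (ltW HX2) _; rewrite ler_nat; lia.
  - by apply: mulr_ge0 => //; apply: divr_ge0 => //; rewrite mulr_ge0 // ltW.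
  - by rewrite !mulr_ge0 ?hb_ge0 // ltW.
rewrite ler_pdivrMr ?mulr_gt0 // in hp.
have dp := dd_gt0 R (2 * p).
have : 8 <= e * (p%:R * T p).
  apply: le_trans hp _; rewrite mulrC -mulrA ler_wpM2l ?(ltW e0) // mulrCA.
  by rewrite ler_wpM2l ?ler0n.
move=> h8; apply: le_trans d8 _; apply: le_trans (_ : e * (p%:R * T p) * dd (2 * p) <= _).
  by rewrite ler_wpM2r // ltW.
by rewrite -mulrA ler_wpM2l // ltW.
Qed.

(* T and dd vary regularly with exponents -1/2 and -5/2 along multiples. *)
Lemma Tdd_slow a b (e : R) : (0 < a)%N -> (0 < b)%N -> 0 < e -> exists X, forall i n, (X <= i)%N -> (X <= n)%N ->
  a%:R ^+ 3 * (T (a * i) * dd (a * n)) <= (1 + e) * (b%:R ^+ 3 * (T (b * i) * dd (b * n))).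
Proof.
move=> a0 b0 e0.
have [X1 HX1] := @T_slow R T Tpos Tle Tsup a b e a0 b0 e0.
have [X2 HX2] := @dd_slow R a b e a0 b0 e0.
exists (maxn X1 X2) => i n iX nX.
have := HX1 i ltac:(lia); have := HX2 n ltac:(lia) => h1 h2.
have aR := ler0n R a; have bR := ler0n R b.
have tt k l : 0 <= T k * dd l by rewrite mulr_ge0 ?(ltW (Tpos _)) // ltW // dd_gt0.
have e1 : 0 <= 1 + e by lra.
have p3 k l c : 0 <= (c%:R : R) ^+ 3 * (T k * dd l) by apply: mulr_ge0; [rewrite exprn_ge0|exact: tt].
rewrite -(ler_pXn2r (ltn0Sn 1)) ?nnegrE; [|exact: p3|by apply: mulr_ge0].
set s := T (a * i) in h2 *; set r := T (b * i) in h2 *; set u := dd _ in h1 *; set v := dd (b * n) in h1 *.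
rewrite (_ : (a%:R ^+ 3 * (s * u)) ^+ 2 = (a%:R * s ^+ 2) * (a%:R ^+ 5 * u ^+ 2)); last by ring.
rewrite (_ : (_ * _) ^+ 2 = ((1 + e) * (b%:R * r ^+ 2)) * ((1 + e) * (b%:R ^+ 5 * v ^+ 2))); last by ring.
by apply: ler_pM => //; apply: mulr_ge0; rewrite ?sqr_ge0 // exprn_ge0.
Qed.

Lemma sum_group (F : nat -> R) mu K :
  \sum_(i < mu * K) F i = \sum_(k < K) \sum_(r < mu) F (mu * k + r)%N.
Proof.
elim: K => [|K IH]; first by rewrite muln0 !big_ord0.
by rewrite mulnS addnC big_split_ord big_ord_recr /= IH.
Qed.

(** Group the series at [mu * p] into packets of length [mu]. By monotonicity a packet is at most
    [mu] times its value at the left end, which [Tdd_slow] compares with a term of the series near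
    [p]. *)
Lemma A_mul_le mu (e : R) : (0 < mu)%N -> 0 < e -> exists X, forall p, (X <= p)%N ->
  mu%:R ^+ 2 * A (mu * p).+1 <= (1 + e) * A p.+1.
Proof.
move=> m0 e0; have e2 : 0 < e / 2 by lra.
have [X HX] := Tdd_slow m0 (ltn0Sn 0) e2.
have mR : 0 < mu%:R :> R by rewrite ltr0n.
(* The first [X.+1] packets lie below the range of [Tdd_slow]; as [T <= 1], they are together at
   most [c * dd p]. *)
pose c : R := mu%:R ^+ 3 * X.+1%:R.
have c0 : 0 < c by rewrite mulr_gt0 ?exprn_gt0.
have [Y HY] := dd_negl (divr_gt0 e2 c0).
exists (maxn X Y) => p pX; have [am ->] := AT (mu * p).
have [ap apE] := AT p.+1.
rewrite -smZ //; apply: sm_le => [|n]; first exact: absumZ.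
have dp := ltW (dd_gt0 R p).
have f0 i : 0 <= mu%:R ^+ 2 * (T i.+1 * dd (mu * p + i)).
  by apply: mulr_ge0; [rewrite exprn_ge0 // ltW|exact: t0].
pose K := (X.+1 + n)%N.
have nK : (n <= mu * K)%N by apply: leq_trans (_ : 1 * K <= _)%N; rewrite ?leq_mul // mul1n leq_addl.
apply: le_trans (_ : \sum_(i < mu * K) mu%:R ^+ 2 * (T i.+1 * dd (mu * p + i)) <= _).
  by rewrite -(subnKC nK) big_split_ord /= lerDl sumr_ge0.
rewrite (sum_group (fun i => mu%:R ^+ 2 * (T i.+1 * dd (mu * p + i)))).
have gr k : \sum_(r < mu) mu%:R ^+ 2 * (T (mu * k + r).+1 * dd (mu * p + (mu * k + r))) <=
    mu%:R ^+ 3 * (T (mu * k) * dd (mu * (p + k))).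
  apply: le_trans (_ : \sum_(r < mu) mu%:R ^+ 2 * (T (mu * k) * dd (mu * (p + k))) <= _).
    apply: ler_sum => r _; apply: ler_wpM2l; first by rewrite exprn_ge0 // ltW.
    apply: ler_pM; rewrite ?(ltW (Tpos _)) ?(ltW (dd_gt0 _ _)) //; first by apply: Tle; lia.
    by apply: dd_le; rewrite mulnDr; lia.
  by rewrite sumr_const card_ord -[leLHS]mulr_natr [X in _ <= X](_ : _ = mu%:R ^+ 2 * (T (mu * k) * dd (mu * (p + k))) * mu%:R) //; ring.
apply: le_trans (ler_sum _ (fun (k : 'I_K) _ => gr k)) _.
rewrite big_split_ord /=.
have s1 : \sum_(k < X.+1) mu%:R ^+ 3 * (T (mu * k) * dd (mu * (p + k))) <= e / 2 * A p.+1.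
  apply: le_trans (_ : c * dd p <= _).
    rewrite -mulr_sumr /c -mulrA; apply: ler_wpM2l; first by rewrite exprn_ge0 // ltW.
    rewrite mulr_natl -[X in _ *+ X](card_ord X.+1) -sumr_const; apply: ler_sum => k _.
    rewrite -[leRHS]mul1r; apply: ler_pM; rewrite ?(ltW (Tpos _)) ?(ltW (dd_gt0 _ _)) //.
      by apply: le_trans T0; apply: Tle.
    by apply: dd_le; apply: leq_trans (leq_pmull _ m0); exact: leq_addr.
  have := HY p ltac:(lia); rewrite mulrAC ler_pdivlMr // mulrC //.
have s2 : \sum_(k < n) mu%:R ^+ 3 * (T (mu * (X.+1 + k)) * dd (mu * (p + (X.+1 + k)))) <= (1 + e / 2) * A p.+1.
  apply: le_trans (_ : (1 + e / 2) * A p.+2 <= _); last first.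
    by apply: ler_wpM2l; [lra|exact: A_le].
  rewrite apE; apply: le_trans (_ : (1 + e / 2) * \sum_(j < X + n) (T j.+1 * dd (p.+1 + j)) <= _); last first.
    by apply: ler_wpM2l; [lra|exact: sm_ge].
  rewrite mulr_sumr big_split_ord /= -[leLHS]add0r lerD //.
    by apply: sumr_ge0 => i _; apply: mulr_ge0; [lra|exact: t0].
  apply: ler_sum => k _.
  have := HX (X.+1 + k)%N (p + (X.+1 + k))%N ltac:(lia) ltac:(lia).
  by rewrite expr1n !mul1n mul1r !addSn addnS.
apply: le_trans (lerD s1 s2) _; lra.
Qed.

(** The packets are now bounded from below by their right ends, which shifts the index to [p.+2];
    the early terms leave the error [e * A p.+1]. *)
Lemma A_mul_ge mu (e : R) : (0 < mu)%N -> 0 < e -> exists X, forall p, (X <= p)%N ->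
  A p.+2 <= (1 + e) * (mu%:R ^+ 2 * A (mu * p).+1) + e * A p.+1.
Proof.
move=> m0 e0.
have [X HX] := Tdd_slow (ltn0Sn 0) m0 e0.
have mR : 0 < mu%:R :> R by rewrite ltr0n.
have [Y HY] := dd_negl (divr_gt0 e0 (ltr0Sn R X)).
exists (maxn X Y) => p pX; have [am amE] := AT (mu * p).
have [ap ->] := AT p.+1.
apply: sm_le => // n.
apply: le_trans (_ : \sum_(k < X + n) T k.+1 * dd (p.+1 + k) <= _).
  by rewrite addnC big_split_ord /= lerDl sumr_ge0 // => i _; exact: t0.
rewrite big_split_ord /= addrC lerD //; last first.
  apply: le_trans (_ : X.+1%:R * dd p <= _).
    apply: le_trans (_ : X%:R * dd p <= _); last by apply: ler_wpM2r; [exact/ltW/dd_gt0|rewrite ler_nat].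
    rewrite mulr_natl -[X in _ *+ X](card_ord X) -sumr_const; apply: ler_sum => k _.
    rewrite -[leRHS]mul1r; apply: ler_pM; rewrite ?(ltW (Tpos _)) ?(ltW (dd_gt0 _ _)) //.
      by apply: le_trans T0; apply: Tle.
    by apply: dd_le; lia.
  by have := HY p ltac:(lia); rewrite mulrAC ler_pdivlMr // mulrC.
have gr k : mu%:R * (T (mu * k.+1) * dd (mu * (p + k.+1))) <=
   \sum_(r < mu) (T (mu * k + r).+1 * dd (mu * p + (mu * k + r))).
  rewrite mulr_natl -[X in _ *+ X](card_ord mu) -sumr_const; apply: ler_sum => r _.
  have rm := ltn_ord r.
  apply: ler_pM; rewrite ?(ltW (Tpos _)) ?(ltW (dd_gt0 _ _)) //; first by apply: Tle; rewrite mulnS; lia.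
  by apply: dd_le; rewrite mulnDr mulnS; lia.
apply: le_trans (_ : (1 + e) * (mu%:R ^+ 2 * \sum_(k < X + n) mu%:R * (T (mu * k.+1) * dd (mu * (p + k.+1)))) <= _); last first.
  apply: ler_wpM2l; first lra.
  apply: ler_wpM2l; first by rewrite exprn_ge0 // ltW.
  apply: le_trans (ler_sum _ (fun (k : 'I_(X + n)) _ => gr k)) _.
  rewrite -(sum_group (fun i => T i.+1 * dd (mu * p + i))) amE; exact: sm_ge.
rewrite !mulr_sumr big_split_ord /= -[leLHS]add0r lerD //.
  apply: sumr_ge0 => i _; apply: mulr_ge0; first lra.
  apply: mulr_ge0; first by rewrite exprn_ge0 // ltW.
  by rewrite !mulr_ge0 ?(ltW (Tpos _)) ?(ltW (dd_gt0 _ _)) // ltW.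
apply: ler_sum => k _.
have := HX (X + k).+1 (p + (X + k).+1)%N ltac:(lia) ltac:(lia).
rewrite expr1n !mul1n mul1r addnS addSn => /le_trans; apply.
by rewrite [mu%:R ^+ 3]exprSr -mulrA.
Qed.

End Asymp.

(** * From integer multiples to slow variation on the reals *)

Section RegVar.
Variables (R : realType) (a : nat -> R).
Hypotheses (a0 : forall p, 0 < a p) (ale : forall p q, (p <= q)%N -> a q <= a p).
Hypothesis a_ratio : forall e, 0 < e -> exists X, forall p, (X <= p)%N -> a p <= (1 + e) * a p.+1.
Hypothesis a_mul_le : forall mu (e : R), (0 < mu)%N -> 0 < e -> exists X, forall p, (X <= p)%N ->
  mu%:R ^+ 2 * a (mu * p) <= (1 + e) * a p.
Hypothesis a_mul_ge : forall mu (e : R), (0 < mu)%N -> 0 < e -> exists X, forall p, (X <= p)%N ->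
  a p.+1 <= (1 + e) * (mu%:R ^+ 2 * a (mu * p)%N) + e * a p.

(** The index shift costs [1 + d] by [a_ratio], and the error term moves to the left. The cap 1/4
    keeps [1 - d (1 + d)] away from 0, so that three more factors [1 + d] pay for dividing by it:
    five in all. *)
Lemma a_mul_ge1 mu (e : R) : (0 < mu)%N -> 0 < e -> exists X, forall p, (X <= p)%N ->
  a p <= (1 + e) * (mu%:R ^+ 2 * a (mu * p)%N).
Proof.
move=> m0 e0; have e4 : 0 < Num.min e (1 / 4) by rewrite lt_min e0 /=; lra.
have [d [d0 Hd]] := small_pow 5 e4.
have [me m4] : Num.min e (1 / 4) <= e /\ Num.min e (1 / 4) <= 1 / 4.
  by rewrite !ge_min !lexx orbT.
have d4 : d <= 1 / 4.
  have d1 : 1 <= 1 + d by lra.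
  have := exprn_ege1 4 d1; move: Hd; rewrite exprS; set z := _ ^+ 4 => Hd z1; nra.
have [X1 HX1] := a_mul_ge m0 d0; have [X2 HX2] := a_ratio d0.
exists (maxn X1 X2) => p pX; have := HX1 p ltac:(lia); have := HX2 p ltac:(lia).
have ap := a0 p; set y := mu%:R ^+ 2 * a _.
have y0 : 0 <= y by rewrite mulr_ge0 ?sqr_ge0 // ltW.
set x' := a p.+1; set x := a p in ap * => h1 h2.
have h3 : x <= (1 + d) * ((1 + d) * y + d * x) by apply: le_trans h1 _; rewrite ler_wpM2l //; lra.
have h4 : x * (1 - d * (1 + d)) <= (1 + d) ^+ 2 * y by rewrite expr2; nra.
have h5 : 1 <= (1 + d) ^+ 3 * (1 - d * (1 + d)).
  have d2 : d * d <= d / 4 by nra.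
  have d3 : d * d * d <= d / 4 by nra.
  have d5 : d * d * d * d <= d / 16 by nra.
  have d6 : d * d * d * d * d <= d / 16 by nra.
  rewrite !exprS expr0; lra.
apply: le_trans (_ : x * ((1 + d) ^+ 3 * (1 - d * (1 + d))) <= _).
  by rewrite ler_peMr // ltW.
rewrite mulrCA; apply: le_trans (_ : (1 + d) ^+ 3 * ((1 + d) ^+ 2 * y) <= _).
  by rewrite ler_wpM2l // exprn_ge0; lra.
by rewrite mulrA -exprD ler_wpM2r //; lra.
Qed.

Definition ext x : R := x ^+ 2 * a (Num.truncn x).

Lemma ext_gt0 x : 0 < x -> 0 < ext x.
Proof. by move=> x0; rewrite mulr_gt0 // exprn_gt0. Qed.

(** Approximate [lam] from above by [M / N]. With [n] the quotient of the integer part of [x] by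
    [N], monotonicity brackets [x] from below by [N n] and [lam x] from above by [M (n + 1)]; both
    are compared with [n] through the integer multiples. *)
Lemma ext_le lam e : 0 < lam -> 0 < e -> exists X : R, forall x, X <= x -> 0 < x ->
  ext x <= (1 + e) * ext (lam * x).
Proof.
move=> l0 e0; have [d [d0 Hd]] := small_pow 6 e0.
have [N0 HN0] := archi_nat (1 / (lam * d)).
pose N := N0.+1; have N1 : 0 < N%:R :> R by rewrite ltr0n.
have lN0 : 0 < lam * N%:R by rewrite mulr_gt0.
pose M := (Num.truncn (lam * N%:R)).+1.
have /andP[M1 M2] := truncn_itv (ltW lN0); rewrite -/M in M2.
have lNd : 1 <= lam * N%:R * d.
  move: HN0; rewrite ltr_pdivrMr ?mulr_gt0 // => H.
  have : N0%:R <= N%:R :> R by rewrite ler_nat.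
  have ld : 0 < lam * d by rewrite mulr_gt0.
  nra.
have Mle : M%:R <= (1 + d) * (lam * N%:R) by rewrite /M -natr1; lra.
have [X1 HX1] := a_mul_le (ltn0Sn N0) d0; rewrite -/N in HX1.
have [X2 HX2] := a_mul_ge1 (ltn0Sn (Num.truncn (lam * N%:R))) d0; rewrite -/M in HX2.
have [X3 HX3] := a_ratio d0.
pose X := (maxn X1 (maxn X2 X3)).
exists (N * X)%:R => x Xx x0.
pose k := Num.truncn x; pose n := (k %/ N)%N.
have /andP[k1 k2] := truncn_itv (ltW x0); rewrite -/k in k1 k2.
have nX : (X <= n)%N.
  rewrite /n leq_divRL // mulnC; rewrite /k truncn_ge_nat //; exact: ltW.
have /and3P[nX1 nX2 nX3] : [&& X1 <= n, X2 <= n & X3 <= n]%N by rewrite -!geq_max.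
have kN : (n * N <= k)%N by exact: leq_trunc_div.
have kN' : (k < n.+1 * N)%N by rewrite mulSn addnC; have := ltn_ceil k (ltn0Sn N0); rewrite -/N -/n mulSn addnC.
pose j := Num.truncn (lam * x).
have lx0 : 0 < lam * x by rewrite mulr_gt0.
have /andP[j1 j2] := truncn_itv (ltW lx0); rewrite -/j in j1 j2.
have jM : (j <= M * n.+1)%N.
  rewrite -(ler_nat R) natrM; apply: le_trans j1 _.
  apply: le_trans (_ : lam * N%:R * n.+1%:R <= _); last by rewrite ler_wpM2r // ltW.
  rewrite -mulrA ler_wpM2l ?(ltW l0) // -natrM mulnC.
  by apply: le_trans (ltW k2) _; rewrite ler_nat.
have A1 : N%:R ^+ 2 * a k <= (1 + d) * a n.
  apply: le_trans (HX1 n nX1); apply: ler_wpM2l; first by rewrite exprn_ge0 // ltW.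
  by apply: ale; rewrite mulnC.
have A2 : a n <= (1 + d) * a n.+1 by exact: HX3.
have A3 : a n.+1 <= (1 + d) * (M%:R ^+ 2 * a j).
  apply: le_trans (HX2 n.+1 (leqW nX2)) _; apply: ler_wpM2l; first lra.
  apply: ler_wpM2l; first by rewrite exprn_ge0 ?ler0n.
  by apply: ale.
have A4 : M%:R ^+ 2 <= (1 + d) ^+ 2 * (lam * N%:R) ^+ 2.
  by rewrite -exprMn lerXn2r ?nnegrE ?ler0n //; apply: mulr_ge0; lra.
have aj := a0 j; have d1 : 0 <= 1 + d by lra.
rewrite /ext -/k -/j.
rewrite -(ler_pM2l (_ : 0 < N%:R ^+ 2)); last by rewrite exprn_gt0.
rewrite mulrCA.
have x2 : 0 <= x ^+ 2 by exact: sqr_ge0.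
apply: le_trans (ler_wpM2l x2 A1) _.
apply: le_trans (_ : x ^+ 2 * ((1 + d) * ((1 + d) * ((1 + d) * ((1 + d) ^+ 2 * (lam * N%:R) ^+ 2 * a j)))) <= _).
  apply: ler_wpM2l => //; apply: ler_wpM2l => //; apply: le_trans A2 _; apply: ler_wpM2l => //.
  apply: le_trans A3 _; apply: ler_wpM2l => //; apply: ler_wpM2r => //; exact: ltW.
rewrite (_ : x ^+ 2 * _ = N%:R ^+ 2 * ((1 + d) ^+ 5 * ((lam * x) ^+ 2 * a j))); last by ring.
apply: ler_wpM2l; first by rewrite exprn_ge0 // ltW.
apply: ler_wpM2r; first by apply: mulr_ge0; [exact: sqr_ge0|exact: ltW].
apply: le_trans Hd; rewrite [leRHS]exprS ler_peMl ?exprn_ge0 //; lra.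
Qed.

Lemma ext_slow lam : 0 < lam -> (fun x => ext (lam * x) / ext x) @ +oo --> (1 : R).
Proof.
move=> l0; apply/cvgrPdist_le => e e0.
have [X1 HX1] := ext_le l0 e0.
have il0 : 0 < lam^-1 by rewrite invr_gt0.
have [X2 HX2] := ext_le il0 e0.
near=> x.
have x0 : 0 < x by near: x; exact: nbhs_pinfty_gt.
have xX1 : X1 <= x by near: x; apply: nbhs_pinfty_ge; exact: num_real.
have xX2 : X2 / lam <= x by near: x; apply: nbhs_pinfty_ge; exact: num_real.
have h1 := HX1 x xX1 x0.
have lx0 : 0 < lam * x by rewrite mulr_gt0.
have := HX2 (lam * x) _ lx0; rewrite mulKf ?gt_eqF // => h2.
have {}h2 : ext (lam * x) <= (1 + e) * ext x by apply: h2; rewrite mulrC -ler_pdivrMr //.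
have E0 := ext_gt0 x0; have F0 := ext_gt0 lx0.
(* The two bounds are [ext_le] for [lam] at [x] and for its inverse at [lam * x]. *)
rewrite ler_norml; apply/andP; split.
  by rewrite lerBrDr -lerBrDl opprK ler_pdivrMr // addrC.
rewrite lerBlDr -lerBlDl ler_pdivlMr //; nra.
Unshelve. all: by end_near.
Qed.

End RegVar.

(** * Quadratic lower and upper bounds for [A] *)

Section AsympBounds.
Variables (R : realType) (T A : nat -> R).
Local Notation hb := (hb R).
Local Notation kap := (kap R).
Local Notation dd := (dd R).
Hypotheses (Tpos : forall k, 0 < T k) (Tle : forall m n, (m <= n)%N -> T n <= T m).
Hypothesis Tsup : forall k I, \sum_(i < I) kap (k + i).+2 * T i.+1 <= T k.
Hypothesis T0 : T 0 <= 1.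
Hypothesis AT : forall p, absum (fun i => T i.+1 * dd (p + i)) /\
  A p.+1 = sm (fun i => T i.+1 * dd (p + i)).

Lemma A_lower_sq : exists c, 0 < c /\ forall p, (0 < p)%N -> c <= p%:R ^+ 2 * A p.+1.
Proof.
pose m := T 1 / 4; have m0 : 0 < m by rewrite divr_gt0.
(* Collected from [T_lower], [hb p * hb (2p) >= 1 / (8p)] and the denominator of [dd (2p)], at most
   [12 p^2]: [(3/4) / (8 * 12) = 1/128]. *)
exists (m / 128); split; first by rewrite divr_gt0.
move=> p p0; have Ap : p%:R * T p * dd (2 * p) <= A p.+1 by rewrite mul2n -addnn; exact: A_ge.
have Tp := @T_lower R T Tpos Tsup T0 p p0; rewrite -/m in Tp.
have pR : 1 <= p%:R :> R by rewrite ler1n.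
have h2 : (8 * p%:R)^-1 <= hb p * hb (2 * p).
  apply: le_trans (_ : hb (2 * p) ^+ 2 <= _); last first.
    by rewrite expr2 ler_wpM2r ?hb_ge0 // hb_le //; lia.
  have := hb_sqr_ge R (2 * p).-1; rewrite prednK ?muln_gt0 // natrM => h.
  by rewrite -div1r ler_pdivrMr; lra.
apply: le_trans (_ : p%:R ^+ 2 * (p%:R * T p * dd (2 * p)) <= _); last first.
  by rewrite ler_wpM2l // exprn_ge0.
have dE : dd (2 * p) = 3 / 4 * hb (2 * p) / ((2 * p%:R + 1) * (2 * p%:R + 2)).
  by rewrite dd_hb natrM.
apply: le_trans (_ : p%:R ^+ 3 * (m * (3 / 4)) * (8 * p%:R)^-1 / (12 * p%:R ^+ 2) <= _).
  by rewrite le_eqVlt; apply/orP; left; apply/eqP; field; rewrite gt_eqF //; lra.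
rewrite dE (_ : p%:R ^+ 2 * _ = p%:R ^+ 3 * (3 / 4) * (T p * hb (2 * p)) / ((2 * p%:R + 1) * (2 * p%:R + 2))); last by ring.
have q0 : 0 < (2 * p%:R + 1) * (2 * p%:R + 2) :> R by apply: mulr_gt0; lra.
have p3 : 0 <= p%:R ^+ 3 :> R by rewrite exprn_ge0 ?ler0n.
apply: ler_pM.
- by apply: mulr_ge0; [apply: mulr_ge0 => //; lra|rewrite invr_ge0; lra].
- by rewrite invr_ge0 mulr_ge0 // exprn_ge0 // ler0n.
- rewrite (_ : p%:R ^+ 3 * (m * (3 / 4)) * _ = p%:R ^+ 3 * (3 / 4) * (m * (8 * p%:R)^-1)); last by ring.
  apply: ler_wpM2l; first by apply: mulr_ge0 => //; lra.
  apply: le_trans (ler_wpM2l (ltW m0) h2) _; rewrite mulrA.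
  by apply: ler_wpM2r; rewrite ?hb_ge0.
- by rewrite lef_pV2 ?posrE ?mulr_gt0 ?exprn_gt0 //; rewrite ?expr2; nra.
Qed.

Lemma A_upper_sq : exists C, 0 < C /\ forall p, (4 <= p)%N -> p%:R ^+ 2 * A p.+1 <= C * ln (p%:R : R).
Proof.
have [C [C0 HC]] := @T_upper R T Tpos Tle Tsup T0; have K0 := kap0_gt0 R.
have l2 : 0 < ln (2 : R) by rewrite ln_gt0 //; lra.
have [D [D0 HD]] : exists D, 0 < D /\ forall p, A p.+1 <= D * hb p / (p%:R + 1) * T p.
  exists (3 / (4 * kap0 R)); split; last by move=> p; exact: A_upper.
  by apply: divr_gt0 => //; apply: mulr_gt0.
exists (D * C * 2 / ln 2); split; first by apply: divr_gt0 => //; rewrite !mulr_gt0.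
move=> p p4; pose n := (trunc_log 2 p).-1.
have tl : (1 < trunc_log 2 p)%N by apply: leq_trans (leq_trunc_log 2 p4).
have [b1 b2] : (2 ^ n.+1 <= p)%N /\ (p < 2 ^ n.+2)%N.
  by rewrite /n prednK ?(ltnW tl) // trunc_logP // ?trunc_log_ltn //; lia.
have n0 : (0 < n)%N by rewrite /n; lia.
have pR : 4 <= p%:R :> R by rewrite ler_nat.
have nln : n%:R <= ln (p%:R : R) / ln 2.
  rewrite ler_pdivlMr // mulr_natl -lnXn //; rewrite ler_ln ?posrE ?exprn_gt0 //; last lra.
  by rewrite -natrX ler_nat; apply: leq_trans b1; rewrite leq_exp2l.
have Tp : T p <= C * n%:R * hb (2 ^ n - 1) by apply: le_trans (Tle b1) (HC n n0).
(* Since [p < 2^(n+2)], the two squares [p hb_p^2] and [p hb_(2^n - 1)^2] are at most 1 and 4. *)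
have hh : p%:R * (hb p * hb (2 ^ n - 1)) <= 2.
  have x0 : 0 <= p%:R * (hb p * hb (2 ^ n - 1)) by rewrite !mulr_ge0 ?hb_ge0.
  rewrite -(ler_pXn2r (ltn0Sn 1)) ?nnegrE //.
  rewrite (_ : (_ * _) ^+ 2 = (p%:R * hb p ^+ 2) * (p%:R * hb (2 ^ n - 1) ^+ 2)); last by ring.
  apply: le_trans (_ : 1 * 4 <= _); last by rewrite expr2; lra.
  apply: ler_pM; rewrite ?mulr_ge0 ?exprn_ge0 ?hb_ge0 //.
    apply: le_trans (hb_sqr_le R p); rewrite mulrC ler_wpM2l ?sqr_ge0 //; lra.
  have := hb_sqr_le R (2 ^ n - 1).
  have : p%:R <= 4 * (2 * (2 ^ n - 1)%:R + 1) :> R.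
    have : (p <= 4 * (2 * (2 ^ n - 1) + 1))%N by move: b2; rewrite !expnS; have := expn_gt0 2 n; lia.
    by rewrite -(ler_nat R) natrM natrD natrM.
  have := sqr_ge0 (hb (2 ^ n - 1)); set h := hb _ ^+ 2; set z := (_ - _)%:R; nra.
have hp := hb_ge0 R p.
apply: le_trans (_ : p%:R ^+ 2 * (D * hb p / (p%:R + 1) * T p) <= _).
  by apply: ler_wpM2l; [rewrite exprn_ge0 ?ler0n|exact: HD].
apply: le_trans (_ : p%:R * (D * hb p * T p) <= _).
  rewrite expr2 -mulrA; apply: ler_wpM2l; first lra.
  rewrite (_ : p%:R * _ = D * hb p * T p * (p%:R / (p%:R + 1))); last by ring.
  rewrite ler_piMr //; first by rewrite !mulr_ge0 // ltW.
  by rewrite ler_pdivrMr; lra.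
apply: le_trans (_ : p%:R * (D * hb p * (C * n%:R * hb (2 ^ n - 1))) <= _).
  apply: ler_wpM2l; first lra.
  by apply: ler_wpM2l => //; apply: mulr_ge0 => //; exact: ltW.
rewrite (_ : p%:R * _ = D * C * (p%:R * (hb p * hb (2 ^ n - 1))) * n%:R); last by ring.
rewrite (_ : _ * ln p%:R = D * C * 2 * (ln p%:R / ln 2)); last by ring.
have DC : 0 <= D * C by rewrite mulr_ge0 ?ltW.
apply: ler_pM => //; rewrite ?ler0n //.
  by apply: mulr_ge0 => //; rewrite !mulr_ge0 ?hb_ge0.
by apply: ler_wpM2l.
Qed.

End AsympBounds.

(** * Rescaling Tutte's equation and collecting the estimates *)

Unset Implicit Arguments.
Set Strict Implicit.
Set Printing Implicit Defensive.

Theorem theorem1p1 (R : realType) (q : nat -> R) (c : R) :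
  (forall k, (0 < k)%N -> 0 <= q k) ->
  (exists k, (0 < k)%N /\ q k != 0) ->
  admissible q ->
  0 < c ->
  (fun l => Wr q l.+1 / Wr q l) @ \oo --> c ->
  (forall k, (0 < k)%N -> 0 <= q k - 2 * c ^- (2 * k) * Wr q k) ->
  exists L : R -> R,
    [/\ slowly_varying L,
        exists C : R, 0 < C /\ \forall l \near \oo, 1 <= C * `|L l%:R|,
        exists C : R, 0 < C /\ \forall l \near \oo, `|L l%:R| <= C * ln (l%:R : R)
      & (fun l : nat => Wr q l / (c ^+ l.+1 * L l%:R / (2 * l%:R ^+ 2))) @ \oo --> (1 : R)].
Proof.
move=> q0 _ qadm c0 Wratio qW.
have cn0 n : 0 < c ^+ n by rewrite exprn_gt0.
have cne n : c ^+ n != 0 by rewrite gt_eqF.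
have dS := disk_tutte q0 qadm.
(* Positivity propagates through the term [disk 0 * disk l] of Tutte's equation. *)
have dpos l : 0 < disk q l.
  elim: l => [|l IH]; first by rewrite disk0.
  have [qa ->] := dS l; rewrite big_ord_recl /= disk0 mul1r subn0 -addrA.
  apply: ltr_wpDr IH; apply: addr_ge0; last first.
    by apply: sm_ge0 => // k; rewrite mulr_ge0 ?q0 ?disk_ge0.
  by apply: sumr_ge0 => i _; rewrite mulr_ge0 ?disk_ge0.
have [A [A00 AS]] : exists A : nat -> R, A 0%N = 0 /\ forall p, A p.+1 = 2 * disk q p / c ^+ p.+1.
  by exists (fun p => if p is n.+1 then 2 * disk q n / c ^+ n.+1 else 0).
pose B k := q k.+1 * c ^+ k.
have Apos p : 0 < A p.+1 by rewrite AS divr_gt0 ?mulr_gt0.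
have B0 k : 0 <= B k by rewrite /B mulr_ge0 ?q0 ?ltW.
have tutteA p : (1 < p)%N -> absum (fun k => B k * A (p + k)%N) /\ 2 * A p = conv A A p + 2 * corr B A p.
  case: p => [|[|l]] // _; have [qa dE] := dS l.
  (* Tutte's equation at [l.+1] is multiplied by [4 / c^(l+2)]. The shift of [A] by one makes the
     powers of [c] match in the convolution, and the end terms drop out because [A 0 = 0]. *)
  have BE k : 2 / c ^+ l.+2 * (q k.+1 * disk q (l + k.+1)) = B k * A (l.+2 + k)%N.
    rewrite /B addSn addSn AS addnS (_ : c ^+ (l + k).+2 = c ^+ l.+2 * c ^+ k); last by rewrite -exprD !addSn.
    by field; rewrite !cne.
  have Ba := eq_absum BE (absumZ (2 / c ^+ l.+2) qa).
  split=> //; rewrite /corr -(eq_sm BE) smZ //.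
  rewrite /conv big_ord_recl A00 mul0r add0r big_ord_recr /= /bump /= add1n subnn A00 mulr0 addr0.
  rewrite AS dE.
  have -> : \sum_(i < l.+1) A (1 + i)%N * A (l.+2 - (1 + i))%N =
      4 / c ^+ l.+2 * \sum_(i < l.+1) disk q i * disk q (l - i).
    rewrite mulr_sumr; apply: eq_bigr => i _; have il := ltn_ord i.
    rewrite add1n subSS subSn ?AS //.
    rewrite (_ : c ^+ l.+2 = c ^+ i.+1 * c ^+ (l - i).+1); first by field; rewrite !cne.
    by rewrite -exprD; congr (_ ^+ _); lia.
  by field; rewrite cne.
have ratioA : A n.+2 / A n.+1 @[n --> \oo] --> (1 : R).
  rewrite -(cvg_shiftS (fun n => A n.+2 / A n.+1)).
  have H : Wr q n.+2 / Wr q n.+1 / c @[n --> \oo] --> c / c.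
    by apply: cvgMl; rewrite (cvg_shiftS (fun n => Wr q n.+1 / Wr q n)).
  rewrite divff ?gt_eqF // in H; apply: cvgn_eq H => n.
  rewrite -!(disk_Wr q0 qadm) // !AS (exprS c n.+2); field.
  by rewrite !cne !gt_eqF.
(* The assumption at [k.+1], multiplied by [c^k]. *)
have AB k : A k.+2 <= B k.
  have := qW k.+1 isT; rewrite -(disk_Wr q0 qadm) // AS /B => H.
  have {}H : 0 <= (q k.+1 - 2 * c ^- (2 * k.+1) * disk q k.+1) * c ^+ k by rewrite mulr_ge0 // ltW.
  rewrite -subr_ge0; apply: le_trans H _; rewrite le_eqVlt; apply/orP; left; apply/eqP.
  rewrite (_ : c ^+ (2 * k.+1) = c ^+ k.+2 * c ^+ k); last by rewrite -exprD; congr (_ ^+ _); lia.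
  by field; rewrite !cne.
have A0 p : 0 <= A p by case: p => [|p]; [rewrite A00|exact: ltW].
have [b [b0 ba b1 AE bE]] := sqrt_factor A00 Apos B0 tutteA ratioA.
have mass := mass_le1 A00 Apos B0 tutteA ratioA.
have Aa : absum A.
  by apply: (absum_ge0 (M := 1)) => // n; apply: le_trans (mass n); rewrite lerDl sumr_ge0.
have Ba : absum B.
  by apply: (absum_ge0 (M := 1)) => // n; apply: le_trans (mass n); rewrite lerDr sumr_ge0.
pose T := tl b.
have Tpos := T_gt0 Apos Aa Ba b0 ba b1 bE AB.
have Tle := T_le b0 ba.
have Tsup := T_super Aa Ba b0 ba b1 AE bE AB.
have AT := A_T Aa Ba b0 ba b1 AE bE AB.
have T0 : T 0%N <= 1.
  by apply: le_trans b1; apply: tl_le.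
have a_ratio e : 0 < e -> exists X, forall p, (X <= p)%N -> A p.+1 <= (1 + e) * A p.+2.
  move=> e0; have d0 : 0 < e / (1 + e) by rewrite divr_gt0 //; lra.
  move/cvgrPdist_le: ratioA => /(_ _ d0) [X _ HX]; exists X => p Xp.
  have := HX p Xp => /=; rewrite ler_norml => /andP[_].
  rewrite lerBlDr -lerBlDl ler_pdivlMr ?Apos //.
  rewrite (_ : 1 - e / (1 + e) = (1 + e)^-1); last by field; lra.
  by rewrite mulrC ler_pdivrMr; [rewrite mulrC|lra].
pose a p := A p.+1.
have natE l : ext a l%:R = l%:R ^+ 2 * A l.+1 by rewrite /ext natrK.
have L0 l : 0 <= ext a l%:R by rewrite natE mulr_ge0 ?sqr_ge0.
exists (ext a); split.
- have aml mu (e : R) := A_mul_le Tpos Tle Tsup T0 AT (mu := mu) (e := e).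
  have amg mu (e : R) := A_mul_ge Tpos Tle Tsup T0 AT (mu := mu) (e := e).
  move=> lam l0; exact: (@ext_slow R a Apos (fun p q => A_le Tpos AT (p := p) (q := q)) a_ratio aml amg lam l0).
- have [k [k0 Hk]] := A_lower_sq Tpos Tle Tsup T0 AT.
  exists k^-1; split; first by rewrite invr_gt0.
  exists 1%N => // l /= l1; rewrite ger0_norm // natE.
  by rewrite mulrC ler_pdivlMr // mul1r Hk.
- have [C [C0 HC]] := A_upper_sq Tpos Tle Tsup T0 AT.
  exists C; split=> //; exists 4%N => // l /= l4.
  by rewrite ger0_norm // natE HC.
(* With this choice of the slowly varying function the quotient equals 1 for every [l >= 1]. *)
- apply: cvg_near_cst.
  exists 1%N => // l /= l1; rewrite natE AS -(disk_Wr q0 qadm) //.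
  by field; rewrite !cne pnatr_eq0 gt_eqF //= gt_eqF.
Qed.
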